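(* Let $T>0$, and let $\omega\subset\Omega=(0,1)$ be an interval. Let also $\overline u\in L^2(0,T;H^2(0,1)\cap H^1_0(0,1))$ with $\overline u_t\in L^2(Q_T)$ furnish initial and final data $\overline u(0,x)$ and $\overline u(T,x)$. Let $\mathcal A_0$, $\mathcal A=\overline u+\mathcal A_0$, the corrector map $\mathbf T:\mathcal A\to H^1_0(Q_T)$ and the functional $E_T:\mathcal A\to[0,\infty)$ be as defined in the context. The following are equivalent: (1) the trace $\overline u(T,x)$ for $t=T$ of $\overline u$ is approximately controllable from $\overline u(0,x)$ through $\omega$, that is, for every $\epsilon>0$ there is $u_\epsilon\in\mathcal A$ such that $E_T(u_\epsilon)<\epsilon$; (2) the unique continuation property holds, that is, the only $v\in\operatorname{im}\mathbf T\subset H^1_0(Q_T)$ with $v\equiv0$ in $q_T$ and $$\int_{Q_T\setminus q_T}(-Uv_t+U_xv_x)\,dx\,dt=0\quad\text{for all }U\in\mathcal A_0$$ is the trivial one $v\equiv0$; (3) $E_T$ is an error functional, that is, for $u\in\mathcal A$, $E_T'(u)=0$ implies $E_T(u)=0$.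
   Context: Notation: $Q_T=(0,T)\times(0,1)$ with points $(t,x)$, $q_T=(0,T)\times\omega$; subscripts $t,x$ denote weak partial derivatives; boundary values are understood in the sense of traces; $\chi_{S}$ is the indicator function of a set $S$. Put $$\mathcal A_0=\{U\in L^2(0,T;H^2(0,1)\cap H^1_0(0,1)): U_t\in L^2(Q_T),\ U=0\text{ on }\partial Q_T\},\qquad \mathcal A=\overline u+\mathcal A_0.$$ For $u\in\mathcal A$, its corrector $v\in H^1_0(Q_T)$ is the unique (weak) solution of $$v_{tt}+v_{xx}=\chi_{Q_T\setminus q_T}(t,x)\,(u_t-u_{xx})\ \text{ in }Q_T,\qquad v=0\ \text{ on }\partial Q_T.$$ The map $\mathbf T:\mathcal A\to H^1_0(Q_T)$ takes $u$ to its corrector $v$, and $\operatorname{im}\mathbf T=\{\mathbf T u:u\in\mathcal A\}$. The functional $E_T$ is $$E_T(u)=\frac12\int_{Q_T}(v_t^2+v_x^2)\,dx\,dt,\qquad v=\mathbf T u.$$ The derivative is taken in directions of $\mathcal A_0$: $\langle E_T'(u),U\rangle=\frac{d}{d\epsilon}E_T(u+\epsilon U)\big|_{\epsilon=0}$ for $U\in\mathcal A_0$, and $E_T'(u)=0$ means $\langle E_T'(u),U\rangle=0$ for all $U\in\mathcal A_0$. *)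

(* Defs.v *)
From HB Require Import structures.
From mathcomp Require Import all_boot all_order all_algebra.
From mathcomp Require Import all_classical all_reals all_analysis.
Set Implicit Arguments.
Unset Strict Implicit.
Unset Printing Implicit Defensive.
Import Order.TTheory GRing.Theory Num.Theory.
Import numFieldNormedType.Exports.

Local Open Scope classical_set_scope.
Local Open Scope ring_scope.

Section Smooth.
Context {R : realType} {V : normedModType R}.

Definition iterD (s : seq V) (f : V -> R) : V -> R :=
  foldr (fun e g => 'D_e g) f s.

(* Used for V = R and V = R * R, where it says that f is of class C^oo. *)
Definition smooth (f : V -> R) : Prop :=
  forall (s : seq V) (x : V), differentiable (iterD s f) x.

Definition test_function (D : set V) (f : V -> R) : Prop :=
  smooth f /\
  exists K : set V, [/\ compact K, K `<=` D & forall x, ~ K x -> f x = 0].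

End Smooth.

Definition L2 {R : realType} {d : measure_display} {X : measurableType d}
    (mu : {measure set X -> \bar R}) (D : set X) (f : X -> R) : Prop :=
  f \_ D \in Lfun mu 2%:E.

(* Functions are honest functions on R or R * R; only their values in the
   domain count, and these only up to almost-everywhere equality. *)

Definition I01 {R : realType} : set R := `]0, 1[%classic.

Section UnitInterval.
Context {R : realType}.
Local Notation mu := (@lebesgue_measure R).
Local Notation I := (@I01 R).
Implicit Types h g : R -> R.

(* h and g belong to L^2(0,1) and h' = g weakly *)
Definition wderiv1 h g : Prop :=
  [/\ L2 mu I h, L2 mu I g &
      forall f : R -> R, test_function I f ->
        \int[mu]_(x in I) (h x * 'D_1 f x) = - \int[mu]_(x in I) (g x * f x)].

(* h belongs to H^2(0,1), with h' = h1 and h'' = h2 *)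
Definition H2_with h h1 h2 : Prop := wderiv1 h h1 /\ wderiv1 h1 h2.

(* H^1_0(0,1), the closure of the test functions in H^1(0,1) *)
Definition H10_unit h : Prop :=
  exists2 g, wderiv1 h g &
    forall eps : R, 0 < eps -> exists2 f : R -> R, test_function I f &
      (\int[mu]_(x in I) ((h x - f x) ^+ 2 + (g x - 'D_1 f x) ^+ 2)%:E
        < eps%:E)%E.

End UnitInterval.

Definition mu2 {R : realType} :=
  (@lebesgue_measure R \x @lebesgue_measure R)%E.

Definition QT {R : realType} (T : R) : set (R * R) := `]0, T[%classic `*` I01.
Definition qT {R : realType} (T : R) (omega : set R) : set (R * R) :=
  `]0, T[%classic `*` omega.

Section Cylinder.
Context {R : realType} (T : R).
Local Notation mu := (@lebesgue_measure R).
Local Notation Q := (QT T).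
Implicit Types u v w g f : R * R -> R.

(* u and g belong to L^2(Q_T) and g is the weak derivative of u along e *)
Definition wderiv (e : R * R) u g : Prop :=
  [/\ L2 mu2 Q u, L2 mu2 Q g &
      forall f, test_function Q f ->
        \int[mu2]_(p in Q) (u p * 'D_e f p) = - \int[mu2]_(p in Q) (g p * f p)].

(* The weak partial derivatives in L^2(Q_T), when they exist; points are
   (t, x). *)
Definition dt u : R * R -> R := xget (cst 0) [set g | wderiv (1, 0) u g].
Definition dx u : R * R -> R := xget (cst 0) [set g | wderiv (0, 1) u g].

Definition H1 u : Prop :=
  (exists g, wderiv (1, 0) u g) /\ (exists g, wderiv (0, 1) u g).

(* squared H^1(Q_T) distance between u in H^1(Q_T) and a smooth f *)
Definition H1dist2 u f : \bar R :=
  (\int[mu2]_(p in Q) ((u p - f p) ^+ 2 + (dt u p - 'D_(1, 0) f p) ^+ 2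
                       + (dx u p - 'D_(0, 1) f p) ^+ 2)%:E)%E.

(* H^1_0(Q_T), the closure of the test functions in H^1(Q_T) *)
Definition H10 v : Prop :=
  H1 v /\ forall eps : R, 0 < eps ->
    exists2 f, test_function Q f & (H1dist2 v f < eps%:E)%E.

(* squared norm in L^2 of the boundary of Q_T of the restriction of f *)
Definition boundary_norm2 f : \bar R :=
  (\int[mu]_(t in (`]0, T[%classic)%R) (f (t, 0) ^+ 2 + f (t, 1) ^+ 2)%:E
   + \int[mu]_(x in I01) (f (0, x) ^+ 2 + f (T, x) ^+ 2)%:E)%E.

(* The trace operator is the continuous extension to H^1(Q_T), with values in
   L^2 of the boundary, of the restriction of functions smooth up to the
   boundary. Hence u has trace 0 when it is the H^1 limit of smooth functions
   whose boundary values tend to 0 in L^2. *)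
Definition zero_trace u : Prop :=
  H1 u /\ forall eps : R, 0 < eps ->
    exists f, [/\ smooth f, (H1dist2 u f < eps%:E)%E
                & (boundary_norm2 f < eps%:E)%E].

(* L^2(0,T; H^2(0,1) /\ H^1_0(0,1)). With L^2(0,T; L^2(0,1)) = L^2(Q_T), strong
   measurability and square integrability of t |-> u(t,.) in H^2(0,1) mean
   that u and the slicewise derivatives w1 and w2 are (represented by) elements
   of L^2(Q_T). *)
Definition L2_H2_H10 u : Prop :=
  L2 mu2 Q u /\
  exists w1 w2, [/\ L2 mu2 Q w1, L2 mu2 Q w2 &
    {ae mu, forall t : R, (`]0, T[%classic)%R t ->
      H2_with (fun x => u (t, x)) (fun x => w1 (t, x)) (fun x => w2 (t, x)) /\
      H10_unit (fun x => u (t, x))}].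

Definition dt_in_L2 u : Prop := exists g, wderiv (1, 0) u g.

Definition A0 : set (R * R -> R) :=
  [set U | [/\ L2_H2_H10 U, dt_in_L2 U & zero_trace U]].

Definition A ubar : set (R * R -> R) := [set ubar \+ U | U in A0].

Variable omega : set R.
Local Notation q := (qT T omega).

Definition is_corrector u v : Prop :=
  H10 v /\ forall w, H10 w ->
    \int[mu2]_(p in Q) (dt v p * dt w p + dx v p * dx w p) =
    - \int[mu2]_(p in Q) (\1_(Q `\` q) p * (dt u p - dx (dx u) p) * w p).

Definition corrector u : R * R -> R := xget (cst 0) [set v | is_corrector u v].

Definition ET u : R :=
  2^-1 * \int[mu2]_(p in Q) (dt (corrector u) p ^+ 2 + dx (corrector u) p ^+ 2).

(* <E_T'(u), U> = l *)
Definition ET_derivative u U (l : R) : Prop :=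
  is_derive (0 : R) (1 : R) (fun eps : R => ET (fun p => u p + eps * U p)) l.

Definition ET_critical u : Prop := forall U, A0 U -> ET_derivative u U 0.

End Cylinder.

(* Main.v *)
(* Write chi for the indicator of Q_T \ q_T, which depends on x only. All three
   statements hold, for one and the same reason: if v in H^1_0(Q_T) satisfies
   int chi (U_t - U_xx) v = 0 for every smooth U vanishing on the boundary, then
   chi v = 0. Indeed U = phi(t) sin(k pi x) and an integration by parts in t
   give int chi phi sin(k pi x) (-v_t + (k pi)^2 v) = 0 first for phi vanishing
   at 0 and T and then, by dominated convergence, for phi = e^(jt); a second
   integration by parts yields (j + (k pi)^2) int e^(jt) sin(k pi x) chi v = 0.
   Hence sin(pi x) chi v is orthogonal to all polynomials in e^t and cos(pi x),
   and these approximate the indicators of quadrants.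
   (2) If v = 0 in q_T then v_x = 0 in q_T, so that both integrals over
   Q_T \ q_T become the one above.
   (3) If v is the corrector of a critical u then testing the correctors of
   u + eps U against v gives int chi (U_t - U_xx) v = 0, so chi v = 0, and
   |v|^2 = - int chi (u_t - u_xx) v = 0.
   (1) The projection m of 0 on the closure of the affine space of correctors
   is orthogonal to their differences, so chi m = 0; then m is orthogonal to the
   correctors themselves, which forces m = 0. *)

From HB Require Import structures.
Require Import Defs.
From mathcomp Require Import all_boot all_order all_algebra.
From mathcomp Require Import all_classical all_reals all_analysis.
From mathcomp Require Import measurable_realfun ring lra.
Set Implicit Arguments.
Unset Strict Implicit.
Unset Printing Implicit Defensive.
Import Order.TTheory GRing.Theory Num.Theory.
Import numFieldNormedType.Exports.
Local Open Scope classical_set_scope.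
Local Open Scope ring_scope.

(** The obstacle is the jump of chi at the ends of omega: an integral carrying chi can be integrated
    by parts in t, but not in x. Hence the choice U = phi(t) sin(k pi x): the sine is an
    eigenfunction, so that U_xx is a multiple of U and no x-derivative has to be moved onto v.
    Replacing phi by cutoffs of e^(jt) would involve the derivative of the cutoff, which blows up at
    0 and T; once the t-derivative sits on v, only phi itself remains and bounded pointwise
    convergence suffices. The second integration by parts has no boundary terms since v is in H^1_0,
    and its factor j + (k pi)^2 is positive for k >= 1. Multiplication by cos(pi x) turns a sine
    into a combination of the two neighbouring ones, which gives sin(pi x) times all powers of
    cos(pi x) without the completeness of Fourier series. Existence of correctors is never
    established: [corrector] defaults to 0, and each of the three arguments treats that case
    separately. *)

Lemma discriminant_le0 {R : realFieldType} (a b c : R) :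
  (forall t, 0 <= a + 2 * t * b + t ^+ 2 * c) -> b ^+ 2 <= a * c.
Proof.
move=> H.
have c0 : 0 <= c.
  rewrite leNgt; apply/negP => c0.
  (* If c < 0, this k >= 1 makes k^2 c at most -k (|a| + 2|b| + 1), which outweighs the other
     terms. *)
  pose k := (`|a| + 2 * `|b| + 1) / - c + 1.
  have k1 : 1 <= k.
    by rewrite lerDr divr_ge0// ?oppr_ge0 ?ltW// !addr_ge0// mulr_ge0.
  have kc : k * c = - (`|a| + 2 * `|b| + 1) + c by rewrite /k; field; rewrite lt_eqF.
  have := H k; rewrite expr2 -(mulrA k k) kc.
  have := ler_norm a; have := ler_norm b; have := normr_ge0 a; have := normr_ge0 b.
  nra.
have [c_eq0|cn0] := eqVneq c 0.
  rewrite c_eq0 mulr0; have h t : 0 <= a + 2 * t * b by have := H t; rewrite c_eq0; lra.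
  have [->|b0] := eqVneq b 0; first by rewrite expr0n.
  have := h (- (a + 1) / (2 * b)).
  have -> : a + 2 * (- (a + 1) / (2 * b)) * b = -1 by field; rewrite b0.
  by lra.
have cp : 0 < c by rewrite lt_def cn0.
have := H (- b / c).
have -> : a + 2 * (- b / c) * b + (- b / c) ^+ 2 * c = (a * c - b ^+ 2) / c.
  by field; rewrite cn0.
by rewrite pmulr_lge0 ?invr_gt0// subr_ge0.
Qed.

Lemma geometric_half_le2 {R : realFieldType} n :
  \sum_(0 <= k < n) (2^-1 ^+ k) <= 2 :> R.
Proof.
suff -> : \sum_(0 <= k < n) (2^-1 ^+ k) = 2 - 2 * 2^-1 ^+ n :> R.
  by rewrite lerBlDr lerDl mulr_ge0// exprn_ge0// invr_ge0.
elim: n => [|n IH]; first by rewrite big_geq// expr0; ring.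
by rewrite big_nat_recr//= IH exprS; field.
Qed.

Lemma ae_imp {R : realType} {d} {X : measurableType d}
    (mu : {measure set X -> \bar R}) (P Q : X -> Prop) :
  (forall x, P x -> Q x) -> {ae mu, forall x, P x} -> {ae mu, forall x, Q x}.
Proof. by move=> PQ; apply: filterS. Qed.

Lemma ae_and {R : realType} {d} {X : measurableType d}
    (mu : {measure set X -> \bar R}) (P Q : X -> Prop) :
  {ae mu, forall x, P x} -> {ae mu, forall x, Q x} ->
  {ae mu, forall x, P x /\ Q x}.
Proof. by move=> hP hQ; apply: filterS2 hP hQ => x. Qed.

(** * Square-integrable functions *)

Section L2theory.
Context {R : realType} {d : measure_display} {X : measurableType d}.
Context (mu : {measure set X -> \bar R}) (D : set X) (mD : measurable D).
Local Notation integ f := (mu.-integrable D (EFin \o (f : X -> R))).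
Local Notation L2 := (L2 mu D).
Implicit Types f g h : X -> R.

Lemma L2P f : L2 f <-> measurable_fun D f /\ integ (fun x => f x ^+ 2).
Proof.
have -> : integ (fun x => f x ^+ 2) <->
    mu.-integrable setT (EFin \o (fun x => (f \_ D) x ^+ 2)).
  rewrite (integrable_mkcond _ mD).
  suff -> : (EFin \o (fun x => f x ^+ 2)) \_ D = EFin \o (fun x => (f \_ D) x ^+ 2) by [].
  apply/funext => x; rewrite /= !patchE; case: ifP => // _.
  by rewrite expr0n.
have <- : measurable_fun setT (f \_ D) <-> measurable_fun D f.
  exact: iff_sym (measurable_restrictT f mD).
rewrite /Defs.L2; split.
  move=> Lf; split; last by exact: Lfun2_integrable_sqr Lf.
  by move: Lf; rewrite inE => /andP[] /[!inE].
move=> [mf If]; rewrite inE; apply/andP; split; rewrite inE//.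
rewrite /finite_norm unlock /Lnorm/=.
apply: poweR_lty.
have -> : (\int[mu]_x `|((f \_ D) x)%:E| `^ 2 = \int[mu]_x `|(((f \_ D) x) ^+ 2)%:E|)%E.
  apply: eq_integral => x _.
  by rewrite /= powR_mulrn// normrX.
by have /integrableP[] := If.
Qed.

Lemma IgD f g : integ f -> integ g -> integ (fun x => f x + g x).
Proof. by move=> If Ig; exact: (integrableD mD If Ig). Qed.

Lemma IgZ a f : integ f -> integ (fun x => a * f x).
Proof. by move=> If; exact: (integrableZl mD a If). Qed.

Lemma Ig_measurable f : integ f -> measurable_fun D f.
Proof. by move=> /measurable_int /measurable_EFinP. Qed.

Lemma Ig_le f g : measurable_fun D f -> integ g ->
  (forall x, D x -> `|f x| <= g x) -> integ f.
Proof.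
move=> mf Ig fg; apply: (le_integrable mD _ _ Ig) => [|x Dx].
  exact/measurable_EFinP.
by rewrite lee_fin (le_trans (fg _ Dx))// ler_norm.
Qed.

Lemma L2_measurable f : L2 f -> measurable_fun D f.
Proof. by case/L2P. Qed.

Lemma L2_sqr f : L2 f -> integ (fun x => f x ^+ 2).
Proof. by case/L2P. Qed.

Lemma L2_mul f g : L2 f -> L2 g -> integ (fun x => f x * g x).
Proof.
move=> /L2P[mf If] /L2P[mg Ig].
apply: (Ig_le (g := fun x => f x ^+ 2 + g x ^+ 2)).
- exact: measurable_funM.
- exact: IgD.
- move=> x _; rewrite normrM -(real_normK (num_real (f x))) -(real_normK (num_real (g x))).
  have := sqr_ge0 (`|f x| - `|g x|); have := normr_ge0 (f x).
  have := normr_ge0 (g x); nra.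
Qed.

Lemma L2D f g : L2 f -> L2 g -> L2 (fun x => f x + g x).
Proof.
move=> Lf Lg; have /L2P[mf If] := Lf; have /L2P[mg Ig] := Lg.
apply/L2P; split; first exact: measurable_funD.
have := IgD (IgD If Ig) (IgZ 2 (L2_mul Lf Lg)).
apply: eq_integrable => //x _ /=; congr EFin; ring.
Qed.

Lemma L2Z a f : L2 f -> L2 (fun x => a * f x).
Proof.
move=> /L2P[mf If]; apply/L2P; split; first exact: measurable_funM.
have := IgZ (a ^+ 2) If.
by apply: eq_integrable => // x _ /=; rewrite exprMn.
Qed.

Lemma L2N f : L2 f -> L2 (fun x => - f x).
Proof.
by move=> /(L2Z (-1)); under eq_fun do rewrite mulN1r.
Qed.

Lemma L2B f g : L2 f -> L2 g -> L2 (fun x => f x - g x).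
Proof. by move=> Lf /L2N; exact: L2D. Qed.

Lemma L2_bddM (M : R) g f : measurable_fun D g -> (forall x, D x -> `|g x| <= M) ->
  L2 f -> L2 (fun x => g x * f x).
Proof.
move=> mg gM /L2P[mf If]; apply/L2P; split; first exact: measurable_funM.
apply: (Ig_le _ (IgZ (M ^+ 2) If)).
  by apply: measurable_funX; exact: measurable_funM.
move=> x Dx; rewrite exprMn normrM !ger0_norm ?sqr_ge0//.
rewrite ler_wpM2r ?sqr_ge0// -(real_normK (num_real (g x))) lerXn2r ?nnegrE//; last exact: gM.
by rewrite (le_trans _ (gM _ Dx)).
Qed.

Lemma Ig_bddM (M : R) g f : measurable_fun D g -> (forall x, D x -> `|g x| <= M) ->
  integ f -> integ (fun x => g x * f x).
Proof.
move=> mg gM If; apply: (Ig_le (g := fun x => M * `|f x|)).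
- by apply: measurable_funM => //; exact: Ig_measurable.
- by apply: IgZ; exact: (integrable_norm If).
- by move=> x Dx; rewrite normrM ler_wpM2r// gM.
Qed.

Lemma Ig_bdd (M : R) g : (mu D < +oo)%E -> measurable_fun D g ->
  (forall x, D x -> `|g x| <= M) -> integ g.
Proof.
move=> muD mg gM; apply: (Ig_le (g := cst M)) => //.
  apply/integrableP; split; first exact/measurable_EFinP/measurable_cst.
  by rewrite (@integral_cst _ _ _ mu D mD `|M|%:E)// lte_mul_pinfty// lee_fin.
Qed.

Lemma L2_bdd (M : R) g : (mu D < +oo)%E -> measurable_fun D g ->
  (forall x, D x -> `|g x| <= M) -> L2 g.
Proof.
move=> muD mg gM; apply/L2P; split => //.
apply: (Ig_bdd (M := M ^+ 2)) => //; first exact: measurable_funX.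
move=> x Dx; rewrite normrX lerXn2r ?nnegrE//; last exact: gM.
by rewrite (le_trans _ (gM _ Dx)).
Qed.

Lemma eq_Rintegral_ae f g : measurable_fun D f -> measurable_fun D g ->
  {ae mu, forall x, D x -> f x = g x} ->
  \int[mu]_(x in D) f x = \int[mu]_(x in D) g x.
Proof.
move=> mf mg fg; congr fine; apply: ae_eq_integral => //.
- exact/measurable_EFinP.
- exact/measurable_EFinP.
- by apply: filterS fg => x /= fg Dx; rewrite fg.
Qed.

Definition ip f g := \int[mu]_(x in D) (f x * g x).

Lemma ipE f g : ip f g = \int[mu]_(x in D) (f x * g x).
Proof. by []. Qed.

Lemma ipC f g : ip f g = ip g f.
Proof. by apply: eq_Rintegral => x _; rewrite mulrC. Qed.

Lemma ip_ge0 f : 0 <= ip f f.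
Proof. by apply: Rintegral_ge0 => x _; rewrite -expr2 sqr_ge0. Qed.

Lemma ipDl f g h : L2 f -> L2 g -> L2 h ->
  ip (fun x => f x + g x) h = ip f h + ip g h.
Proof.
move=> Lf Lg Lh; rewrite /ip -RintegralD//; try exact: L2_mul.
by apply: eq_Rintegral => x _; rewrite mulrDl.
Qed.

Lemma ipZl a f h : L2 f -> L2 h -> ip (fun x => a * f x) h = a * ip f h.
Proof.
move=> Lf Lh; rewrite /ip -RintegralZl//; try exact: L2_mul.
by apply: eq_Rintegral => x _; rewrite mulrA.
Qed.

Lemma ipNl f h : L2 f -> L2 h -> ip (fun x => - f x) h = - ip f h.
Proof.
move=> Lf Lh; rewrite -mulN1r -ipZl//.
by apply: eq_Rintegral => x _; rewrite mulN1r.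
Qed.

Lemma ipBl f g h : L2 f -> L2 g -> L2 h ->
  ip (fun x => f x - g x) h = ip f h - ip g h.
Proof. by move=> Lf Lg Lh; rewrite ipDl ?ipNl//; exact: L2N. Qed.

Lemma ipDr f g h : L2 f -> L2 g -> L2 h ->
  ip h (fun x => f x + g x) = ip h f + ip h g.
Proof. by move=> *; rewrite ipC ipDl// !(ipC h). Qed.

Lemma ipZr a f h : L2 f -> L2 h -> ip h (fun x => a * f x) = a * ip h f.
Proof. by move=> *; rewrite ipC ipZl// !(ipC h). Qed.

Lemma ipBr f g h : L2 f -> L2 g -> L2 h ->
  ip h (fun x => f x - g x) = ip h f - ip h g.
Proof. by move=> *; rewrite ipC ipBl// !(ipC h). Qed.

Lemma ip_sqrD f g : L2 f -> L2 g ->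
  ip (fun x => f x + g x) (fun x => f x + g x) = ip f f + 2 * ip f g + ip g g.
Proof.
move=> Lf Lg; have LD := L2D Lf Lg.
rewrite ipDl// !ipDr// (ipC g f); ring.
Qed.

Lemma ip_sqrB f g : L2 f -> L2 g ->
  ip (fun x => f x - g x) (fun x => f x - g x) = ip f f - 2 * ip f g + ip g g.
Proof.
move=> Lf Lg; have LD := L2B Lf Lg.
rewrite ipBl// !ipBr// (ipC g f); ring.
Qed.

Lemma ip_tri f g : L2 f -> L2 g ->
  ip (fun x => f x + g x) (fun x => f x + g x) <= 2 * ip f f + 2 * ip g g.
Proof.
move=> Lf Lg; have := ip_ge0 (fun x => f x - g x).
rewrite (ip_sqrD Lf Lg) (ip_sqrB Lf Lg); lra.
Qed.

Lemma ip_triB f g : L2 f -> L2 g ->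
  ip (fun x => f x - g x) (fun x => f x - g x) <= 2 * ip f f + 2 * ip g g.
Proof.
move=> Lf Lg; have := ip_ge0 (fun x => f x + g x).
rewrite (ip_sqrD Lf Lg) (ip_sqrB Lf Lg); lra.
Qed.

Lemma ip_sqrZ a f : L2 f -> ip (fun x => a * f x) (fun x => a * f x) = a ^+ 2 * ip f f.
Proof. by move=> Lf; have LZ := L2Z a Lf; rewrite ipZl// ipZr// mulrA. Qed.

Lemma ip_distC f g :
  ip (fun x => f x - g x) (fun x => f x - g x) =
  ip (fun x => g x - f x) (fun x => g x - f x).
Proof. by apply: eq_Rintegral => x _; ring. Qed.

Lemma ip_sqr_ae f g : L2 f -> L2 g ->
  {ae mu, forall x, D x -> f x = g x} -> ip f f = ip g g.
Proof.
move=> Lf Lg fg; apply: eq_Rintegral_ae.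
- exact: (Ig_measurable (L2_mul Lf Lf)).
- exact: (Ig_measurable (L2_mul Lg Lg)).
- by apply: filterS fg => x /= fg Dx; rewrite fg.
Qed.

Lemma ip_ael f g h : L2 f -> L2 g -> L2 h ->
  {ae mu, forall x, D x -> f x = g x} -> ip f h = ip g h.
Proof.
move=> Lf Lg Lh fg; apply: eq_Rintegral_ae.
- exact: (Ig_measurable (L2_mul Lf Lh)).
- exact: (Ig_measurable (L2_mul Lg Lh)).
- by apply: filterS fg => x /= fg Dx; rewrite fg.
Qed.

Lemma ip_CS f g : L2 f -> L2 g -> ip f g ^+ 2 <= ip f f * ip g g.
Proof.
move=> Lf Lg; apply: discriminant_le0 => t.
have := ip_ge0 (fun x => f x + t * g x).
have Lt := L2Z t Lg; have Lft := L2D Lf Lt.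
rewrite !(ipDl, ipDr)// !(ipZr, ipZl)// (ipC g f).
move=> /le_trans; apply; rewrite le_eqVlt; apply/orP; left; apply/eqP; ring.
Qed.

Lemma integral_sqr3 f g h : L2 f -> L2 g -> L2 h ->
  (\int[mu]_(x in D) (f x ^+ 2 + g x ^+ 2 + h x ^+ 2)%:E =
   (ip f f + ip g g + ip h h)%:E)%E.
Proof.
move=> Lf Lg Lh.
have If := L2_sqr Lf; have Ig := L2_sqr Lg; have Ih := L2_sqr Lh.
have E k : ip k k = \int[mu]_(x in D) (k x ^+ 2) by apply: eq_Rintegral => x _; rewrite expr2.
rewrite !E.
rewrite -RintegralD// -RintegralD//; last exact: IgD.
by rewrite /Rintegral fineK//; apply: integrable_fin_num => //; do 2 ?apply: IgD.
Qed.

Lemma ip_CS2 (A B f g : X -> R) (eps : R) : L2 A -> L2 B -> L2 f -> L2 g ->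
  ip f f <= eps -> ip g g <= eps ->
  (ip A f + ip B g) ^+ 2 <= 2 * (ip A A + ip B B) * eps.
Proof.
move=> LA LB Lf Lg fe ge.
have h1 := ip_CS LA Lf; have h2 := ip_CS LB Lg.
have h3 := ler_wpM2l (ip_ge0 A) fe; have h4 := ler_wpM2l (ip_ge0 B) ge.
have := sqr_ge0 (ip A f - ip B g).
move: (ip A f) (ip B g) (ip A A) (ip B B) (ip f f) (ip g g) h1 h2 h3 h4 => a b x y z t.
nra.
Qed.

(** With a_k = g_(k+1) - g_k, the integral of the sum of 2^k a_k^2 is at most the sum of 2^k 4^(-k),
    so this sum is finite almost everywhere. Since |a_k| <= 2^k a_k^2 + 2^(-k), the telescoping
    series then converges absolutely. *)
Lemma L2_rapid_cvg (g : nat -> X -> R) : (forall k, L2 (g k)) ->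
  (forall k, ip (fun x => g k.+1 x - g k x) (fun x => g k.+1 x - g k x)
     <= (4^-1) ^+ k) ->
  {ae mu, forall x, D x -> cvgn (fun k => g k x)}.
Proof.
move=> Lg gk.
have Ld k : L2 (fun x => g k.+1 x - g k x) by exact: L2B.
pose h k x := ((2 ^+ k * (g k.+1 x - g k x) ^+ 2)%:E).
have h0 k x : (0 <= h k x)%E by rewrite lee_fin mulr_ge0 ?sqr_ge0// exprn_ge0.
have mh k : measurable_fun D (h k).
  exact/(measurable_int mu)/IgZ/L2_sqr.
have mS : measurable_fun D (fun x => \sum_(k <oo) h k x)%E.
  exact: (@ge0_emeasurable_sum _ _ _ D h xpredT).
have int : (\int[mu]_(x in D) (\sum_(k <oo) h k x) < +oo)%E.
  rewrite integral_nneseries//.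
  apply: (@le_lt_trans _ _ 2%:E); last exact: ltry.
  apply: lime_le; first by apply: is_cvg_nneseries => n _ _; exact: integral_ge0.
  apply: nearW => n.
  apply: (@le_trans _ _ (\sum_(0 <= k < n) (2^-1 ^+ k)%:E)%E); last first.
    by rewrite sumEFin lee_fin geometric_half_le2.
  apply: lee_sum => k _; rewrite /h.
  have := integrable_fin_num mD (IgZ (2 ^+ k) (L2_sqr (Ld k))).
  move=> /fineK <-; rewrite lee_fin.
  rewrite [leLHS](RintegralZl (2 ^+ k) mD (L2_sqr (Ld k))).
  have -> : 2^-1 ^+ k = 2 ^+ k * 4^-1 ^+ k :> R by rewrite -exprMn; congr (_ ^+ k); field.
  rewrite ler_wpM2l ?exprn_ge0//.
  by apply: le_trans (gk k); rewrite /ip; under eq_Rintegral do rewrite expr2.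
have iS : mu.-integrable D (fun x => \sum_(k <oo) h k x)%E.
  apply/integrableP; split => //.
  under eq_integral => x _ do rewrite gee0_abs ?nneseries_ge0//.
  by [].
apply: filterS (integrable_ae mD iS) => x /= Sx Dx.
have -> : (fun k => g k x) = (fun k => g 0%N x + series (telescope (g^~ x)) k).
  by apply/funext => k; exact: eq_sum_telescope.
apply: is_cvgD; first exact: is_cvg_cst.
apply: normed_cvg; apply: nondecreasing_is_cvgn.
  by apply: nondecreasing_series => n _ _; exact: normr_ge0.
exists (fine (\sum_(k <oo) h k x)%E + 2) => _ [n _ <-].
rewrite /series/=.
apply: (@le_trans _ _ (\sum_(0 <= k < n) (2 ^+ k * (g k.+1 x - g k x) ^+ 2 + 2^-1 ^+ k))).
  apply: ler_sum => k _; rewrite /telescope/=; set a := g k.+1 x - g k x.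
  have p0 : 0 < 2 ^+ k :> R by rewrite exprn_gt0.
  rewrite exprVn -(real_normK (num_real a)).
  have := sqr_ge0 (2 ^+ k * `|a| - 1); set b := 2 ^+ k in p0 *.
  have -> : b * `|a| ^+ 2 + b^-1 = `|a| + ((b * `|a| - 1) ^+ 2 + b * `|a|) / b by field; rewrite gt_eqF.
  by move=> ?; rewrite lerDl divr_ge0// ?addr_ge0// ?mulr_ge0// ltW.
rewrite big_split/= lerD// ?geometric_half_le2//.
rewrite -lee_fin fineK; last exact: Sx.
rewrite -sumEFin.
exact: (@nneseries_lim_ge _ (fun k => h k x) xpredT 0%N n (fun i _ _ => h0 i x)).
Qed.

(** Riesz-Fischer: a rapidly convergent subsequence has a pointwise limit almost everywhere, and
    Fatou's lemma carries the Cauchy estimate over to that limit. *)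
Lemma L2_complete (f : nat -> X -> R) : (forall n, L2 (f n)) ->
  (forall e, 0 < e -> exists N, forall m n, (N <= m)%N -> (N <= n)%N ->
     ip (fun x => f m x - f n x) (fun x => f m x - f n x) <= e) ->
  exists2 g, L2 g & forall e, 0 < e -> exists N, forall n, (N <= n)%N ->
     ip (fun x => f n x - g x) (fun x => f n x - g x) <= e.
Proof.
move=> Lf Cf.
have q0 k : 0 < 4^-1 ^+ k :> R by rewrite exprn_gt0.
have [N hN] := choice (fun k => Cf _ (q0 k)).
(* Partial sums make [s] monotone while it dominates both [N k] and [k]. *)
pose s k := (\sum_(i < k.+1) N i + k)%N.
have sN k : (N k <= s k)%N by rewrite /s big_ord_recr/= addnAC leq_addl.
have sS k : (s k <= s k.+1)%N by rewrite /s (big_ord_recr k.+1)/= leq_add// leq_addr.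
have sk k : (k <= s k)%N by rewrite leq_addl.
have Lfs k : L2 (f (s k)) by [].
have cv := L2_rapid_cvg Lfs (fun k => hN k _ _ (leq_trans (sN k) (sS k)) (sN k)).
(* The upper limit is measurable everywhere, also where the subsequence diverges. *)
pose g x := fine (limn_esup (fun k => (f (s k) x)%:E)).
have mg : measurable_fun D g.
  apply: measurableT_comp => //; apply: measurable_fun_limn_esup => k.
  exact/measurable_EFinP/L2_measurable.
have fg : {ae mu, forall x, D x -> (fun k => f (s k) x) @ \oo --> g x}.
  apply: filterS cv => x /= cv Dx; have := cv Dx => /cvg_ex[l fl].
  suff -> : g x = l by [].
  have fl' : (fun k => (f (s k) x)%:E) @ \oo --> l%:E.
    by apply/fine_cvgP; split => //; exact: nearW.
  by rewrite /g (cvg_limn_einf_sup fl').2.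
have key n e : (forall k, (n <= k)%N -> ip (fun x => f n x - f k x) (fun x => f n x - f k x) <= e) ->
    L2 (fun x => f n x - g x) /\ ip (fun x => f n x - g x) (fun x => f n x - g x) <= e.
  move=> hn.
  have md : measurable_fun D (fun x => f n x - g x).
    by apply: measurable_funB => //; exact: L2_measurable.
  have bound : (\int[mu]_(x in D) ((f n x - g x) ^+ 2)%:E <= e%:E)%E.
    rewrite (@ae_eq_integral _ _ _ mu D
       (fun x => limn_einf (fun k => ((f n x - f (s k) x) ^+ 2)%:E)))//; last first.
    - apply: filterS fg => x /= fg Dx; have {}fg := fg Dx; apply/esym.
      have hd : (fun k => f n x - f (s k) x) @ \oo --> f n x - g x.
        by apply: cvgB => //; exact: cvg_cst.
      have hd2 : (fun k => ((f n x - f (s k) x) ^+ 2)%:E) @ \oo --> ((f n x - g x) ^+ 2)%:E.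
        apply/fine_cvgP; split; first exact: nearW.
        rewrite expr2 [X in X @ _ --> _](_ : _ =
          (fun k => (f n x - f (s k) x) * (f n x - f (s k) x))); last first.
          by apply/funext => k /=; rewrite expr2.
        exact: cvgM.
      by rewrite (cvg_limn_einf_sup hd2).1.
    - apply: measurableT_comp => //; apply: measurable_fun_limn_esup => k.
      apply: measurableT_comp => //; apply/measurable_EFinP/measurable_funX.
      by apply: measurable_funB; exact: L2_measurable.
    - exact/measurable_EFinP/measurable_funX.
    have Lk k : L2 (fun x => f n x - f (s k) x) by exact: L2B.
    apply: le_trans.
      apply: fatou => //= k; first exact/measurable_EFinP/Ig_measurable/L2_sqr.
      by move=> x _; rewrite lee_fin sqr_ge0.
    rewrite limn_einf_lim; apply: lime_le; first exact: is_cvg_einfs.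
    near=> m.
    apply: le_trans (_ : (\int[mu]_(x in D) ((f n x - f (s m) x) ^+ 2)%:E <= _)%E).
      by apply: ereal_inf_lbound; exists m => //=.
    have := integrable_fin_num mD (L2_sqr (Lk m)) => /fineK <-; rewrite lee_fin.
    have : (n <= s m)%N by apply: leq_trans (sk m); near: m; exact: nbhs_infty_ge.
    move=> /hn; apply: le_trans; rewrite /ip.
    by under [leRHS]eq_Rintegral do rewrite -expr2.
  have Ld : L2 (fun x => f n x - g x).
    apply/L2P; split => //; apply/integrableP; split.
      exact/measurable_EFinP/measurable_funX.
    under eq_integral => x _ do rewrite /= ger0_norm ?sqr_ge0//.
    exact: le_lt_trans bound (ltry _).
  split => //; rewrite -lee_fin; apply: le_trans bound.
  have := integrable_fin_num mD (L2_mul Ld Ld) => /fineK; rewrite -[fine _]/(ip _ _) => ->.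
  rewrite le_eqVlt; apply/orP; left; apply/eqP.
  by apply: eq_integral => x _ /=; rewrite expr2.
have [N1 h1] := Cf 1 ltr01.
have [Ld _] := key N1 1 (fun k hk => h1 _ _ (leqnn _) hk).
exists g.
  have := L2B (Lf N1) Ld.
  by under eq_fun do rewrite subKr.
move=> e /Cf[M hM]; exists M => n Mn.
by have [_] := key n e (fun k hk => hM _ _ Mn (leq_trans Mn hk)).
Unshelve. all: by end_near. Qed.

End L2theory.

Lemma Rintegral_dct {R : realType} {d} {X : measurableType d}
    (mu : {measure set X -> \bar R}) (D : set X) (mD : measurable D)
    (f_ : nat -> X -> R) (f g : X -> R) :
  (forall n, measurable_fun D (f_ n)) -> measurable_fun D f ->
  {ae mu, forall x, D x -> f_ ^~ x @ \oo --> f x} ->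
  mu.-integrable D (EFin \o g) ->
  (forall n x, D x -> `|f_ n x| <= g x) ->
  (fun n => \int[mu]_(x in D) f_ n x) @ \oo --> \int[mu]_(x in D) f x.
Proof.
move=> mf_ mf ff ig fg.
have ff' : {ae mu, forall x, D x -> (f_ n x)%:E @[n --> \oo] --> (f x)%:E}.
  apply: filterS ff => x /= h Dx; apply/fine_cvgP; split; first exact: nearW.
  exact: h.
have [If _ cv] := @dominated_convergence _ _ _ mu D mD (fun n x => (f_ n x)%:E)
  (EFin \o f) (EFin \o g) (fun n => (measurable_EFinP _ _).2 (mf_ n))
  ((measurable_EFinP _ _).2 mf)
  ff' ig
  (aeW _ (fun x n Dx => fg n x Dx)).
apply: fine_cvg; rewrite fineK; last exact: integrable_fin_num.
exact: cv.
Qed.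

(** * Functions with vanishing integrals over quadrants *)

Section measure_density.
Context {R : realType} {d} {X : measurableType d}.
Context (mu : {measure set X -> \bar R}) (f : X -> \bar R).
Hypotheses (mf : measurable_fun setT f) (f0 : forall x, (0 <= f x)%E).

(** The two proofs are arguments so that the measure structure can be attached to this very term. *)
Definition density_measure of measurable_fun setT f & (forall x, (0 <= f x)%E) :
  set X -> \bar R := fun A => (\int[mu]_(x in A) f x)%E.

Local Notation nu := (density_measure mf f0).

Let nu0 : nu set0 = 0%E. Proof. by rewrite /density_measure integral_set0. Qed.

Let nu_ge0 A : (0 <= nu A)%E. Proof. exact: integral_ge0. Qed.

Let nu_sigma_additive : semi_sigma_additive nu.
Proof. exact: semi_sigma_additive_nng_induced. Qed.

HB.instance Definition _ :=
  isMeasure.Build _ _ _ nu nu0 nu_ge0 nu_sigma_additive.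

End measure_density.

(** The positive and negative parts of [G] are densities of two measures that are finite and agree
    on the pi-system, hence on every measurable set; so [G] has integral zero over each of these. *)
Lemma pi_system_integral_ae0 {R : realType} {d} {X : measurableType d}
    (mu : {measure set X -> \bar R}) (P : set (set X)) (F : nat -> set X)
    (G : X -> R) :
  measurable = <<s P >> -> setI_closed P -> (forall i, P (F i)) ->
  \bigcup_i F i = setT -> mu.-integrable setT (EFin \o G) ->
  (forall A, P A -> \int[mu]_(x in A) G x = 0) ->
  {ae mu, forall x, G x = 0}.
Proof.
move=> mP PI PF UF iG G0.
have mG := measurable_int _ iG.
have ip := integrable_funepos measurableT iG.
have im := integrable_funeneg measurableT iG.
pose nup : {measure set X -> \bar R} :=
  density_measure mu (measurable_int _ ip) (funepos_ge0 _).
pose num : {measure set X -> \bar R} :=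
  density_measure mu (measurable_int _ im) (funeneg_ge0 _).
have fin A : measurable A -> nup A \is a fin_num /\ num A \is a fin_num.
  move=> mA; split; apply: integrable_fin_num => //.
    exact: (integrableS measurableT mA _ ip).
  exact: (integrableS measurableT mA _ im).
have mPA A : P A -> measurable A by rewrite mP; exact: sub_sigma_algebra.
have E A : measurable A -> nup A = num A.
  apply: (@measure_unique _ R _ P F _ _ _ _ nup num) => //.
  - move=> B PB; have [f1 f2] := fin _ (mPA _ PB).
    have := G0 _ PB; rewrite /Rintegral integralE.
    rewrite -[X in fine (X - _)]/(nup _) -[X in fine (_ - X)]/(num _).
    rewrite fineB// => /eqP; rewrite subr_eq0 => /eqP.
    by move=> /(congr1 (@EFin R)); rewrite !fineK.
  - by move=> k; have [f1 _] := fin _ (mPA _ (PF k)); rewrite ltey_eq f1.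
have : ae_eq mu setT (EFin \o G) (cst 0%E).
  apply: integral_ae_eq => // A _ mA; rewrite integral0 integralE.
  rewrite -[X in (X - _)%E]/(nup _) -[X in (_ - X)%E]/(num _).
  by rewrite E// subee//; case: (fin _ mA).
by apply: filterS => p /= /(_ I) [].
Qed.

Section plane.
Context {R : realType}.
Local Notation mu2 := (@mu2 R).
Local Notation RR := (measurableTypeR R * measurableTypeR R)%type.

Definition quadrants : set (set RR) :=
  [set A | exists a b, A = `]-oo, a[%classic `*` `]-oo, b[%classic].

Lemma quadrants_setI : setI_closed quadrants.
Proof.
move=> _ _ [a [b ->]] [a' [b' ->]]; exists (Num.min a a'), (Num.min b b').
rewrite -setXI; congr (_ `*` _); apply/seteqP; split=> x /=;
  by rewrite !in_itv/= lt_min => /andP.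
Qed.

Lemma bigcup_ray : \bigcup_n `]-oo, n%:R[%classic = [set: R].
Proof.
apply/seteqP; split=> // x _; exists (Num.bound `|x|) => //=.
by rewrite in_itv/= (le_lt_trans (ler_norm _))// archi_boundP.
Qed.

Lemma measurable_quadrantsE : @measurable _ RR = <<s quadrants >>.
Proof.
apply/seteqP; split; last first.
  apply: smallest_sub; first exact: sigma_algebra_measurable.
  by move=> _ [a [b ->]]; exact: measurableX.
rewrite measurable_prod_measurableType; apply: smallest_sub.
  exact: smallest_sigma_algebra.
have SA := @smallest_sigma_algebra (R * R)%type setT quadrants.
have sI A B : <<s quadrants >> A -> <<s quadrants >> B -> <<s quadrants >> (A `&` B).
  move=> hA hB.
  exact: (@measurableI _ (g_sigma_algebraType quadrants) A B hA hB).
have sU (F : nat -> set RR) : (forall i, <<s quadrants >> (F i)) ->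
    <<s quadrants >> (\bigcup_i F i).
  by case: SA => _ _; apply.
have sC A : <<s quadrants >> A -> <<s quadrants >> (~` A).
  by move=> hA; rewrite -setTD; case: SA => _ + _; apply.
(* The sets whose product with the line lies in the generated sigma-algebra form a sigma-algebra
   themselves, so rays suffice; the product of a ray with the line is a countable union of
   quadrants. *)
have s1 (A : set (measurableTypeR R)) : measurable A -> <<s quadrants >> (A `*` [set: R]).
  rewrite -[measurable]/((@ocitv R).-sigma.-measurable) RGenInftyO.measurableE => mA.
  apply: (mA [set A | <<s quadrants >> (A `*` [set: R])]); split.
    split => /=; first by rewrite set0X; case: SA.
    - move=> B hB; rewrite (_ : _ `*` _ = ~` (B `*` setT)); first exact: sC.
      by apply/seteqP; split=> -[x y] /=; [move=> [[_ nB] _] []|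
        move=> h; split => //; split => // Bx; exact: h].
    - move=> F hF; rewrite (_ : _ `*` _ = \bigcup_i (F i `*` setT)); first exact: sU.
      by apply/seteqP; split=> -[x y] /=; [move=> [[i _ Fi] _]; exists i|
        move=> [i _ [Fi _]]; split => //; exists i].
  move=> _ [x ->] /=; rewrite -bigcup_ray setX_bigcupr; apply: sU => n.
  by apply: sub_sigma_algebra; exists x, n%:R.
have s2 (A : set (measurableTypeR R)) : measurable A -> <<s quadrants >> ([set: R] `*` A).
  rewrite -[measurable]/((@ocitv R).-sigma.-measurable) RGenInftyO.measurableE => mA.
  apply: (mA [set A | <<s quadrants >> ([set: R] `*` A)]); split.
    split => /=; first by rewrite setX0; case: SA.
    - move=> B hB; rewrite (_ : _ `*` _ = ~` (setT `*` B)); first exact: sC.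
      by apply/seteqP; split=> -[x y] /=; [move=> [_ [_ nB]] []|
        move=> h; split => //; split => // Bx; exact: h].
    - move=> F hF; rewrite (_ : _ `*` _ = \bigcup_i (setT `*` F i)); first exact: sU.
      by apply/seteqP; split=> -[x y] /=; [move=> [_ [i _ Fi]]; exists i|
        move=> [i _ [_ Fi]]; split => //; exists i].
  move=> _ [x ->] /=; rewrite -bigcup_ray setX_bigcupl; apply: sU => n.
  by apply: sub_sigma_algebra; exists n%:R, x.
move=> _ [A mA [B mB <-]].
rewrite (_ : A `*` B = (A `*` setT) `&` (setT `*` B)).
  by apply: sI; [exact: s1|exact: s2].
by rewrite -setXI setTI setIT.
Qed.

Lemma open_measurable_plane (A : set RR) : open (A : set (R * R)) -> measurable A.
Proof.
move=> oA.
pose F (q : (rat * rat) * (rat * rat)) : set RR :=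
  `]ratr q.1.1, ratr q.1.2[%classic `*` `]ratr q.2.1, ratr q.2.2[%classic.
(* Emptying the rational boxes that leave [A] allows a union over all quadruples of rationals. *)
pose F' q := if pselect (F q `<=` A) then F q else set0.
rewrite (_ : A = \bigcup_q F' q).
  apply: countable_bigcupT_measurable => // q.
  by rewrite /F'; destruct (pselect (F q `<=` A)); [apply: measurableX|]; exact: measurable0 || exact: measurable_itv.
apply/seteqP; split => [[x y] Axy|p [q _]]; last first.
  by rewrite /F'; destruct (pselect (F q `<=` A)) as [h|h] => // /h.
have : nbhs (x, y) A by exact: open_nbhs_nbhs.
move=> /nbhs_ballP[e /= e0 eA].
have [q1] := @rat_in_itvoo R (x - e) x ltac:(lra).
have [q2] := @rat_in_itvoo R x (x + e) ltac:(lra).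
have [q3] := @rat_in_itvoo R (y - e) y ltac:(lra).
have [q4] := @rat_in_itvoo R y (y + e) ltac:(lra).
rewrite !in_itv/= => /andP[h1 h2] /andP[h3 h4] /andP[h5 h6] /andP[h7 h8].
have sF : F ((q1, q2), (q3, q4)) `<=` A.
  move=> [a b] [/=]; rewrite !in_itv/= => /andP[k1 k2] /andP[k3 k4]; apply: eA.
  by split; rewrite /ball/= ltr_norml; apply/andP; split; lra.
exists ((q1, q2), (q3, q4)) => //; rewrite /F'.
destruct (pselect (F ((q1, q2), (q3, q4)) `<=` A)) => //.
by split; rewrite /= in_itv/=; apply/andP.
Qed.

Lemma continuous_measurable_plane (f : RR -> R) :
  continuous (f : R * R -> R) -> measurable_fun setT f.
Proof.
move=> cf; apply: (measurability _ (RGenOInfty.measurableE R)).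
move=> /= _ [_ [a ->]] <-; rewrite setTI; apply: open_measurable_plane.
by move/continuousP : cf; apply; exact: interval_open.
Qed.

Lemma quadrant_integral_ae0 (G : RR -> R) :
  mu2.-integrable setT (EFin \o G) ->
  (forall a b, \int[mu2]_(p in `]-oo, a[%classic `*` `]-oo, b[%classic) G p = 0) ->
  {ae mu2, forall p, G p = 0}.
Proof.
move=> iG G0.
refine (pi_system_integral_ae0 (P := quadrants)
    (F := fun n => `]-oo, n%:R[%classic `*` `]-oo, n%:R[%classic) _ _ _ _ iG _).
- exact: measurable_quadrantsE.
- exact: quadrants_setI.
- by move=> i; exists i%:R, i%:R.
- apply/seteqP; split => // -[x y] _.
  exists (Num.bound `|x| + Num.bound `|y|)%N => //; split; rewrite /= in_itv/= natrD.
    by rewrite (le_lt_trans (ler_norm _))// (lt_le_trans (archi_boundP _))// lerDl ler0n.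
  by rewrite (le_lt_trans (ler_norm _))// (lt_le_trans (archi_boundP _))// lerDr ler0n.
- by move=> _ [a [b ->]].
Qed.

End plane.

(** * Smooth functions *)

Section smooth_theory.
Context {R : realType} {V : normedModType R}.
Implicit Types (f g : V -> R) (P : (V -> R) -> Prop).

Inductive alg_closure P : (V -> R) -> Prop :=
| alg_base f of P f : alg_closure P f
| alg_cst c : alg_closure P (cst c)
| alg_add f g of alg_closure P f & alg_closure P g :
    alg_closure P (fun x => f x + g x)
| alg_mul f g of alg_closure P f & alg_closure P g :
    alg_closure P (fun x => f x * g x).

(* Coinduction up to sums and products: it spares the Leibniz formula for
   iterated derivatives. *)
Lemma smooth_coind P :
  (forall f, P f -> (forall x, differentiable f x) /\
                    forall e, alg_closure P ('D_e f)) ->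
  forall f, alg_closure P f -> smooth f.
Proof.
move=> hP.
have H f : alg_closure P f -> (forall x, differentiable f x) /\
    forall e, alg_closure P ('D_e f).
  elim=> {f}[f /hP//|c|f g af [df Df] ag [dg Dg]|f g af [df Df] ag [dg Dg]].
  - split=> [x|e]; first exact: differentiable_cst.
    rewrite (_ : 'D_e _ = cst 0); first exact: alg_cst.
    by apply/funext => x; exact: derive_cst.
  - split=> [x|e]; first exact: differentiableD.
    rewrite (_ : 'D_e _ = fun x => 'D_e f x + 'D_e g x); first exact: alg_add.
    by apply/funext => x; apply: deriveD; exact: diff_derivable.
  - split=> [x|e]; first exact: differentiableM.
    rewrite (_ : 'D_e _ = fun x => f x * 'D_e g x + g x * 'D_e f x).
      by apply: alg_add; exact: alg_mul.
    by apply/funext => x; apply: deriveM; exact: diff_derivable.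
move=> f af s x.
suff : alg_closure P (Defs.iterD s f) by move=> /H[].
by elim: s => //= e s IH; apply (H _ IH).
Qed.

Lemma smooth_differentiable f (x : V) : smooth f -> differentiable f x.
Proof. by move=> sf; exact: (sf [::]). Qed.

Lemma smooth_derivable f x e : smooth f -> derivable f x e.
Proof. by move=> sf; exact/diff_derivable/smooth_differentiable. Qed.

Lemma smooth_derive f e : smooth f -> smooth ('D_e f).
Proof. by move=> sf s x; have := sf (rcons s e) x; rewrite /Defs.iterD foldr_rcons. Qed.

Lemma smooth_continuous f : smooth f -> continuous f.
Proof. by move=> sf x; exact/differentiable_continuous/smooth_differentiable. Qed.

Lemma smooth_alg f : alg_closure smooth f -> smooth f.
Proof.
apply: smooth_coind => {}f sf; split=> [x|e]; first exact: smooth_differentiable.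
by apply: alg_base; exact: smooth_derive.
Qed.

Lemma smooth_cst c : smooth (cst c : V -> R).
Proof. exact/smooth_alg/alg_cst. Qed.

Lemma smoothD f g : smooth f -> smooth g -> smooth (fun x => f x + g x).
Proof. by move=> sf sg; apply/smooth_alg/alg_add; exact: alg_base. Qed.

Lemma smoothM f g : smooth f -> smooth g -> smooth (fun x => f x * g x).
Proof. by move=> sf sg; apply/smooth_alg/alg_mul; exact: alg_base. Qed.

Lemma smoothZ c f : smooth f -> smooth (fun x => c * f x).
Proof. by move=> sf; apply: (@smoothM (cst c)) => //; exact: smooth_cst. Qed.

Lemma smoothB f g : smooth f -> smooth g -> smooth (fun x => f x - g x).
Proof.
move=> sf /(smoothZ (-1)); under eq_fun do rewrite mulN1r.
exact: smoothD.
Qed.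

Lemma smooth_deriveD f g e x : smooth f -> smooth g ->
  'D_e (fun x => f x + g x) x = 'D_e f x + 'D_e g x.
Proof. by move=> sf sg; apply: deriveD; exact: smooth_derivable. Qed.

Lemma smooth_deriveM f g e x : smooth f -> smooth g ->
  'D_e (fun x => f x * g x) x = f x * 'D_e g x + g x * 'D_e f x.
Proof. by move=> sf sg; apply: deriveM; exact: smooth_derivable. Qed.

Lemma smooth_deriveZ c f e x : smooth f ->
  'D_e (fun x => c * f x) x = c * 'D_e f x.
Proof.
move=> sf; rewrite (@smooth_deriveM (cst c))//; last exact: smooth_cst.
by rewrite derive_cst mulr0 addr0.
Qed.

End smooth_theory.

Section smooth_composition.
Context {R : realType} {V : normedModType R}.

Lemma is_diff_compE (phi : R -> R) (A : V -> R) (L : V -> R) x e :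
  is_diff x A L -> differentiable phi (A x) ->
  differentiable (phi \o A) x /\ 'D_e (phi \o A) x = L e * 'D_1 phi (A x).
Proof.
move=> dA dphi; have dc : differentiable (phi \o A) x.
  by apply: differentiable_comp => //; case: dA.
split => //; rewrite deriveE// diff_comp//.
by rewrite /= diff_val diff1E// derive1E.
Qed.

(** The differential [L] is the same at every point, so each derivative of a composite is a constant
    [L e] times another composite: the family needed for [smooth_coind]. *)
Lemma smooth_comp (phi : R -> R) (A L : V -> R) :
  (forall x, is_diff x A L) -> smooth phi -> smooth (phi \o A).
Proof.
move=> dA sphi.
apply: (smooth_coind (P := fun f => exists2 psi : R -> R, smooth psi & f = psi \o A)).
  move=> _ [psi spsi ->].
  have h x e := is_diff_compE e (dA x) (smooth_differentiable (A x) spsi).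
  split=> [x|e]; first by have [] := h x 0.
  rewrite (_ : 'D_e _ = fun x => cst (L e) x * ('D_1 psi \o A) x).
    apply: alg_mul; first exact: alg_cst.
    by apply: alg_base; exists ('D_1 psi) => //; exact: smooth_derive.
  by apply/funext => x; have [] := h x e.
by apply: alg_base; exists phi.
Qed.

End smooth_composition.

Section smooth_real.
Context {R : realType}.
Implicit Types phi psi : R -> R.

Lemma is_derive_dir (phi : R -> R) (x d e : R) : is_derive x 1 phi d ->
  differentiable phi x /\ 'D_e phi x = e * d.
Proof.
move=> dphi; have df : differentiable phi x by apply/derivable1_diffP.
by split => //; rewrite deriveE// diff1E// derive1E derive_val.
Qed.

Lemma smooth_real_coind (P : (R -> R) -> Prop) :
  (forall f : R -> R, P f -> exists2 f' : R -> R, alg_closure P f' &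
     forall x : R, is_derive x 1 f (f' x)) ->
  forall f : R -> R, alg_closure P f -> smooth f.
Proof.
move=> hP; apply: smooth_coind => f /hP[f' af' df].
have h x e := is_derive_dir e (df x).
split=> [x|e]; first by have [] := h x 0.
rewrite (_ : 'D_e f = fun x => cst e x * f' x).
  by apply: alg_mul => //; exact: alg_cst.
by apply/funext => x; have [] := h x e.
Qed.

Lemma smooth_id : smooth (@id R).
Proof.
apply: (smooth_real_coind (P := fun f => f = id)); last exact: alg_base.
by move=> _ ->; exists (cst 1) => [|x]; [exact: alg_cst|exact: is_derive_id].
Qed.

Lemma smooth_sin_cos : smooth (@sin R) /\ smooth (@cos R).
Proof.
suff H (f : R -> R) : alg_closure (fun f : R -> R => f = @sin R \/ f = @cos R) f -> smooth f.
  by split; apply: H; apply: alg_base; [left|right].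
apply: smooth_real_coind => _ [->|->].
  by exists cos => [|x]; [apply: alg_base; right|exact: is_derive_sin].
exists (fun x => cst (-1) x * sin x) => [|x].
  by apply: alg_mul; [exact: alg_cst|apply: alg_base; left].
by rewrite mulN1r; exact: is_derive_cos.
Qed.

Lemma smooth_expR : smooth (@expR R).
Proof.
apply: (smooth_real_coind (P := fun f => f = expR)); last exact: alg_base.
by move=> _ ->; exists expR => [|x]; [exact: alg_base|exact: is_derive_expR].
Qed.

Lemma is_diff_scale (a x : R) : is_diff x (fun y => a * y) (fun y => a * y).
Proof. exact: is_diff_scaler. Qed.

Lemma is_diff_affine (a b x : R) : is_diff x (fun y => a * y + b) (fun y => a * y).
Proof.
have := @is_diffD _ _ _ (fun y => a * y) (cst b) (fun y => a * y) 0 x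
  (is_diff_scale a x) (is_diff_cst _ _).
by rewrite addr0.
Qed.

Lemma smooth_affine phi (a b : R) : smooth phi -> smooth (fun x => phi (a * x + b)).
Proof. exact: (smooth_comp (is_diff_affine a b)). Qed.

Lemma derive_affine phi (a b x : R) : smooth phi ->
  'D_1 (fun x => phi (a * x + b)) x = a * 'D_1 phi (a * x + b).
Proof.
move=> sphi; have [_ ->] := is_diff_compE (1 : R) (is_diff_affine a b x)
  (smooth_differentiable (a * x + b) sphi).
by rewrite mulr1.
Qed.

Lemma is_diff_fst (p : R * R) : is_diff p fst fst.
Proof.
have cf : continuous (fst : R * R -> R) by move=> q; exact: cvg_fst.
apply: DiffDef; first exact: linear_differentiable.
exact: diff_lin.
Qed.

Lemma is_diff_snd (p : R * R) : is_diff p snd snd.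
Proof.
have cf : continuous (snd : R * R -> R) by move=> q; exact: cvg_snd.
apply: DiffDef; first exact: linear_differentiable.
exact: diff_lin.
Qed.

Lemma smooth_fst phi : smooth phi -> smooth (fun p : R * R => phi p.1).
Proof. exact: (smooth_comp is_diff_fst). Qed.

Lemma smooth_snd phi : smooth phi -> smooth (fun p : R * R => phi p.2).
Proof. exact: (smooth_comp is_diff_snd). Qed.

Lemma derive_fst phi e (p : R * R) : smooth phi ->
  'D_e (fun p => phi p.1) p = e.1 * 'D_1 phi p.1.
Proof.
by move=> sphi; have [_] := is_diff_compE e (is_diff_fst p) (smooth_differentiable p.1 sphi).
Qed.

Lemma derive_snd phi e (p : R * R) : smooth phi ->
  'D_e (fun p => phi p.2) p = e.2 * 'D_1 phi p.2.
Proof.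
by move=> sphi; have [_] := is_diff_compE e (is_diff_snd p) (smooth_differentiable p.2 sphi).
Qed.

Definition tensor phi psi : R * R -> R := fun p => phi p.1 * psi p.2.

Lemma smooth_tensor phi psi : smooth phi -> smooth psi -> smooth (tensor phi psi).
Proof.
by move=> sphi spsi; apply: smoothM; [exact: smooth_fst|exact: smooth_snd].
Qed.

Lemma derive_tensor phi psi e p : smooth phi -> smooth psi ->
  'D_e (tensor phi psi) p =
    e.1 * ('D_1 phi p.1 * psi p.2) + e.2 * (phi p.1 * 'D_1 psi p.2).
Proof.
move=> sphi spsi.
rewrite (@smooth_deriveM _ _ (fun p => phi p.1) (fun p => psi p.2)).
- by rewrite derive_fst// derive_snd//; ring.
- exact: smooth_fst.
- exact: smooth_snd.
Qed.

Lemma is_diff_slice (a b : R) : forall x : R,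
  is_diff x (fun y => (a, y) : R * R) (fun y => (0, y) : R * R).
Proof.
move=> x; have h1 := @is_diff_cst R R R a x; have h2 := @is_diff_id R R x.
exact: (@is_diff_pair _ _ _ _ (cst a) 0 id id x h1 h2).
Qed.

Lemma is_diff_slice1 (b : R) : forall x : R,
  is_diff x (fun y => (y, b) : R * R) (fun y => (y, 0) : R * R).
Proof.
move=> x; have h1 := @is_diff_cst R R R b x; have h2 := @is_diff_id R R x.
exact: (@is_diff_pair _ _ _ _ id id (cst b) 0 x h2 h1).
Qed.

Lemma derive_slice (f : R * R -> R) t x : differentiable f (t, x) ->
  differentiable (fun y => f (t, y)) x /\
  forall e, 'D_e (fun y => f (t, y)) x = e * 'D_(0, 1) f (t, x).
Proof.
move=> df; have ds := is_diff_slice t 0 x.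
have dc : differentiable (f \o (fun y => (t, y))) x.
  by apply: differentiable_comp => //; case: ds.
split => // e; rewrite deriveE// [LHS](_ : _ = 'd (f \o (fun y => (t, y))) x e)//.
rewrite diff_comp//.
rewrite /= diff_val [in RHS]deriveE//.
have -> : (0, e) = e *: (0, 1) :> R * R.
  by rewrite -[RHS]/(e *: 0, e *: 1) scaler0 /GRing.scale/= mulr1.
by rewrite linearZ.
Qed.

Lemma derive_slice1 (f : R * R -> R) t x : differentiable f (t, x) ->
  differentiable (fun s => f (s, x)) t /\
  forall e, 'D_e (fun s => f (s, x)) t = e * 'D_(1, 0) f (t, x).
Proof.
move=> df; have ds := is_diff_slice1 x t.
have dc : differentiable (f \o (fun y => (y, x))) t.
  by apply: differentiable_comp => //; case: ds.
split => // e; rewrite deriveE// [LHS](_ : _ = 'd (f \o (fun y => (y, x))) t e)//.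
rewrite diff_comp//.
rewrite /= diff_val [in RHS]deriveE//.
have -> : (e, 0) = e *: (1, 0) :> R * R.
  by rewrite -[RHS]/(e *: 1, e *: 0) scaler0 /GRing.scale/= mulr1.
by rewrite linearZ.
Qed.

Lemma smooth_slice (f : R * R -> R) t : smooth f -> smooth (fun x => f (t, x)).
Proof.
move=> sf.
apply: (smooth_coind (P := fun h => exists2 g : R * R -> R, smooth g & h = fun x => g (t, x))); last first.
  by apply: alg_base; exists f.
move=> _ [g sg ->]; have h x := derive_slice (smooth_differentiable (t, x) sg).
split=> [x|e]; first by have [] := h x.
rewrite (_ : 'D_e _ = fun x => cst e x * 'D_(0, 1) g (t, x)).
  apply: alg_mul; first exact: alg_cst.
  by apply: alg_base; exists ('D_(0, 1) g) => //; exact: smooth_derive.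
by apply/funext => x; have [_ ->] := h x.
Qed.

Lemma smooth_slice1 (f : R * R -> R) x : smooth f -> smooth (fun t => f (t, x)).
Proof.
move=> sf.
apply: (smooth_coind (P := fun h => exists2 g : R * R -> R, smooth g & h = fun t => g (t, x))); last first.
  by apply: alg_base; exists f.
move=> _ [g sg ->]; have h t := derive_slice1 (smooth_differentiable (t, x) sg).
split=> [t|e]; first by have [] := h t.
rewrite (_ : 'D_e _ = fun t => cst e t * 'D_(1, 0) g (t, x)).
  apply: alg_mul; first exact: alg_cst.
  by apply: alg_base; exists ('D_(1, 0) g) => //; exact: smooth_derive.
by apply/funext => t; have [_ ->] := h t.
Qed.

End smooth_real.

(** * Smooth cutoffs *)

Section flat.
Context {R : realType}.
Implicit Types (c t : R).

(* The powers of 1/t make the family closed under differentiation. *)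
Definition flat c n t : R := if 0 < t then t^-1 ^+ n * expR (- (c * t^-1)) else 0.

(** With y = 1/t, the exponential series gives (c y)^(n+2) <= (n+2)! e^(c y), which turns y^n e^(-c
    y) into a multiple of y^(-2) = t^2. The quadratic bound is what makes the derivative at 0 exist
    and vanish. *)
Lemma flat_bound c n : 0 < c -> exists K, forall t, `|flat c n t| <= K * t ^+ 2.
Proof.
move=> c0; exists ((n.+2)`!%:R / c ^+ n.+2) => t.
have K0 : 0 <= (n.+2)`!%:R / c ^+ n.+2 :> R by rewrite divr_ge0// exprn_ge0// ltW.
rewrite /flat; case: ifPn => t0; last by rewrite normr0 mulr_ge0// sqr_ge0.
have y0 : 0 < t^-1 by rewrite invr_gt0.
rewrite -[X in _ * X ^+ 2]invrK; move: y0; set y := t^-1 => y0.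
rewrite ger0_norm ?mulr_ge0 ?exprn_ge0 ?expR_ge0 ?(ltW y0)//.
have cy0 : 0 <= c * y by rewrite mulr_ge0// ltW.
have := expR_ge1Dxn n.+1 cy0; rewrite expRN.
move: (expR (c * y)) (expR_gt0 (c * y)) => E E0 h.
have {}h : (c * y) ^+ n.+2 <= E * (n.+2)`!%:R.
  rewrite -ler_pdivrMr ?ltr0n ?fact_gt0//; apply: le_trans h; lra.
have yn0 : y != 0 by rewrite gt_eqF.
have cn0 : c != 0 by rewrite gt_eqF.
rewrite ler_pdivrMr//.
have -> : (n.+2)`!%:R / c ^+ n.+2 * y^-1 ^+ 2 * E = E * (n.+2)`!%:R / (c ^+ n.+2 * y ^+ 2).
  by field; rewrite yn0 expf_neq0.
have p0 : 0 < c ^+ n.+2 * y ^+ 2 by rewrite mulr_gt0// exprn_gt0.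
rewrite (ler_pdivlMr _ _ p0) mulrCA -exprD addn2 -exprMn.
exact: h.
Qed.

Lemma is_derive_sqr_bound (g : R -> R) (K : R) : g 0 = 0 ->
  (forall t, `|g t| <= K * t ^+ 2) -> is_derive (0 : R) (1 : R) g 0.
Proof.
move=> g0 gK.
have K0 : 0 <= K by have := gK 1; rewrite expr1n mulr1; apply: le_trans.
suff h : (fun h => h^-1 *: ((g \o shift 0) (h *: 1) - g 0)) @ 0^' --> (0 : R).
  by apply: DeriveDef; [apply/cvg_ex; exists 0|exact/cvg_lim].
apply/cvgrPdist_le => e e0; near=> h.
have hn0 : h != 0 by near: h; exact: nbhs_dnbhs_neq.
rewrite /= g0 subr0 addr0 sub0r normrN /GRing.scale/= mulr1 normrM normfV.
rewrite mulrC ler_pdivrMr ?normr_gt0//; apply: le_trans (gK _) _.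
rewrite -(real_normK (num_real h)) expr2 mulrA ler_wpM2r//.
have : `|h| <= e / (K + 1).
  near: h; apply: dnbhs0_le; rewrite divr_gt0//; lra.
rewrite ler_pdivlMr; last by lra.
by apply: le_trans; rewrite mulrC ler_wpM2l//; lra.
Unshelve. all: by end_near. Qed.

Lemma is_derive_flat c n t : 0 < c ->
  is_derive t (1 : R) (flat c n) (c * flat c n.+2 t - n%:R * flat c n.+1 t).
Proof.
move=> c0; have [t0|t0|<-] := ltgtP 0 t.
- have tn0 : t != 0 by rewrite gt_eqF.
  pose g (x : R) := x^-1 ^+ n * expR (- (c * x^-1)).
  have dV : is_derive t (1 : R) (fun x : R => x^-1) (- (t^-1 ^+ 2)).
    have h := @is_deriveV _ (@id R) t 1 1 tn0 (is_derive_id _ _).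
    by apply: (is_derive_eq h); rewrite /GRing.scale/= mulr1 exprVn.
  have dX : is_derive t (1 : R) (fun x : R => x^-1 ^+ n) (- (n%:R * t^-1 ^+ n.+1)).
    have h := is_deriveX n dV; rewrite exprfctE in h; apply: (is_derive_eq h); rewrite /GRing.scale/=.
    by clear; case: n => [|n] /=; rewrite ?mul0r ?oppr0// mulrN -mulrA -exprD addn2.
  have dZ : is_derive t (1 : R) (fun x : R => - (c * x^-1)) (c * t^-1 ^+ 2).
    have h := is_deriveN (is_deriveZ c dV).
    by apply: (is_derive_eq h); rewrite /GRing.scale/= mulrN opprK.
  have dE := @is_derive1_comp _ expR (fun x : R => - (c * x^-1)) t _ _
    (is_derive_expR (- (c * t^-1))) dZ.
  have dg : is_derive t (1 : R) g (c * flat c n.+2 t - n%:R * flat c n.+1 t).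
    have h := is_deriveM dX dE; apply: (is_derive_eq h).
    rewrite /GRing.scale/= /flat t0 !exprS /=; ring.
  apply: near_eq_is_derive dg; near=> x; rewrite /flat /g ifT//.
  by near: x; exact: lt_nbhsr.
- have -> : c * flat c n.+2 t - n%:R * flat c n.+1 t = 0.
    by rewrite /flat ltNge (ltW t0)/= !mulr0 subr0.
  apply: near_eq_is_derive (is_derive_cst (0 : R) t 1); near=> x.
  rewrite /flat ifF//; apply/negbTE; rewrite -leNgt ltW//.
  by near: x; exact: lt_nbhsl.
- have -> : c * flat c n.+2 0 - n%:R * flat c n.+1 0 = 0.
    by rewrite /flat ltxx !mulr0 subr0.
  have [K hK] := flat_bound n c0; apply: (is_derive_sqr_bound (K := K)) => //.
  by rewrite /flat ltxx.
Unshelve. all: by end_near. Qed.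

Lemma smooth_flat c n : 0 < c -> smooth (flat c n).
Proof.
move=> c0.
apply: (smooth_real_coind (P := fun f => exists n, f = flat c n)).
  move=> _ [m ->].
  exists (fun x => cst c x * flat c m.+2 x + cst (- m%:R) x * flat c m.+1 x) => [|x].
    apply: alg_add; apply: alg_mul; try exact: alg_cst.
      by apply: alg_base; exists m.+2.
    by apply: alg_base; exists m.+1.
  by rewrite /= mulNr; exact: is_derive_flat.
by apply: alg_base; exists n.
Qed.

(** The single parameter [c] is both the margin left at the end points and the rate in the
    exponentials: as it tends to 0, the support fills the interval and the values inside tend to
    1. *)
Definition cutoff (a b c x : R) : R := flat c 0 (x - a - c) * flat c 0 (b - c - x).

Lemma flat0_ge0 c t : 0 <= flat c 0 t.
Proof. by rewrite /flat; case: ifP => // _; rewrite expr0 mul1r expR_ge0. Qed.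

Lemma flat0_le1 c t : 0 < c -> flat c 0 t <= 1.
Proof.
move=> c0; rewrite /flat; case: ifP => // t0; rewrite expr0 mul1r.
by rewrite -expR0 ler_expR oppr_le0 mulr_ge0// ?invr_ge0 ltW.
Qed.

Lemma cutoff_ge0 a b c x : 0 <= cutoff a b c x.
Proof. by rewrite mulr_ge0// flat0_ge0. Qed.

Lemma cutoff_le1 a b c x : 0 < c -> cutoff a b c x <= 1.
Proof. by move=> c0; rewrite mulr_ile1// ?flat0_ge0// flat0_le1. Qed.

Lemma cutoff_norm_le1 a b c x : 0 < c -> `|cutoff a b c x| <= 1.
Proof. by move=> c0; rewrite ger0_norm ?cutoff_ge0// cutoff_le1. Qed.

Lemma smooth_cutoff a b c : 0 < c -> smooth (cutoff a b c).
Proof.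
move=> c0.
have -> : cutoff a b c =
    fun x => flat c 0 (1 * x + (- a - c)) * flat c 0 (-1 * x + (b - c)).
  by apply/funext => x; rewrite /cutoff; congr (flat c 0 _ * flat c 0 _); ring.
by apply: smoothM; apply: smooth_affine; exact: smooth_flat.
Qed.

Lemma cutoff_support a b c x : ~ `[a + c, b - c]%classic x -> cutoff a b c x = 0.
Proof.
move=> /= h; rewrite /cutoff /flat; case: ifPn => [h1|_]; last by rewrite mul0r.
case: ifPn => [h2|_]; last by rewrite mulr0.
by exfalso; apply: h; rewrite in_itv/=; apply/andP; split; lra.
Qed.

Lemma test_function_cutoff (a b c : R) : 0 < c ->
  test_function (`]a, b[%classic : set R) (cutoff a b c).
Proof.
move=> c0; split; first exact: smooth_cutoff.
exists `[a + c, b - c]%classic; split; first exact: segment_compact.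
  by move=> x /=; rewrite !in_itv/= => /andP[h1 h2]; apply/andP; split; lra.
exact: cutoff_support.
Qed.

Lemma cvg_harmonic_inv : (fun n => n.+1%:R^-1 : R) @ \oo --> (0 : R).
Proof. exact: cvg_harmonic. Qed.

Lemma flat_cvg1 (a : R) : 0 < a ->
  (fun n => flat n.+1%:R^-1 0 (a - n.+1%:R^-1)) @ \oo --> (1 : R).
Proof.
move=> a0.
have h : (fun n => expR (- (n.+1%:R^-1 * (a - n.+1%:R^-1)^-1))) @ \oo --> (1 : R).
  rewrite -[X in _ --> X]expR0; apply: continuous_cvg; first exact: continuous_expR.
  rewrite -[X in _ --> X]oppr0; apply: cvgN.
  rewrite -[X in _ --> X](mul0r (a - 0)^-1).
  apply: cvgM; first exact: cvg_harmonic_inv.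
  apply: cvgV; first by rewrite subr0 gt_eqF.
  by apply: cvgB; [exact: cvg_cst|exact: cvg_harmonic_inv].
apply: cvg_trans h; apply: near_eq_cvg; near=> n.
rewrite /flat expr0 mul1r ifT// subr_gt0.
near: n; apply: (cvgr_lt (0 : R)) => //; exact: cvg_harmonic_inv.
Unshelve. all: by end_near. Qed.

Lemma cutoff_cvg (a b x : R) :
  (fun n => cutoff a b n.+1%:R^-1 x) @ \oo --> (\1_`]a, b[%classic x : R).
Proof.
rewrite indicE; have [|] := boolP (x \in `]a, b[%classic).
  rewrite inE/= in_itv/= => /andP[ax xb].
  rewrite -[X in _ --> X](mulr1 1); apply: cvgM; first by apply: flat_cvg1; lra.
  rewrite [X in X @ _](_ : _ = fun n => flat n.+1%:R^-1 0 ((b - x) - n.+1%:R^-1)).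
    by apply: flat_cvg1; lra.
  by apply/funext => n; congr flat; ring.
move=> /negP xab; rewrite [X in X @ _](_ : _ = cst 0); first exact: cvg_cst.
apply/funext => n; apply: cutoff_support => /= h; apply: xab.
have c0 : 0 < n.+1%:R^-1 :> R by rewrite invr_gt0 ltr0n.
move: (n.+1%:R^-1) c0 h => k k0; rewrite in_itv/= => /andP[h1 h2].
apply/mem_set; rewrite /= in_itv/=; apply/andP; split; lra.
Qed.

End flat.

(** * Integration by parts on rectangles *)

Section rectangles.
Context {R : realType}.
Local Notation mu := (@lebesgue_measure R).
Local Notation mu2 := (@mu2 R).
Local Notation RR := (measurableTypeR R * measurableTypeR R)%type.
Implicit Types a b c d : R.

Definition rect a b c d : set RR := `]a, b[%classic `*` `]c, d[%classic.

Lemma measurable_rect a b c d : measurable (rect a b c d).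
Proof. exact: measurableX. Qed.

Lemma lebesgue_itv_lty a b : (mu `]a, b[%classic < +oo)%E.
Proof. by rewrite lebesgue_measure_itv/=; case: ifP => // _; rewrite -EFinB ltry. Qed.

Lemma mu2_rect_lty a b c d : (mu2 (rect a b c d) < +oo)%E.
Proof.
rewrite /mu2 /rect product_measure1E//.
by rewrite lte_mul_pinfty// ?ge0_fin_numE// lebesgue_itv_lty.
Qed.

Lemma continuous_rect_bounded (f : R * R -> R) a b c d : continuous f ->
  exists M, forall p, rect a b c d p -> `|f p| <= M.
Proof.
move=> cf.
have cK : compact (`[a, b]%classic `*` `[c, d]%classic).
  by apply: compact_setX; exact: segment_compact.
have /compact_bounded[M [_ hM]] := continuous_compact (continuous_subspaceT cf) cK.
exists (M + 1) => p [/= h1 h2]; apply: (hM (M + 1)); first by rewrite ltrDl.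
by exists p => //; split => /=; apply: subset_itv_oo_cc.
Qed.

Lemma continuous_itv_bounded (f : R -> R) a b : continuous f ->
  exists M, forall x, `]a, b[%classic x -> `|f x| <= M.
Proof.
move=> cf.
have cK : compact `[a, b]%classic by exact: segment_compact.
have /compact_bounded[M [_ hM]] := continuous_compact (continuous_subspaceT cf) cK.
exists (M + 1) => x h1; apply: (hM (M + 1)); first by rewrite ltrDl.
by exists x => //; apply: subset_itv_oo_cc.
Qed.

Lemma fubini_zero (A B : set R) (F : RR -> R) :
  measurable A -> measurable B ->
  mu2.-integrable (A `*` B) (EFin \o F) ->
  ({ae mu, forall x, B x -> (\int[mu]_(t in A) (F (t, x))%:E = 0)%E} \/
   {ae mu, forall t, A t -> (\int[mu]_(x in B) (F (t, x))%:E = 0)%E}) ->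
  \int[mu2]_(p in A `*` B) F p = 0.
Proof.
move=> mA mB iF hF.
have mAB : measurable (A `*` B : set RR) by exact: measurableX.
have iG : mu2.-integrable setT ((EFin \o F) \_ (A `*` B)).
  by apply/(integrable_mkcond _ mAB).
rewrite /Rintegral integral_mkcond.
case: hF => hF.
  rewrite -(integral21_prod_meas1 iG) (@ae_eq_integral _ _ _ mu setT (cst 0%E)) ?integral0//.
    exact: measurable_fubini_G iG.
  apply: ae_imp hF => x hx _; rewrite /fubini_G /=.
  have [Bx|Bx] := pselect (B x); last first.
    rewrite (eq_integral (cst 0%E)) ?integral0// => t _.
    by rewrite patchE memNset// => -[].
  rewrite -(hx Bx) [RHS]integral_mkcond; apply: eq_integral => t _.
  rewrite !patchE; have [At|At] := pselect (A t); first by rewrite !mem_set.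
  by rewrite !memNset// => -[].
rewrite -(integral12_prod_meas1 iG) (@ae_eq_integral _ _ _ mu setT (cst 0%E)) ?integral0//.
  exact: measurable_fubini_F iG.
apply: ae_imp hF => x hx _; rewrite /fubini_F /=.
have [Bx|Bx] := pselect (A x); last first.
  rewrite (eq_integral (cst 0%E)) ?integral0// => t _.
  by rewrite patchE memNset// => -[].
rewrite -(hx Bx) [RHS]integral_mkcond; apply: eq_integral => t _.
rewrite !patchE; have [At|At] := pselect (B t); first by rewrite !mem_set.
by rewrite !memNset// => -[].
Qed.

Lemma smooth_FTC (phi : R -> R) a b : a < b -> smooth phi ->
  (\int[mu]_(x in `]a, b[) ('D_1 phi x)%:E = (phi b - phi a)%:E)%E.
Proof.
move=> ab sphi.
have cd : continuous ('D_1 phi) by exact/smooth_continuous/smooth_derive.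
rewrite -[LHS](@integral_itv_bndoo _ a b _ true false); last first.
  apply/measurable_EFinP; apply: measurable_funTS; exact: continuous_measurable_fun.
rewrite (@continuous_FTC2 _ ('D_1 phi) phi)//.
- exact: continuous_subspaceT.
- split=> [x _||]; first exact: smooth_derivable.
  + by apply: cvg_at_right_filter; exact: smooth_continuous.
  + by apply: cvg_at_left_filter; exact: smooth_continuous.
- by move=> x _; rewrite derive1E.
Qed.

Lemma smooth_measurable (f : R * R -> R) (D : set RR) : smooth f -> measurable_fun D (f : RR -> R).
Proof.
move=> sf; apply: measurable_funTS; apply: continuous_measurable_plane.
exact: smooth_continuous.
Qed.

Lemma smooth_measurable1 (f : R -> R) (D : set R) : smooth f -> measurable_fun D f.
Proof.
move=> sf; apply: measurable_funTS; apply: continuous_measurable_fun.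
exact: smooth_continuous.
Qed.

Lemma test_function_measurable (f : R * R -> R) (Q D : set RR) :
  test_function Q f -> measurable_fun D (f : RR -> R).
Proof. by case=> sf _; exact: smooth_measurable. Qed.

Lemma test_function_out (V : normedModType R) (Q : set V) (f : V -> R) x :
  test_function Q f -> ~ Q x -> f x = 0.
Proof. by move=> [_ [K [_ KQ fK]]] Qx; apply: fK => /KQ. Qed.

(** The weight depends on x only, so integrating in t first takes it out of the inner integral, and
    it may be discontinuous. This is how chi enters later. *)
Lemma int_dt_test a b c d (F : R * R -> R) (g : R -> R) M :
  a < b -> test_function (rect a b c d) F ->
  measurable_fun `]c, d[%classic g -> (forall x, `]c, d[%classic x -> `|g x| <= M) ->
  \int[mu2]_(p in rect a b c d) (g p.2 * 'D_(1, 0) F p) = 0.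
Proof.
move=> ab tF mg gM; have sF := tF.1.
have mg2 : measurable_fun (rect a b c d) (fun p : RR => g p.2).
  apply: (measurable_comp (F := `]c, d[%classic)) => //.
    by move=> _ [p [_ pQ] <-].
  exact: measurable_funTS.
have sD : smooth ('D_(1, 0) F) by exact: smooth_derive.
have [N hN] := continuous_rect_bounded a b c d (smooth_continuous sD).
apply: fubini_zero => //.
  apply: (Ig_bddM (measurable_rect a b c d) mg2 (M := M)).
    by move=> p [_ /gM].
  apply: (Ig_bdd (measurable_rect a b c d) (mu2_rect_lty _ _ _ _) _ hN).
  exact: smooth_measurable.
left; apply: aeW => x /= _.
have h t : differentiable F (t, x) by exact: smooth_differentiable.
under eq_integral => t _ do rewrite EFinM.
have sslice : smooth (fun t => F (t, x)) by exact: smooth_slice1.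
have E t : 'D_(1, 0) F (t, x) = 'D_1 (fun t => F (t, x)) t.
  by have [_ ->] := derive_slice1 (h t); rewrite mul1r.
under eq_integral => t _ do rewrite E.
have sd1 := smooth_derive (1 : R) sslice.
rewrite integralZl//=; last first.
  have [N1 hN1] := continuous_itv_bounded a b (smooth_continuous sd1).
  apply: (@Ig_bdd _ _ _ mu _ (measurable_itv _) N1 _ (lebesgue_itv_lty a b) _ hN1).
  exact: (@smooth_measurable1 ('D_1 (fun t : R => F (t, x)))).
rewrite smooth_FTC// !(test_function_out tF) ?subrr ?mule0//.
  by move=> [/=]; rewrite in_itv/= ltxx.
by move=> [/=]; rewrite in_itv/= ltxx andbF.
Qed.

Lemma int_dx_test a b c d (F : R * R -> R) :
  c < d -> test_function (rect a b c d) F ->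
  \int[mu2]_(p in rect a b c d) 'D_(0, 1) F p = 0.
Proof.
move=> cd tF; have sF := tF.1.
have sD : smooth ('D_(0, 1) F) by exact: smooth_derive.
have [N hN] := continuous_rect_bounded a b c d (smooth_continuous sD).
apply: fubini_zero => //.
  apply: (Ig_bdd (measurable_rect a b c d) (mu2_rect_lty _ _ _ _) _ hN).
  exact: smooth_measurable.
right; apply: aeW => t /= _.
have h x : differentiable F (t, x) by exact: smooth_differentiable.
rewrite (@eq_integral _ _ _ mu _ (fun x => ('D_1 (fun x => F (t, x)) x)%:E)); last first.
  by move=> x _; have [_ ->] := derive_slice (h x); rewrite mul1r.
rewrite smooth_FTC//; last exact: smooth_slice.
rewrite !(test_function_out tF) ?subrr//.
  by move=> [/= _]; rewrite in_itv/= ltxx.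
by move=> [/= _]; rewrite in_itv/= ltxx andbF.
Qed.

Lemma test_function_sub (V : normedModType R) (D E : set V) (f : V -> R) :
  D `<=` E -> test_function D f -> test_function E f.
Proof.
by move=> DE [sf [K [cK KD fK]]]; split => //; exists K; split => //; exact: subset_trans DE.
Qed.

Lemma test_functionM (V : normedModType R) (D : set V) (f g : V -> R) :
  smooth g -> test_function D f -> test_function D (fun x => g x * f x).
Proof.
move=> sg [sf [K [cK KD fK]]]; split; first exact: smoothM.
by exists K; split => // x /fK ->; rewrite mulr0.
Qed.

Lemma test_functionB (V : normedModType R) (D : set V) (f g : V -> R) :
  test_function D f -> test_function D g -> test_function D (fun x => f x - g x).
Proof.
move=> [sf [K [cK KD fK]]] [sg [L [cL LD gL]]]; split; first exact: smoothB.
exists (K `|` L); split; first exact: compactU.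
  by move=> x [/KD|/LD].
by move=> x KL; rewrite fK ?gL ?subrr// => h; apply: KL; [right|left].
Qed.

Lemma test_function_tensor (A B : set R) (f g : R -> R) :
  test_function A f -> test_function B g -> test_function (A `*` B) (tensor f g).
Proof.
move=> [sf [K [cK KA fK]]] [sg [L [cL LB gL]]]; split; first exact: smooth_tensor.
exists (K `*` L); split; first exact: compact_setX.
  by move=> p [/KA ? /LB ?].
move=> p /not_andP[/fK h|/gL h]; rewrite /tensor h ?mul0r ?mulr0//.
Qed.

(** Cutoffs are test functions that converge boundedly to indicators of rectangles, so the integrals
    over quadrants vanish. *)
Lemma test_function_ae0 a b c d (g : RR -> R) :
  mu2.-integrable (rect a b c d) (EFin \o g) ->
  (forall f, test_function (rect a b c d) f ->
     \int[mu2]_(p in rect a b c d) (g p * f p) = 0) ->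
  {ae mu2, forall p, rect a b c d p -> g p = 0}.
Proof.
move=> ig h.
have mQ := measurable_rect a b c d.
pose G := g \_ (rect a b c d).
suff : {ae mu2, forall p, G p = 0}.
  by apply: filterS => p; rewrite /G patchE => + Qp; rewrite mem_set.
have iG : mu2.-integrable setT (EFin \o G).
  by rewrite -restrict_EFin; apply/(integrable_mkcond _ mQ).
have mg : measurable_fun (rect a b c d) g by exact: Ig_measurable ig.
apply: quadrant_integral_ae0 => // t x.
(* The quadrant with corner (t, x) meets the rectangle in a smaller, possibly empty rectangle; its
   cutoffs are test functions of the original one. *)
pose f n := tensor (cutoff a (Num.min b t) n.+1%:R^-1) (cutoff c (Num.min d x) n.+1%:R^-1).
have c0 n : 0 < n.+1%:R^-1 :> R by rewrite invr_gt0.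
have tf n : test_function (rect a b c d) (f n).
  apply: (@test_function_sub _ (rect a (Num.min b t) c (Num.min d x))).
    move=> p [/=]; rewrite !in_itv/= !lt_min => /andP[h1 /andP[h2 _]] /andP[h3 /andP[h4 _]].
    by split; rewrite /= in_itv/=; apply/andP.
  by apply: test_function_tensor; exact: test_function_cutoff.
have cv : (fun n => \int[mu2]_(p in rect a b c d) (g p * f n p)) @ \oo -->
    \int[mu2]_(p in rect a b c d) (g p * \1_(`]-oo, t[%classic `*` `]-oo, x[%classic) p).
  apply: (Rintegral_dct mQ (g := fun p => `|g p|)).
  - by move=> n; apply: measurable_funM => //; exact: test_function_measurable (tf n).
  - by apply: measurable_funM => //; apply: measurable_indic; exact: measurableX.
  - apply: aeW => -[s y] [/=]; rewrite !in_itv/= => /andP[as_ sb] /andP[cy yd].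
    apply: cvgM; first exact: cvg_cst.
    have -> : \1_(`]-oo, t[%classic `*` `]-oo, x[%classic) (s, y) =
        \1_`]a, Num.min b t[%classic s * \1_`]c, Num.min d x[%classic y :> R.
      rewrite !indicE -natrM mulnb; congr (nat_of_bool _)%:R.
      apply/idP/andP; rewrite !inE/= !in_itv/= !lt_min as_ sb cy yd/=.
        by move=> [].
      by [].
    by apply: cvgM; exact: cutoff_cvg.
  - exact: (integrable_norm ig).
  - move=> n p _; rewrite normrM ler_piMr// /f /tensor normrM mulr_ile1// cutoff_norm_le1//.
have : \int[mu2]_(p in rect a b c d) (g p * \1_(`]-oo, t[%classic `*` `]-oo, x[%classic) p) = 0.
  rewrite -(cvg_lim _ cv)//; under eq_fun do rewrite h//.
  exact: lim_cst.
move=> <-; rewrite [LHS]Rintegral_mkcond [RHS]Rintegral_mkcond.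
apply: eq_Rintegral => p _; rewrite /G !patchE indicE.
by case: ifP => _; case: ifP => _; rewrite ?mulr1 ?mulr0.
Qed.

End rectangles.

(** The difference quotients at 0 are at least [c] from the right and at most [c] from the left, and
    both tend to [l]. *)
Lemma is_derive_lower_line {R : realType} (F : R -> R) (l c : R) :
  is_derive (0 : R) (1 : R) F l -> (\forall e \near 0, F 0 + e * c <= F e) -> l = c.
Proof.
move=> dF near0.
have /cvg_ex[l' cv] : cvg ((fun h => h^-1 *: (F (h *: 1 + 0) - F 0)) @ 0^') by exact: ex_derive.
have El : l' = l.
  have <- : 'D_1 F 0 = l by exact: derive_val.
  by apply/esym; exact: (cvg_lim (@norm_hausdorff _ _) cv).
rewrite El in cv.
apply/eqP; rewrite eq_le; apply/andP; split.
  apply: (cvgr_to_le (cvg_dnbhs_at_left cv)); near=> h.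
  have h0 : h < 0 by near: h; exact: nbhs_left_lt.
  rewrite /GRing.scale/= mulr1 addr0 ler_ndivrMl// mulrC lerBrDl.
  by rewrite mulrC; near: h; rewrite near_withinE; apply: filterS near0 => y.
apply: (cvgr_to_ge (cvg_dnbhs_at_right cv)); near=> h.
have h0 : 0 < h by near: h; exact: nbhs_right_gt.
rewrite /GRing.scale/= mulr1 addr0 ler_pdivlMl// lerBrDl.
by near: h; rewrite near_withinE; apply: filterS near0 => y.
Unshelve. all: by end_near. Qed.

Local Opaque derive ip Defs.L2.

(** * Weak derivatives on the cylinder *)

Section cylinder.
Context {R : realType} (T : R) (T0 : 0 < T).
Local Notation mu2 := (@mu2 R).
Local Notation RR := (measurableTypeR R * measurableTypeR R)%type.
Local Notation Q := (QT T).
Local Notation L2Q := (L2 mu2 Q).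
Local Notation ipQ := (ip mu2 Q).
Local Notation nQ f := (ip mu2 Q f f).
Implicit Types (u v w g h : R * R -> R) (e : R * R).

Lemma measurable_QT : measurable (Q : set RR).
Proof. exact: measurable_rect. Qed.
Let mQ := measurable_QT.

Lemma mu2_QT_lty : (mu2 Q < +oo)%E.
Proof. exact: mu2_rect_lty. Qed.
Let Qfin := mu2_QT_lty.

Lemma smooth_QT_bounded f : smooth f -> exists M, forall p, Q p -> `|f p| <= M.
Proof. by move=> /smooth_continuous /continuous_rect_bounded; exact. Qed.

Lemma L2_smooth (f : R * R -> R) : smooth f -> L2Q f.
Proof.
move=> sf; have [M hM] := smooth_QT_bounded sf.
by apply: (L2_bdd mQ Qfin _ hM); exact: smooth_measurable.
Qed.

Lemma small_eq0 (x C : R) : (forall eps, 0 < eps -> x <= C * eps) -> x <= 0.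
Proof.
move=> h; have [C0|C0] := leP C 0.
  by apply: le_trans (h 1 ltr01) _; rewrite mulr1.
rewrite leNgt; apply/negP => x0.
have := h (x / C / 2); rewrite !divr_gt0// => /(_ isT).
have -> : C * (x / C / 2) = x / 2 by field; rewrite gt_eqF.
lra.
Qed.

Lemma sum3_lt (a b c eps : R) : 0 <= a -> 0 <= b -> 0 <= c -> a + b + c < eps ->
  [/\ a < eps, b < eps & c < eps].
Proof. by move=> *; split; lra. Qed.

Lemma sum3_lt4 (a b c eps : R) : 0 < eps -> a <= eps / 4 -> b <= eps / 4 ->
  c <= eps / 4 -> a + b + c < eps.
Proof. move=> *; lra. Qed.

(** Replaces passages to the limit: to extend a bilinear identity by density, the defect [x] is
    written as pairings with arbitrarily small errors, and Cauchy-Schwarz bounds x^2 by a multiple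
    of eps. *)
Lemma ip_small_eq0 (x : R) A B : L2Q A -> L2Q B ->
  (forall eps, 0 < eps -> exists f g, [/\ L2Q f, L2Q g, nQ f <= eps, nQ g <= eps &
     x = ipQ A f + ipQ B g]) -> x = 0.
Proof.
move=> LA LB h; apply/eqP; rewrite -sqrf_eq0; apply/eqP.
apply: le_anti; rewrite sqr_ge0 andbT.
apply: (@small_eq0 _ (2 * (nQ A + nQ B))) => // eps /h[f [g [Lf Lg fe ge ->]]].
exact: ip_CS2.
Qed.

Lemma wderiv_unique e u g h : wderiv T e u g -> wderiv T e u h ->
  {ae mu2, forall p, Q p -> g p = h p}.
Proof.
move=> [_ Lg Hg] [_ Lh Hh].
have Ld : L2Q (fun p => g p - h p) by exact: L2B.
have L1 : L2Q (cst 1) by exact/L2_smooth/smooth_cst.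
have Id : mu2.-integrable Q (EFin \o (fun p => g p - h p)).
  have := L2_mul mQ Ld L1; apply: eq_integrable => // p _ /=.
  by rewrite mulr1.
have : {ae mu2, forall p, Q p -> g p - h p = 0}.
  apply: test_function_ae0 => // f tf.
  have Lf := L2_smooth tf.1.
  have := Hg f tf; rewrite Hh// => /eqP; rewrite -subr_eq0 -opprD.
  rewrite -[_ - _]/(ipQ h f - ipQ g f) => E.
  rewrite -[LHS]/(ipQ (fun p => g p - h p) f) ipBl//; move/eqP: E; lra.
by apply: ae_imp => p + Qp => /(_ Qp) /eqP; rewrite subr_eq0 => /eqP.
Qed.

Lemma dt_spec u : (exists g, wderiv T (1, 0) u g) -> wderiv T (1, 0) u (dt T u).
Proof. by move=> [g hg]; apply: (@xgetPex _ _ [set g | wderiv T (1, 0) u g]); exists g. Qed.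

Lemma dx_spec u : (exists g, wderiv T (0, 1) u g) -> wderiv T (0, 1) u (dx T u).
Proof. by move=> [g hg]; apply: (@xgetPex _ _ [set g | wderiv T (0, 1) u g]); exists g. Qed.

Local Opaque dt dx.

Lemma dt_ae u g : wderiv T (1, 0) u g -> {ae mu2, forall p, Q p -> dt T u p = g p}.
Proof. by move=> h; apply: wderiv_unique (h); apply: dt_spec; exists g. Qed.

Lemma dx_ae u g : wderiv T (0, 1) u g -> {ae mu2, forall p, Q p -> dx T u p = g p}.
Proof. by move=> h; apply: wderiv_unique (h); apply: dx_spec; exists g. Qed.

Lemma H1_wderiv u : H1 T u -> wderiv T (1, 0) u (dt T u) /\ wderiv T (0, 1) u (dx T u).
Proof. by move=> [h1 h2]; split; [exact: dt_spec|exact: dx_spec]. Qed.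

Lemma wderiv_lin e u v g h a : wderiv T e u g -> wderiv T e v h ->
  wderiv T e (fun p => u p + a * v p) (fun p => g p + a * h p).
Proof.
move=> [Lu Lg Hg] [Lv Lh Hh].
have Lav := L2Z mQ a Lv; have Lah := L2Z mQ a Lh.
split; [exact: L2D|exact: L2D|move=> f tf].
have Lf := L2_smooth tf.1; have LDf := L2_smooth (smooth_derive e tf.1).
rewrite -[LHS]/(ipQ (fun p => u p + a * v p) ('D_e f)).
rewrite -[X in - X]/(ipQ (fun p => g p + a * h p) f) !ipDl// !ipZl//.
have -> : ipQ u ('D_e f) = - ipQ g f by exact: Hg.
have -> : ipQ v ('D_e f) = - ipQ h f by exact: Hh.
ring.
Qed.

Lemma int_dir_test e (F : R * R -> R) : e = (1, 0) \/ e = (0, 1) ->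
  test_function Q F -> \int[mu2]_(p in Q) 'D_e F p = 0.
Proof.
case=> -> tF; last exact: int_dx_test.
have := @int_dt_test _ 0 T 0 1 F (cst 1) 1 T0 tF.
under eq_Rintegral => p _ do rewrite mul1r.
by apply => // x _; rewrite normr1.
Qed.

Lemma wderiv_smooth e U : e = (1, 0) \/ e = (0, 1) -> smooth U -> wderiv T e U ('D_e U).
Proof.
move=> he sU; have sD := smooth_derive e sU.
split; [exact: L2_smooth|exact: L2_smooth|move=> f tf].
have := int_dir_test he (test_functionM sU tf).
under eq_Rintegral => p _ do rewrite (smooth_deriveM _ _ sU tf.1) (mulrC (f p)).
rewrite RintegralD//; first lra.
  by apply: L2_mul => //; apply: L2_smooth => //; apply: smooth_derive; exact: tf.1.
by apply: L2_mul => //; apply: L2_smooth => //; exact: tf.1.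
Qed.

Lemma wderiv_lim e u g : L2Q u -> L2Q g ->
  (forall eps, 0 < eps -> exists v h, [/\ wderiv T e v h,
     nQ (fun p => u p - v p) <= eps & nQ (fun p => g p - h p) <= eps]) ->
  wderiv T e u g.
Proof.
move=> Lu Lg H; split => // f tf.
have Lf := L2_smooth tf.1; have LDf := L2_smooth (smooth_derive e tf.1).
apply/eqP; rewrite -subr_eq0 opprK; apply/eqP.
apply: (@ip_small_eq0 _ ('D_e f) f) => // eps /H[v [h [[Lv Lh Hv] h1 h2]]].
have L1 := L2B mQ Lu Lv; have L2' := L2B mQ Lg Lh.
exists (fun p => u p - v p), (fun p => g p - h p); split => //.
have -> : ipQ ('D_e f) (fun p => u p - v p) = ipQ u ('D_e f) - ipQ v ('D_e f).
  by rewrite ipC ipBl.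
have -> : ipQ f (fun p => g p - h p) = ipQ g f - ipQ h f by rewrite ipC ipBl.
have -> : ipQ v ('D_e f) = - ipQ h f by exact: Hv.
rewrite !ipE; ring.
Qed.

Lemma H1dist2E u (f : R * R -> R) (eps : R) : H1 T u -> smooth f ->
  H1dist2 T u f = (nQ (fun p => u p - f p) + nQ (fun p => dt T u p - 'D_(1, 0) f p)
    + nQ (fun p => dx T u p - 'D_(0, 1) f p))%:E.
Proof.
move=> /H1_wderiv[[Lu Lt _] [_ Lx _]] sf.
have L0 := L2B mQ Lu (L2_smooth sf).
have L1 := L2B mQ Lt (L2_smooth (smooth_derive ((1, 0) : R * R) sf)).
have L2' := L2B mQ Lx (L2_smooth (smooth_derive ((0, 1) : R * R) sf)).
exact: (integral_sqr3 mQ L0 L1 L2').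
Qed.

Lemma H10_approx v : H10 T v -> forall eps, 0 < eps ->
  exists f, [/\ test_function Q f, nQ (fun p => v p - f p) <= eps,
    nQ (fun p => dt T v p - 'D_(1, 0) f p) <= eps &
    nQ (fun p => dx T v p - 'D_(0, 1) f p) <= eps].
Proof.
move=> [Hv H] eps /H[f tf]; rewrite (H1dist2E 0 Hv tf.1) lte_fin => h; exists f.
have h1 := ip_ge0 mu2 Q (fun p => v p - f p).
have h2 := ip_ge0 mu2 Q (fun p => dt T v p - 'D_(1, 0) f p).
have h3 := ip_ge0 mu2 Q (fun p => dx T v p - 'D_(0, 1) f p).
have [h4 h5 h6] := sum3_lt h1 h2 h3 h.
by split; [exact: tf|exact: ltW h4|exact: ltW h5|exact: ltW h6].
Qed.

(** [H10] refers to the chosen derivatives [dt] and [dx]; any weak derivatives may be used instead,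
    since they agree with these almost everywhere. *)
Lemma H10_of_approx v gt gx : wderiv T (1, 0) v gt -> wderiv T (0, 1) v gx ->
  (forall eps, 0 < eps -> exists f, [/\ test_function Q f, nQ (fun p => v p - f p) <= eps,
    nQ (fun p => gt p - 'D_(1, 0) f p) <= eps &
    nQ (fun p => gx p - 'D_(0, 1) f p) <= eps]) -> H10 T v.
Proof.
move=> ht hx H.
have Hv : H1 T v by split; [exists gt|exists gx].
have [[_ Lt _] [_ Lx _]] := H1_wderiv Hv.
have Lgt : L2Q gt by case: ht. have Lgx : L2Q gx by case: hx.
split => // eps e0; have e4 : 0 < eps / 4 by rewrite divr_gt0.
have [f [tf h1 h2 h3]] := H _ e4; exists f => //.
rewrite (H1dist2E 0 Hv tf.1) lte_fin.
have E1 : nQ (fun p => dt T v p - 'D_(1, 0) f p) = nQ (fun p => gt p - 'D_(1, 0) f p).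
  have LD := L2_smooth (smooth_derive ((1, 0) : R * R) tf.1).
  have L1 := L2B mQ Lt LD; have L2' := L2B mQ Lgt LD.
  have ae : {ae mu2, forall p, Q p -> dt T v p - 'D_(1, 0) f p = gt p - 'D_(1, 0) f p}.
    by apply: ae_imp (dt_ae ht) => p h Qp; rewrite h.
  exact: (ip_sqr_ae mQ L1 L2' ae).
have E2 : nQ (fun p => dx T v p - 'D_(0, 1) f p) = nQ (fun p => gx p - 'D_(0, 1) f p).
  have LD := L2_smooth (smooth_derive ((0, 1) : R * R) tf.1).
  have L1 := L2B mQ Lx LD; have L2' := L2B mQ Lgx LD.
  have ae : {ae mu2, forall p, Q p -> dx T v p - 'D_(0, 1) f p = gx p - 'D_(0, 1) f p}.
    by apply: ae_imp (dx_ae hx) => p h Qp; rewrite h.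
  exact: (ip_sqr_ae mQ L1 L2' ae).
exact: (sum3_lt4 e0 h1 (eq_ind_r (fun z => z <= eps / 4) h2 E1)
  (eq_ind_r (fun z => z <= eps / 4) h3 E2)).
Qed.

Lemma H10_H1 v : H10 T v -> H1 T v. Proof. by case. Qed.

Lemma H10_L2 v : H10 T v -> [/\ L2Q v, L2Q (dt T v) & L2Q (dx T v)].
Proof. move=> /H10_H1/H1_wderiv[[h1 h2 _] [_ h3 _]].
by split; [exact: h1|exact: h2|exact: h3]. Qed.

Lemma H1_lin v w a : H1 T v -> H1 T w ->
  [/\ H1 T (fun p => v p + a * w p),
     {ae mu2, forall p, Q p -> dt T (fun p => v p + a * w p) p = dt T v p + a * dt T w p} &
     {ae mu2, forall p, Q p -> dx T (fun p => v p + a * w p) p = dx T v p + a * dx T w p}].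
Proof.
move=> /H1_wderiv[vt vx] /H1_wderiv[wt wx].
have ht := wderiv_lin a vt wt; have hx := wderiv_lin a vx wx.
split; [split|exact: dt_ae ht|exact: dx_ae hx].
  by exists (fun p => dt T v p + a * dt T w p).
by exists (fun p => dx T v p + a * dx T w p).
Qed.

Lemma lin_le_arith (a x y eps : R) : x <= eps -> y <= eps ->
  2 * x + 2 * (a ^+ 2 * y) <= 2 * (1 + a ^+ 2) * eps.
Proof. by move=> h1 /(ler_wpM2l (sqr_ge0 a)); lra. Qed.

Lemma leibniz_arith (k w d f e : R) : k * (w * d + f * e) = k * e * f + k * w * d.
Proof. ring. Qed.

Lemma nQ_lin_le (a eps : R) (f g f' g' : R * R -> R) :
  L2Q f -> L2Q g -> L2Q f' -> L2Q g' ->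
  nQ (fun p => f p - f' p) <= eps -> nQ (fun p => g p - g' p) <= eps ->
  nQ (fun p => (f p + a * g p) - (f' p + a * g' p)) <= 2 * (1 + a ^+ 2) * eps.
Proof.
move=> Lf Lg Lf' Lg' h1 h2.
have L1 := L2B mQ Lf Lf'; have L2' := L2B mQ Lg Lg'.
have -> : (fun p => (f p + a * g p) - (f' p + a * g' p)) =
    (fun p => (f p - f' p) + a * (g p - g' p)) by apply/funext => p; ring.
apply: le_trans (ip_tri mQ L1 (L2Z mQ a L2')) _.
rewrite (ip_sqrZ mQ a L2'); exact: lin_le_arith.
Qed.

Lemma H10_lin v w a : H10 T v -> H10 T w -> H10 T (fun p => v p + a * w p).
Proof.
move=> Hv Hw.
have [vt vx] := H1_wderiv (H10_H1 Hv); have [wt wx] := H1_wderiv (H10_H1 Hw).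
have [Lv Lvt Lvx] := H10_L2 Hv; have [Lw Lwt Lwx] := H10_L2 Hw.
apply: (H10_of_approx (wderiv_lin a vt wt) (wderiv_lin a vx wx)) => eps e0.
have c0 : 0 < 2 * (1 + a ^+ 2) by rewrite mulr_gt0// ltr_pwDl// sqr_ge0.
have e'0 : 0 < eps / (2 * (1 + a ^+ 2)) by rewrite divr_gt0.
have [f [tf f1 f2 f3]] := H10_approx Hv e'0.
have [g [tg g1 g2 g3]] := H10_approx Hw e'0.
have tg' := test_functionM (smooth_cst a) tg.
have tfg : test_function Q (fun p => f p + a * g p).
  have := test_functionB tf (test_functionM (smooth_cst (- a)) tg).
  by under eq_fun do rewrite /= mulNr opprK.
have Ee : eps = 2 * (1 + a ^+ 2) * (eps / (2 * (1 + a ^+ 2))) by rewrite mulrC divfK// gt_eqF.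
have D (h : R * R -> R) (e : R * R) : (fun p => h p - 'D_e (fun p => f p + a * g p) p) =
    (fun p => h p - ('D_e f p + a * 'D_e g p)).
  apply/funext => p; rewrite (smooth_deriveD _ _ tf.1 tg'.1).
  by rewrite (smooth_deriveZ _ _ _ tg.1).
have Lf := L2_smooth tf.1; have Lg := L2_smooth tg.1.
have Lft := L2_smooth (smooth_derive ((1, 0) : R * R) tf.1).
have Lgt := L2_smooth (smooth_derive ((1, 0) : R * R) tg.1).
have Lfx := L2_smooth (smooth_derive ((0, 1) : R * R) tf.1).
have Lgx := L2_smooth (smooth_derive ((0, 1) : R * R) tg.1).
exists (fun p => f p + a * g p); split; first exact: tfg.
- rewrite [leRHS]Ee; exact: (nQ_lin_le a Lv Lw Lf Lg f1 g1).
- rewrite D [leRHS]Ee; exact: (nQ_lin_le a Lvt Lwt Lft Lgt f2 g2).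
- rewrite D [leRHS]Ee; exact: (nQ_lin_le a Lvx Lwx Lfx Lgx f3 g3).
Qed.

Lemma measurable_snd_QT (g : R -> R) : measurable_fun I01 g ->
  measurable_fun Q (fun p : RR => g p.2).
Proof.
move=> mg; apply: (measurable_comp (F := I01)) => //; first exact: measurable_itv.
  by move=> _ [p [_ pQ] <-].
exact: measurable_funTS.
Qed.

Lemma L2_snd_smooth (g : R -> R) M (W : R * R -> R) : measurable_fun I01 g ->
  (forall x, I01 x -> `|g x| <= M) -> smooth W -> L2Q (fun p => g p.2 * W p).
Proof.
move=> mg gM sW; apply: (L2_bddM mQ (measurable_snd_QT mg)); last exact: L2_smooth.
by move=> p [_ /gM]; exact.
Qed.

Lemma H10_int_dt v (g : R -> R) M (W : R * R -> R) : H10 T v ->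
  measurable_fun I01 g -> (forall x, I01 x -> `|g x| <= M) -> smooth W ->
  ipQ (fun p => g p.2 * 'D_(1, 0) W p) v = - ipQ (fun p => g p.2 * W p) (dt T v).
Proof.
move=> Hv mg gM sW; have [Lv Lvt _] := H10_L2 Hv.
have LA := L2_snd_smooth mg gM (smooth_derive ((1, 0) : R * R) sW).
have LB := L2_snd_smooth mg gM sW.
apply/eqP; rewrite -subr_eq0 opprK; apply/eqP.
apply: (ip_small_eq0 LA LB) => eps /(H10_approx Hv)[f [tf f1 f2 _]].
have Lf := L2_smooth tf.1.
have LDf := L2_smooth (smooth_derive ((1, 0) : R * R) tf.1).
exists (fun p => v p - f p), (fun p => dt T v p - 'D_(1, 0) f p).
split; [exact: L2B|exact: L2B|exact: f1|exact: f2|].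
rewrite !ipBr//.
suff : ipQ (fun p => g p.2 * 'D_(1, 0) W p) f + ipQ (fun p => g p.2 * W p) ('D_(1, 0) f) = 0.
  by move=> S; rewrite addrACA -opprD S subr0.
have := int_dt_test T0 (test_functionM sW tf) mg gM.
rewrite !ipE -RintegralD//; try exact: L2_mul.
move=> H; rewrite -[RHS]H; apply: eq_Rintegral => p _.
rewrite (smooth_deriveM _ _ sW tf.1).
exact: (esym (leibniz_arith _ _ _ _ _)).
Qed.

Lemma H10_int_dx v (W : R * R -> R) : H10 T v -> smooth W ->
  ipQ ('D_(0, 1) W) v = - ipQ W (dx T v).
Proof.
move=> Hv sW; have [Lv _ Lvx] := H10_L2 Hv.
have LA := L2_smooth (smooth_derive ((0, 1) : R * R) sW).
have LB := L2_smooth sW.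
apply/eqP; rewrite -subr_eq0 opprK; apply/eqP.
apply: (ip_small_eq0 LA LB) => eps /(H10_approx Hv)[f [tf f1 _ f2]].
have Lf := L2_smooth tf.1.
have LDf := L2_smooth (smooth_derive ((0, 1) : R * R) tf.1).
exists (fun p => v p - f p), (fun p => dx T v p - 'D_(0, 1) f p).
split; [exact: L2B|exact: L2B|exact: f1|exact: f2|].
rewrite !ipBr//.
suff : ipQ ('D_(0, 1) W) f + ipQ W ('D_(0, 1) f) = 0.
  by move=> S; rewrite addrACA -opprD S subr0.
have := int_dir_test (or_intror erefl) (test_functionM sW tf).
rewrite !ipE -RintegralD//; try exact: L2_mul.
move=> H; rewrite -[RHS]H; apply: eq_Rintegral => p _.
by rewrite (smooth_deriveM _ _ sW tf.1) addrC [f p * _]mulrC.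
Qed.

Lemma poincare_arith (x y z : R) : 0 <= x -> 0 <= y -> y <= T ^+ 2 * z ->
  x ^+ 2 <= (-2) ^+ 2 * y * x -> x <= 4 * T ^+ 2 * z.
Proof.
rewrite sqrrN expr2 => x0 y0 h1 h; have [->|xn0] := eqVneq x 0; first lra.
have xp : 0 < x by rewrite lt_def xn0.
have : x <= 2 ^+ 2 * y by rewrite -(ler_pM2r xp).
lra.
Qed.

Lemma poincare_arith2 (t a b c d k l eps : R) : 0 <= t -> k <= eps -> l <= eps ->
  b <= 4 * t * d -> a <= 2 * k + 2 * b -> d <= 2 * c + 2 * l ->
  a - 16 * t * c <= (2 + 16 * t) * eps.
Proof.
move=> t0 h1 h2 h3 h4 h5.
have := ler_wpM2l t0 h5; have := ler_wpM2l t0 h2; nra.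
Qed.

(** The t-derivative of t f^2 has integral zero, so |f|^2 = -2 <t f_t, f>; Cauchy-Schwarz and 0 <= t
    <= T conclude. *)
Lemma poincare_test f : test_function Q f -> nQ f <= 4 * T ^+ 2 * nQ ('D_(1, 0) f).
Proof.
move=> tf; have sf := tf.1.
have sD := smooth_derive ((1, 0) : R * R) sf.
have sfst : smooth (fun p : R * R => p.1) by exact: (smooth_fst smooth_id).
pose k : R * R -> R := fun p => p.1 * 'D_(1, 0) f p.
have sk : smooth k by exact: smoothM.
have E : nQ f = ipQ (fun p => (-2) * k p) f.
  have tF := test_functionM (smoothM sfst sf) tf.
  have := int_dir_test (or_introl erefl) tF.
  rewrite !ipE => H; apply/eqP; rewrite -subr_eq0 -RintegralB//; last 2 first.
  - by apply: L2_mul => //; exact: L2_smooth.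
  - by apply: L2_mul => //; [apply: L2_smooth; exact: smoothZ|exact: L2_smooth].
  rewrite -[X in _ == X]H; apply/eqP; apply: eq_Rintegral => p _.
  rewrite (smooth_deriveM _ _ (smoothM sfst sf) sf) (smooth_deriveM _ _ sfst sf).
  have -> : 'D_(1, 0) (fun p : R * R => p.1) p = 1 :> R.
    by rewrite (derive_fst (phi := id))//; [rewrite derive_id mulr1|exact: smooth_id].
  rewrite /k; ring.
have Lf := L2_smooth sf; have Lk := L2_smooth sk.
have h1 : nQ k <= T ^+ 2 * nQ ('D_(1, 0) f).
  have LD := L2_smooth sD.
  rewrite !ipE -RintegralZl//; last exact: L2_mul.
  apply: le_Rintegral => //; first exact: L2_mul.
    by apply: IgZ => //; exact: L2_mul.
  move=> [t x] [/= + _]; rewrite in_itv/= => /andP[t0 tT].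
  rewrite /k/= mulrACA -!expr2 ler_wpM2r ?sqr_ge0// ler_sqr ?nnegrE; lra.
have := ip_CS mQ (L2Z mQ (-2) Lk) Lf; rewrite -E (ip_sqrZ mQ (-2) Lk).
have := ip_ge0 mu2 Q f; have := ip_ge0 mu2 Q k.
move=> k0 f0; exact: (poincare_arith f0 k0 h1).
Qed.

(** The constant 16 is the 4 of [poincare_test] times two factors 2, one for each triangle
    inequality between v and its approximation. *)
Lemma poincare v : H10 T v -> nQ v <= 16 * T ^+ 2 * nQ (dt T v).
Proof.
move=> Hv; have [Lv Lvt _] := H10_L2 Hv.
rewrite -subr_le0; apply: (@small_eq0 _ (2 + 16 * T ^+ 2)) => eps e0.
have [f [tf f1 f2 _]] := H10_approx Hv e0.
have Lf := L2_smooth tf.1.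
have LD := L2_smooth (smooth_derive ((1, 0) : R * R) tf.1).
have h1 := poincare_test tf.
have h2 := ip_tri mQ (L2B mQ Lv Lf) Lf.
have h3 := ip_triB mQ Lvt (L2B mQ Lvt LD).
have E1 : (fun p => (v p - f p) + f p) = v by apply/funext => p; rewrite subrK.
have E2 : (fun p => dt T v p - (dt T v p - 'D_(1, 0) f p)) = 'D_(1, 0) f.
  by apply/funext => p; rewrite subKr.
rewrite E1 in h2; rewrite E2 in h3.
exact: (poincare_arith2 (sqr_ge0 T) f1 f2 h1 h2 h3).
Qed.

End cylinder.

(* Conversion tests that must fail, such as [dt T v] against [dx T v], unfold
   the whole theory of integration and do not terminate in practice; hence
   these copies of the operations with an opaque body. *)
Section sealed.
Context {R : realType} (T : R).
Local Notation mu2 := (@mu2 R).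
Local Notation Q := (QT T).

Lemma Dt_subproof : {D : (R * R -> R) -> R * R -> R | D = dt T}.
Proof. by exists (dt T). Qed.
Definition Dt := sval Dt_subproof.
Lemma DtE : Dt = dt T. Proof. exact: (svalP Dt_subproof). Qed.

Lemma Dx_subproof : {D : (R * R -> R) -> R * R -> R | D = dx T}.
Proof. by exists (dx T). Qed.
Definition Dx := sval Dx_subproof.
Lemma DxE : Dx = dx T. Proof. exact: (svalP Dx_subproof). Qed.

Lemma ipq_subproof : {b : (R * R -> R) -> (R * R -> R) -> R | b = ip mu2 Q}.
Proof. by exists (ip mu2 Q). Qed.
Definition ipq := sval ipq_subproof.
Lemma ipqE : ipq = ip mu2 Q. Proof. exact: (svalP ipq_subproof). Qed.

Lemma L2q_subproof : {P : (R * R -> R) -> Prop | P = L2 mu2 Q}.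
Proof. by exists (L2 mu2 Q). Qed.
Definition L2q := sval L2q_subproof.
Lemma L2qE : L2q = L2 mu2 Q. Proof. exact: (svalP L2q_subproof). Qed.

Implicit Types (f g h v w : R * R -> R).
Local Notation lin v a w := (fun p => v p + a * w p).
Let mQ := @measurable_QT R T.

Lemma ipqC f g : ipq f g = ipq g f.
Proof. by rewrite ipqE; exact: ipC. Qed.

Lemma ipq_ge0 f : 0 <= ipq f f.
Proof. by rewrite ipqE; exact: ip_ge0. Qed.

Lemma L2q_lin f g a : L2q f -> L2q g -> L2q (lin f a g).
Proof. by rewrite L2qE => Lf Lg; exact: (L2D mQ Lf (L2Z mQ a Lg)). Qed.

Lemma L2qB f g : L2q f -> L2q g -> L2q (fun p => f p - g p).
Proof. by rewrite L2qE => Lf Lg; exact: (L2B mQ Lf Lg). Qed.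

Lemma L2qZ a f : L2q f -> L2q (fun p => a * f p).
Proof. by rewrite L2qE => Lf; exact: (L2Z mQ a Lf). Qed.

Lemma ipq_linl f g h a : L2q f -> L2q g -> L2q h ->
  ipq (lin f a g) h = ipq f h + a * ipq g h.
Proof.
rewrite L2qE ipqE => Lf Lg Lh.
by rewrite (ipDl mQ Lf (L2Z mQ a Lg) Lh) (ipZl mQ a Lg Lh).
Qed.

Lemma ipq_ael f g h : L2q f -> L2q g -> L2q h ->
  {ae mu2, forall p, Q p -> f p = g p} -> ipq f h = ipq g h.
Proof. by rewrite L2qE ipqE => Lf Lg Lh; exact: (ip_ael mQ Lf Lg Lh). Qed.

Lemma ipq_sqr_ae f g : L2q f -> L2q g ->
  {ae mu2, forall p, Q p -> f p = g p} -> ipq f f = ipq g g.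
Proof. by rewrite L2qE ipqE => Lf Lg; exact: (ip_sqr_ae mQ Lf Lg). Qed.

Lemma ipq_tri f g : L2q f -> L2q g ->
  ipq (fun x => f x + g x) (fun x => f x + g x) <= 2 * ipq f f + 2 * ipq g g.
Proof. by rewrite L2qE ipqE => Lf Lg; exact: (ip_tri mQ Lf Lg). Qed.

Lemma ipq_distC f g :
  ipq (fun x => f x - g x) (fun x => f x - g x) =
  ipq (fun x => g x - f x) (fun x => g x - f x).
Proof. by rewrite ipqE; exact: ip_distC. Qed.

Lemma L2q_complete (f : nat -> R * R -> R) : (forall n, L2q (f n)) ->
  (forall e, 0 < e -> exists N, forall m n, (N <= m)%N -> (N <= n)%N ->
     ipq (fun x => f m x - f n x) (fun x => f m x - f n x) <= e) ->
  exists2 g, L2q g & forall e, 0 < e -> exists N, forall n, (N <= n)%N ->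
     ipq (fun x => f n x - g x) (fun x => f n x - g x) <= e.
Proof. by rewrite L2qE ipqE; exact: (L2_complete mQ). Qed.

Lemma H10_L2q v : H10 T v -> [/\ L2q v, L2q (Dt v) & L2q (Dx v)].
Proof. by rewrite L2qE DtE DxE; exact: H10_L2. Qed.

Lemma H10_Dlin v w a : H10 T v -> H10 T w ->
  {ae mu2, forall p, Q p -> Dt (lin v a w) p = Dt v p + a * Dt w p} /\
  {ae mu2, forall p, Q p -> Dx (lin v a w) p = Dx v p + a * Dx w p}.
Proof.
rewrite DtE DxE => Hv Hw.
by have [_ h1 h2] := H1_lin a (H10_H1 Hv) (H10_H1 Hw); split; [exact: h1|exact: h2].
Qed.

Lemma poincareq v : 0 < T -> H10 T v -> ipq v v <= 16 * T ^+ 2 * ipq (Dt v) (Dt v).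
Proof. by rewrite ipqE DtE => T0; exact: poincare. Qed.

Lemma tri_arith (a b e : R) : a <= e / 4 -> b <= e / 4 -> 2 * a + 2 * b <= e.
Proof. by move=> *; lra. Qed.

Lemma ipq_tri4 f g h e : L2q f -> L2q g -> L2q h ->
  ipq (fun p => g p - f p) (fun p => g p - f p) <= e / 4 ->
  ipq (fun p => g p - h p) (fun p => g p - h p) <= e / 4 ->
  ipq (fun p => f p - h p) (fun p => f p - h p) <= e.
Proof.
move=> Lf Lg Lh h1 h2.
have -> : (fun p => f p - h p) = (fun p => (f p - g p) + (g p - h p)).
  by apply/funext => p; rewrite addrA subrK.
apply: le_trans (ipq_tri (L2qB Lf Lg) (L2qB Lg Lh)) _.
by rewrite (ipq_distC f g); exact: tri_arith h1 h2.
Qed.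

(** The derivatives converge separately to [mt] and [mx], which are the weak derivatives of [m]
    because integration against a test function is continuous. Test functions close to v are then
    close to [m]. *)
Lemma H10_closed m mt mx : L2q m -> L2q mt -> L2q mx ->
  (forall e, 0 < e -> exists v, [/\ H10 T v, ipq (fun p => v p - m p) (fun p => v p - m p) <= e,
     ipq (fun p => Dt v p - mt p) (fun p => Dt v p - mt p) <= e &
     ipq (fun p => Dx v p - mx p) (fun p => Dx v p - mx p) <= e]) ->
  [/\ H10 T m, {ae mu2, forall p, Q p -> Dt m p = mt p} &
      {ae mu2, forall p, Q p -> Dx m p = mx p}].
Proof.
move=> Lm Lmt Lmx H.
have dmt : wderiv T (1, 0) m mt.
  apply: wderiv_lim; [by rewrite -L2qE|by rewrite -L2qE|].
  rewrite -ipqE => e /H[v [Hv h1 h2 _]]; exists v, (Dt v).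
  split; [|by rewrite ipq_distC|by rewrite ipq_distC].
  by rewrite DtE; have [] := H1_wderiv (H10_H1 Hv).
have dmx : wderiv T (0, 1) m mx.
  apply: wderiv_lim; [by rewrite -L2qE|by rewrite -L2qE|].
  rewrite -ipqE => e /H[v [Hv h1 _ h2]]; exists v, (Dx v).
  split; [|by rewrite ipq_distC|by rewrite ipq_distC].
  by rewrite DxE; have [] := H1_wderiv (H10_H1 Hv).
split; [|by rewrite DtE; exact: dt_ae dmt|by rewrite DxE; exact: dx_ae dmx].
apply: (H10_of_approx dmt dmx) => e e0; have e4 : 0 < e / 4 by rewrite divr_gt0.
have [v [Hv h1 h2 h3]] := H _ e4.
have [f [tf]] := H10_approx Hv e4; rewrite -ipqE -DtE -DxE => f1 f2 f3.
have [Lv Lvt Lvx] := H10_L2q Hv.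
exists f; split; first exact: tf.
- apply: (ipq_tri4 Lm Lv) h1 f1; rewrite L2qE; exact: L2_smooth tf.1.
- apply: (ipq_tri4 Lmt Lvt) h2 f2; rewrite L2qE; exact: L2_smooth (smooth_derive _ tf.1).
- apply: (ipq_tri4 Lmx Lvx) h3 f3; rewrite L2qE; exact: L2_smooth (smooth_derive _ tf.1).
Qed.

End sealed.

(** * The energy inner product *)

Section energy.
Context {R : realType} (T : R) (T0 : 0 < T).
Local Notation mu2 := (@mu2 R).
Local Notation Q := (QT T).
Local Notation L2Q := (L2q T).
Local Notation Dt := (Dt T).
Local Notation Dx := (Dx T).
Local Notation ipQ := (ipq T).
Local Notation nQ f := (ipq T f f).
Local Notation lin v a w := (fun p => v p + a * w p).
Implicit Types (v w m k : R * R -> R).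

Definition energy v w : R := ipQ (Dt v) (Dt w) + ipQ (Dx v) (Dx w).

Lemma energyC v w : energy v w = energy w v.
Proof. by rewrite /energy (ipqC T (Dt v)) (ipqC T (Dx v)). Qed.

Lemma energy_ge0 v : 0 <= energy v v.
Proof. by apply: addr_ge0; exact: ipq_ge0. Qed.

Lemma energy_arith (a x y z t : R) : (x + a * y) + (z + a * t) = (x + z) + a * (y + t).
Proof. ring. Qed.

Lemma energy_linl v w k a : H10 T v -> H10 T w -> H10 T k ->
  energy (lin v a w) k = energy v k + a * energy w k.
Proof.
move=> Hv Hw Hk; have [_ Lvt Lvx] := H10_L2q Hv; have [_ Lwt Lwx] := H10_L2q Hw.
have [_ Lkt Lkx] := H10_L2q Hk; have [_ Lt Lx] := H10_L2q (H10_lin a Hv Hw).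
have [et ex] := H10_Dlin a Hv Hw.
rewrite /energy (ipq_ael Lt (L2q_lin a Lvt Lwt) Lkt et).
rewrite (ipq_ael Lx (L2q_lin a Lvx Lwx) Lkx ex).
rewrite (ipq_linl a Lvt Lwt Lkt) (ipq_linl a Lvx Lwx Lkx).
exact: energy_arith.
Qed.

Lemma energy_linr v w k a : H10 T v -> H10 T w -> H10 T k ->
  energy k (lin v a w) = energy k v + a * energy k w.
Proof.
by move=> Hv Hw Hk; rewrite energyC (energy_linl a Hv Hw Hk) !(energyC k).
Qed.

Lemma sqr_lin_arith (t x y z : R) : x + t * y + t * (y + t * z) = x + 2 * t * y + t ^+ 2 * z.
Proof. ring. Qed.

Lemma energy_sqr v w a : H10 T v -> H10 T w ->
  energy (lin v a w) (lin v a w) = energy v v + 2 * a * energy v w + a ^+ 2 * energy w w.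
Proof.
move=> Hv Hw; have Hl := H10_lin a Hv Hw.
rewrite (energy_linl a Hv Hw Hl) (energy_linr a Hv Hw Hv) (energy_linr a Hv Hw Hw).
by rewrite (energyC w v) sqr_lin_arith.
Qed.

Lemma energy_CS v w : H10 T v -> H10 T w -> energy v w ^+ 2 <= energy v v * energy w w.
Proof.
move=> Hv Hw; apply: discriminant_le0 => t.
by rewrite -energy_sqr//; exact: energy_ge0.
Qed.

Lemma dt_le_energy v : nQ (Dt v) <= energy v v.
Proof. by rewrite /energy lerDl; exact: ipq_ge0. Qed.

Lemma dx_le_energy v : nQ (Dx v) <= energy v v.
Proof. by rewrite /energy lerDr; exact: ipq_ge0. Qed.

Lemma ipq_lin_ae (f g h : R * R -> R) : L2Q f -> L2Q g -> L2Q h ->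
  {ae mu2, forall p, Q p -> f p = g p + -1 * h p} ->
  nQ f = nQ (fun p => g p - h p).
Proof.
move=> Lf Lg Lh ae; apply: (ipq_sqr_ae Lf (L2qB Lg Lh)).
by apply: ae_imp ae => p h1 Qp; rewrite h1// mulN1r.
Qed.

(** The energy controls the derivatives only; Poincare's inequality makes the functions themselves
    Cauchy, so that all three limits exist in L^2. *)
Lemma energy_complete (v : nat -> R * R -> R) : (forall n, H10 T (v n)) ->
  (forall e, 0 < e -> exists N, forall i j, (N <= i)%N -> (N <= j)%N ->
     energy (lin (v i) (-1) (v j)) (lin (v i) (-1) (v j)) <= e) ->
  exists2 m, H10 T m & forall e, 0 < e -> exists N, forall n, (N <= n)%N ->
     energy (lin (v n) (-1) m) (lin (v n) (-1) m) <= e.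
Proof.
move=> Hv Cv.
have L n := H10_L2q (Hv n).
have Lv n : L2Q (v n) by case: (L n).
have Lt n : L2Q (Dt (v n)) by case: (L n).
have Lx n : L2Q (Dx (v n)) by case: (L n).
have Hd i j := H10_lin (-1) (Hv i) (Hv j).
have Et i j : nQ (fun p => Dt (v i) p - Dt (v j) p) = nQ (Dt (lin (v i) (-1) (v j))).
  have [_ L1 _] := H10_L2q (Hd i j); have [et _] := H10_Dlin (-1) (Hv i) (Hv j).
  exact: (esym (ipq_lin_ae L1 (Lt i) (Lt j) et)).
have Ex i j : nQ (fun p => Dx (v i) p - Dx (v j) p) = nQ (Dx (lin (v i) (-1) (v j))).
  have [_ _ L1] := H10_L2q (Hd i j); have [_ ex] := H10_Dlin (-1) (Hv i) (Hv j).
  exact: (esym (ipq_lin_ae L1 (Lx i) (Lx j) ex)).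
have E0 i j : nQ (fun p => v i p - v j p) <=
    16 * T ^+ 2 * energy (lin (v i) (-1) (v j)) (lin (v i) (-1) (v j)).
  have -> : (fun p => v i p - v j p) = lin (v i) (-1) (v j).
    by apply/funext => p; rewrite mulN1r.
  apply: le_trans (poincareq T0 (Hd i j)) _; apply: ler_wpM2l; last exact: dt_le_energy.
  by rewrite mulr_ge0// sqr_ge0.
have T2 : 0 < 16 * T ^+ 2 by rewrite mulr_gt0// exprn_gt0.
have [m Lm Cm] : exists2 g, L2Q g & forall e, 0 < e -> exists N, forall n, (N <= n)%N ->
     nQ (fun x => v n x - g x) <= e.
  apply: (L2q_complete Lv) => e e0.
  have [N hN] := Cv (e / (16 * T ^+ 2)) (divr_gt0 e0 T2).
  exists N => i j Ni Nj; apply: le_trans (E0 i j) _.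
  by rewrite mulrC -ler_pdivlMr//; exact: hN.
have [mt Lmt Cmt] : exists2 g, L2Q g & forall e, 0 < e -> exists N, forall n, (N <= n)%N ->
     nQ (fun x => Dt (v n) x - g x) <= e.
  apply: (L2q_complete Lt) => e e0; have [N hN] := Cv e e0.
  exists N => i j Ni Nj; rewrite Et; exact: le_trans (dt_le_energy _) (hN i j Ni Nj).
have [mx Lmx Cmx] : exists2 g, L2Q g & forall e, 0 < e -> exists N, forall n, (N <= n)%N ->
     nQ (fun x => Dx (v n) x - g x) <= e.
  apply: (L2q_complete Lx) => e e0; have [N hN] := Cv e e0.
  exists N => i j Ni Nj; rewrite Ex; exact: le_trans (dx_le_energy _) (hN i j Ni Nj).
have [Hm mtE mxE] : [/\ H10 T m, {ae mu2, forall p, Q p -> Dt m p = mt p} &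
    {ae mu2, forall p, Q p -> Dx m p = mx p}].
  apply: (H10_closed Lm Lmt Lmx) => e e0.
  have [N1 h1] := Cm _ e0; have [N2 h2] := Cmt _ e0; have [N3 h3] := Cmx _ e0.
  pose n := (N1 + N2 + N3)%N; exists (v n); split; first exact: Hv.
  - by apply: h1; rewrite /n -addnA leq_addr.
  - by apply: h2; rewrite /n addnAC leq_addl.
  - by apply: h3; rewrite /n leq_addl.
exists m => // e e0; have e2 : 0 < e / 2 by rewrite divr_gt0.
have [N1 h1] := Cmt _ e2; have [N2 h2] := Cmx _ e2.
exists (N1 + N2)%N => n Nn; have Hl := H10_lin (-1) (Hv n) Hm.
have [_ L1 L2'] := H10_L2q Hl; have [_ Lmt' Lmx'] := H10_L2q Hm.
have [et ex] := H10_Dlin (-1) (Hv n) Hm.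
have F1 : nQ (Dt (lin (v n) (-1) m)) <= e / 2.
  rewrite (ipq_lin_ae L1 (Lt n) Lmt' et).
  rewrite (ipq_sqr_ae (L2qB (Lt n) Lmt') (L2qB (Lt n) Lmt)).
    by apply: h1; apply: leq_trans Nn; rewrite leq_addr.
  by apply: ae_imp mtE => p hp Qp; rewrite hp.
have F2 : nQ (Dx (lin (v n) (-1) m)) <= e / 2.
  rewrite (ipq_lin_ae L2' (Lx n) Lmx' ex).
  rewrite (ipq_sqr_ae (L2qB (Lx n) Lmx') (L2qB (Lx n) Lmx)).
    by apply: h2; apply: leq_trans Nn; rewrite leq_addl.
  by apply: ae_imp mxE => p hp Qp; rewrite hp.
rewrite /energy [leRHS](splitr e); exact: lerD F1 F2.
Qed.

Lemma energy_dist v w : H10 T v -> H10 T w ->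
  energy (lin v (-1) w) (lin v (-1) w) = energy v v - 2 * energy v w + energy w w.
Proof. by move=> Hv Hw; rewrite (energy_sqr (-1) Hv Hw) mulrN1 mulNr sqrrN expr1n mul1r. Qed.

(** The parallelogram argument: two almost minimal elements are close, because their midpoint has
    energy at least [d]. *)
Lemma midpoint_arith (x y z d r s : R) : x <= d + r -> y <= d + s ->
  d <= x + 2 * 2^-1 * (z + -1 * x) + 2^-1 ^+ 2 * (y - 2 * z + x) ->
  x - 2 * z + y <= 2 * (r + s).
Proof. move=> *; lra. Qed.

Lemma sub_sqr_arith (x y a b e : R) : 0 <= b -> x ^+ 2 <= e * b -> y ^+ 2 <= e * b ->
  (x - y) ^+ 2 <= 4 * b * e.
Proof. by move=> *; have := sqr_ge0 (x + y); lra. Qed.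

(** [K] is affine but not assumed closed, so [m] is only a limit of elements of [K], obtained from a
    minimizing sequence. *)
Lemma affine_projection (K : (R * R -> R) -> Prop) :
  (exists k, K k) -> (forall k, K k -> H10 T k) ->
  (forall v k k' a, K v -> K k -> K k' -> K (lin v a (lin k (-1) k'))) ->
  exists m, [/\ H10 T m, forall k k', K k -> K k' -> energy m (lin k (-1) k') = 0 &
    forall e, 0 < e -> exists2 k, K k & energy (lin k (-1) m) (lin k (-1) m) <= e].
Proof.
move=> [k0 Kk0] KH KA.
pose E := [set energy k k | k in K].
have lE : has_lbound E by exists 0 => _ [k _ <-]; exact: energy_ge0.
have hE : has_inf E by split => //; exists (energy k0 k0); exists k0.
pose d := inf E.
have dk k : K k -> d <= energy k k by move=> Kk; apply: (ge_inf lE); exists k.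
have ex (n : nat) : exists k, K k /\ energy k k <= d + n.+1%:R^-1.
  have n0 : 0 < n.+1%:R^-1 :> R by rewrite invr_gt0.
  by have [_ [k Kk <-] /ltW h] := inf_adherent n0 hE; exists k.
have [v hv] := choice ex.
have Kv n : K (v n) by case: (hv n).
have vd n : energy (v n) (v n) <= d + n.+1%:R^-1 by case: (hv n).
have Hv n : H10 T (v n) by exact: KH.
have small (e : R) : 0 < e -> exists N, forall n, (N <= n)%N -> n.+1%:R^-1 <= e.
  move=> e0; exists (Num.bound e^-1) => n hn.
  rewrite -[e]invrK lef_pV2 ?posrE ?invr_gt0//.
  apply/ltW/(lt_le_trans (archi_boundP _)); first by rewrite invr_ge0 ltW.
  by rewrite ler_nat (leq_trans hn).
(* Each minimizer is almost orthogonal to the directions w of [K]: the quadratic |v_n + t w|^2 - d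
   is nonnegative for all t, which bounds its discriminant. *)
have orth n k k' : K k -> K k' ->
    energy (v n) (lin k (-1) k') ^+ 2 <= n.+1%:R^-1 * energy (lin k (-1) k') (lin k (-1) k').
  move=> Kk Kk'; have Hw := H10_lin (-1) (KH _ Kk) (KH _ Kk').
  apply: (@le_trans _ _ ((energy (v n) (v n) - d) * energy (lin k (-1) k') (lin k (-1) k'))).
    apply: discriminant_le0 => t.
    have := dk _ (KA (v n) k k' t (Kv n) Kk Kk').
    rewrite (energy_sqr t (Hv n) Hw) -subr_ge0 => h; apply: le_trans h _.
    by rewrite le_eqVlt; apply/orP; left; apply/eqP; ring.
  by apply: ler_wpM2r; [exact: energy_ge0|rewrite lerBlDl].
have Cv e : 0 < e -> exists N, forall i j, (N <= i)%N -> (N <= j)%N ->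
    energy (lin (v i) (-1) (v j)) (lin (v i) (-1) (v j)) <= e.
  move=> e0; have [N hN] := small (e / 4) (divr_gt0 e0 (ltr0n _ 4)).
  exists N => i j /hN hi /hN hj; rewrite (energy_dist (Hv i) (Hv j)).
  apply: le_trans (_ : 2 * (i.+1%:R^-1 + j.+1%:R^-1) <= e); last first.
    by rewrite mulrDr; exact: tri_arith.
  apply: (midpoint_arith (vd i) (vd j)).
  (* The midpoint is written v_i + (v_j - v_i) / 2 to match the closure property of [K]. *)
  have := dk _ (KA (v i) (v j) (v i) 2^-1 (Kv i) (Kv j) (Kv i)).
  rewrite (energy_sqr 2^-1 (Hv i) (H10_lin (-1) (Hv j) (Hv i))).
  rewrite (energy_dist (Hv j) (Hv i)) (energy_linr (-1) (Hv j) (Hv i) (Hv i)).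
  by rewrite (energyC (v j) (v i)).
have [m Hm Cm] := energy_complete Hv Cv.
exists m; split; first exact: Hm.
- move=> k k' Kk Kk'; have Hw := H10_lin (-1) (KH _ Kk) (KH _ Kk').
  set w := lin k (-1) k' in Hw *.
  apply/eqP; rewrite -sqrf_eq0 eq_le sqr_ge0 andbT; apply: (small_eq0 (C := 4 * energy w w)) => e e0.
  have [N1 h1] := small e e0; have [N2 h2] := Cm e e0.
  pose n := (N1 + N2)%N.
  have -> : energy m w = energy (v n) w - energy (lin (v n) (-1) m) w.
    by rewrite (energy_linl (-1) (Hv n) Hm Hw); ring.
  apply: sub_sqr_arith (energy_ge0 w) _ _; first exact: 0.
    apply: le_trans (orth n k k' Kk Kk') _; apply: ler_wpM2r; first exact: energy_ge0.
    by apply: h1; rewrite leq_addr.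
  apply: le_trans (energy_CS (H10_lin (-1) (Hv n) Hm) Hw) _.
  by apply: ler_wpM2r; [exact: energy_ge0|apply: h2; rewrite leq_addl].
- move=> e /Cm[N hN]; exists (v N); [exact: Kv|exact: hN].
Qed.

(** By Pythagoras |k - m|^2 = |k|^2 + |m|^2, so elements of [K] close to [m] are themselves
    small. *)
Lemma affine_projection_small (K : (R * R -> R) -> Prop) m : H10 T m ->
  (forall k, K k -> H10 T k) -> (forall k, K k -> energy m k = 0) ->
  (forall e, 0 < e -> exists2 k, K k & energy (lin k (-1) m) (lin k (-1) m) <= e) ->
  forall e, 0 < e -> exists2 k, K k & energy k k <= e.
Proof.
move=> Hm KH mK Km e e0.
have [k Kk hk] := Km e e0; exists k; first exact: Kk.
apply: le_trans hk; rewrite (energy_dist (KH _ Kk) Hm) energyC (mK _ Kk).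
by rewrite mulr0 subr0 lerDl; exact: energy_ge0.
Qed.

End energy.

(** * Smooth functions vanishing on the boundary *)

Section unit_interval.
Context {R : realType}.
Local Notation mu := (@lebesgue_measure R).
Local Notation I := (@I01 R).
Implicit Types (f g h phi : R -> R).
Let mI : measurable I := measurable_itv _.

Lemma L2_smooth1 phi : smooth phi -> L2 mu I phi.
Proof.
move=> sphi; have [M hM] := continuous_itv_bounded 0 1 (smooth_continuous sphi).
apply: (@L2_bdd _ _ _ mu I mI M phi (lebesgue_itv_lty 0 1)); last exact: hM.
exact: smooth_measurable1.
Qed.

Lemma wderiv1_smooth h : smooth h -> wderiv1 h ('D_1 h).
Proof.
move=> sh; have sD := smooth_derive (1 : R) sh.
split; [exact: L2_smooth1|exact: L2_smooth1|move=> f tf].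
have sf := tf.1; have sDf := smooth_derive (1 : R) sf.
have : \int[mu]_(x in I) (h x * 'D_1 f x + 'D_1 h x * f x) = 0.
  rewrite /Rintegral (@eq_integral _ _ _ mu I (fun x => ('D_1 (fun x => h x * f x) x)%:E)).
    rewrite smooth_FTC//; last exact: smoothM.
    rewrite !(test_function_out tf) ?mulr0 ?subrr//;
      by rewrite /I01/= in_itv/= ltxx ?andbF.
  by move=> x _; rewrite smooth_deriveM// [X in _ + X]mulrC.
rewrite RintegralD//; last 2 first.
- by apply: L2_mul => //; exact: L2_smooth1.
- by apply: L2_mul => //; exact: L2_smooth1.
by move/eqP; rewrite addr_eq0 => /eqP.
Qed.

Lemma expRN_mul_le1 (y : R) : 0 <= y -> y * expR (- y) <= 1.
Proof.
move=> y0; rewrite expRN ler_pdivrMr ?expR_gt0// mul1r.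
by apply: le_trans (expR_ge1Dx y); rewrite lerDr.
Qed.

Lemma expRN_mul_sqr_le2 (y : R) : 0 <= y -> y ^+ 2 * expR (- y) <= 2.
Proof.
move=> y0; rewrite expRN ler_pdivrMr ?expR_gt0//.
have := expR_ge1Dxn 1 y0; rewrite (_ : 2`! = 2)%N// => h.
rewrite -ler_pdivrMl// mulrC; apply: le_trans h; lra.
Qed.

(** With y = c / (x - c), writing x = (x - c) + c turns x c / (x - c)^2 into y + y^2; then y e^(-y)
    <= 1 and y^2 e^(-y) <= 2. The bound does not depend on c, which provides the domination in
    [H10_unit_smooth]. *)
Lemma flat2_bound (c x : R) : 0 < c -> 0 < x -> 0 <= x * (c * flat c 2 (x - c)) <= 3.
Proof.
move=> c0 x0; rewrite /flat; case: ifPn => [xc|_]; last by rewrite !mulr0 lexx ler0n.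
have z0 : 0 < (x - c)^-1 by rewrite invr_gt0.
rewrite !mulr_ge0 ?exprn_ge0 ?expR_ge0 ?(ltW c0) ?(ltW x0) ?(ltW z0)//=.
pose y := c * (x - c)^-1.
have y0 : 0 <= y by rewrite mulr_ge0// ltW.
have -> : x * (c * ((x - c)^-1 ^+ 2 * expR (- (c * (x - c)^-1)))) =
    y * expR (- y) + y ^+ 2 * expR (- y).
  rewrite -/y; have -> : x * (c * ((x - c)^-1 ^+ 2 * expR (- y))) =
    (((x - c) * (x - c)^-1) * (c * (x - c)^-1) + (c * (x - c)^-1) ^+ 2) * expR (- y) by ring.
  by rewrite divff ?gt_eqF// mul1r -/y mulrDl.
have := expRN_mul_le1 y0; have := expRN_mul_sqr_le2 y0; lra.
Qed.

Lemma flat2_cvg (x : R) : 0 < x ->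
  (fun n => n.+1%:R^-1 * flat n.+1%:R^-1 2 (x - n.+1%:R^-1)) @ \oo --> (0 : R).
Proof.
move=> x0.
have hx : (fun n => x - n.+1%:R^-1) @ \oo --> x.
  rewrite -[X in _ --> X]subr0; apply: cvgB; first exact: cvg_cst.
  exact: cvg_harmonic_inv.
have h : (fun n => n.+1%:R^-1 * ((x - n.+1%:R^-1)^-1 * (x - n.+1%:R^-1)^-1)) @ \oo --> (0 : R).
  rewrite -[X in _ --> X](mul0r (x^-1 * x^-1)).
  have hv : (fun n => (x - n.+1%:R^-1)^-1) @ \oo --> x^-1 by apply: cvgV => //; rewrite gt_eqF.
  by apply: cvgM; [exact: cvg_harmonic_inv|exact: cvgM].
apply: (squeeze_cvgr _ (cvg_cst 0) h); near=> n.
have c0 : 0 < n.+1%:R^-1 :> R by rewrite invr_gt0.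
rewrite /flat; case: ifPn => [xc|_]; last first.
  by rewrite mulr0 lexx/=; apply: mulr_ge0; [exact: ltW|rewrite -expr2 sqr_ge0].
have z0 : 0 < (x - n.+1%:R^-1)^-1 by rewrite invr_gt0.
rewrite !mulr_ge0 ?exprn_ge0 ?expR_ge0 ?(ltW c0) ?(ltW z0)//=.
rewrite expr2; apply: ler_wpM2l; first exact: ltW.
apply: ler_piMr; first by rewrite mulr_ge0// ltW.
by rewrite -[X in _ <= X]expR0 ler_expR oppr_le0 mulr_ge0 ?(ltW c0) ?(ltW z0).
Unshelve. all: by end_near. Qed.

Lemma derive_cutoff (a b c x : R) : 0 < c -> 'D_1 (cutoff a b c) x =
  c * flat c 2 (x - a - c) * flat c 0 (b - c - x) -
  flat c 0 (x - a - c) * (c * flat c 2 (b - c - x)).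
Proof.
move=> c0.
have -> : cutoff a b c =
    fun x => flat c 0 (1 * x + (- a - c)) * flat c 0 (-1 * x + (b - c)).
  by apply/funext => y; rewrite /cutoff; congr (flat c 0 _ * flat c 0 _); ring.
have s0 := smooth_flat 0 c0.
rewrite smooth_deriveM; [|exact: smooth_affine|exact: smooth_affine].
rewrite !derive_affine//.
have D y : 'D_1 (flat c 0) y = c * flat c 2 y.
  by have := is_derive_flat 0 y c0 => h; rewrite derive_val mul0r subr0.
rewrite !D.
have -> : 1 * x + (- a - c) = x - a - c by ring.
have -> : -1 * x + (b - c) = b - c - x by ring.
ring.
Qed.

Lemma smooth_zero_bound h : smooth h -> h 0 = 0 -> h 1 = 0 ->
  exists2 M, 0 <= M & forall x, I x ->
    [/\ `|h x| <= M, `|'D_1 h x| <= M, `|h x| <= M * x & `|h x| <= M * (1 - x)].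
Proof.
move=> sh h0 h1; have sD := smooth_derive (1 : R) sh.
have cK : compact (`[0, 1]%classic : set R) by exact: segment_compact.
have /compact_bounded[M [_ hM]] :=
  continuous_compact (continuous_subspaceT (smooth_continuous sD)) cK.
have {}hM x : 0 <= x <= 1 -> `|'D_1 h x| <= `|M| + 1.
  move=> x01; apply: (hM (`|M| + 1)); first by rewrite (le_lt_trans (ler_norm _))// ltrDl.
  by exists x => //=; rewrite in_itv.
have lip x y : 0 <= x -> x < y -> y <= 1 -> `|h y - h x| <= (`|M| + 1) * (y - x).
  move=> x0 xy y1.
  have [||z] := @MVT_segment R h ('D_1 h) x y (ltW xy).
  - by move=> z _; apply: derivableP; exact: smooth_derivable.
  - by apply: continuous_subspaceT; exact: smooth_continuous.
  rewrite in_itv/= => /andP[xz zy] ->.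
  rewrite normrM (ger0_norm (x := y - x)) ?subr_ge0 ?(ltW xy)// ler_wpM2r ?subr_ge0 ?(ltW xy)//.
  by apply: hM; rewrite (le_trans x0 xz) (le_trans zy y1).
exists (`|M| + 1) => [|x]; first by rewrite addr_ge0.
rewrite /I01/= in_itv/= => /andP[x0 x1].
have b1 : `|h x| <= (`|M| + 1) * x.
  by have := lip 0 x (lexx _) x0 (ltW x1); rewrite h0 !subr0.
have b2 : `|h x| <= (`|M| + 1) * (1 - x).
  by have := lip x 1 (ltW x0) x1 (lexx _); rewrite h1 sub0r normrN.
split => //.
- by apply: le_trans b1 _; rewrite ler_piMr ?addr_ge0// ltW.
- by apply: hM; rewrite !ltW.
Qed.

(* h is approximated by h * cutoff: the product of h, which is O(x), with the
   derivative of the cutoff, which is O(c / x^2) exp(-c / x), stays bounded. *)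
Lemma H10_unit_smooth h : smooth h -> h 0 = 0 -> h 1 = 0 -> H10_unit h.
Proof.
move=> sh h0 h1; exists ('D_1 h); first exact: wderiv1_smooth.
move=> eps eps0; have [M M0 hM] := smooth_zero_bound sh h0 h1.
have sD := smooth_derive (1 : R) sh.
pose c n : R := n.+1%:R^-1.
have c0 n : 0 < c n by rewrite invr_gt0.
pose f n x := h x * cutoff 0 1 (c n) x.
have sf n : smooth (f n) by apply: smoothM => //; exact: smooth_cutoff.
have tf n : test_function I (f n).
  by apply: test_functionM => //; exact: test_function_cutoff.
have sDf n := smooth_derive (1 : R) (sf n).
pose r n x : R := (h x - f n x) ^+ 2 + ('D_1 h x - 'D_1 (f n) x) ^+ 2.
have sr n : smooth (r n).
  apply: smoothD; under eq_fun do rewrite expr2; apply: smoothM; exact: smoothB.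
(* 7 M = M + 3 M + 3 M: one term from the derivative of [h], and one application of [flat2_bound]
   for each end point. *)
pose B := M ^+ 2 + (7 * M) ^+ 2.
have fD n x : 'D_1 h x - 'D_1 (f n) x = 'D_1 h x * (1 - cutoff 0 1 (c n) x) -
    h x * 'D_1 (cutoff 0 1 (c n)) x.
  rewrite (smooth_deriveM _ _ sh (smooth_cutoff 0 1 (c0 n))); ring.
have hDc n x : h x * 'D_1 (cutoff 0 1 (c n)) x =
    h x * (c n * flat (c n) 2 (x - c n)) * flat (c n) 0 (1 - c n - x) -
    h x * (c n * flat (c n) 2 (1 - x - c n)) * flat (c n) 0 (x - c n).
  rewrite (derive_cutoff _ _ _ (c0 n)) subr0 (_ : 1 - c n - x = 1 - x - c n); ring.
have prodb n (z w u : R) : 0 < z -> `|w| <= M * z -> 0 <= u <= 1 ->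
    `|w * (c n * flat (c n) 2 (z - c n)) * u| <= 3 * M.
  move=> z0 wz /andP[u0 u1].
  have /andP[k0 k3] := flat2_bound (c0 n) z0.
  have k0' : 0 <= c n * flat (c n) 2 (z - c n) by rewrite -(pmulr_rge0 _ z0).
  rewrite normrM (ger0_norm u0) normrM (ger0_norm k0').
  apply: (@le_trans _ _ (`|w| * (c n * flat (c n) 2 (z - c n)))).
    by rewrite ler_piMr// mulr_ge0.
  apply: le_trans (ler_wpM2r k0' wz) _.
  by rewrite -mulrA mulrC; apply: ler_wpM2r.
have rB n x : I x -> `|r n x| <= B.
  move=> Ix; have [b1 b2 b3 b4] := hM x Ix.
  have /andP[x0 x1] : 0 < x < 1 by move: Ix; rewrite /I01/= in_itv.
  have k0 := cutoff_ge0 0 1 (c n) x; have k1 := cutoff_le1 0 1 x (c0 n).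
  rewrite ger0_norm ?addr_ge0 ?sqr_ge0//; apply: lerD.
    rewrite -(real_normK (num_real _)) ler_sqr ?nnegrE//.
    rewrite /f (_ : h x - _ = h x * (1 - cutoff 0 1 (c n) x)); last by ring.
    rewrite normrM (ger0_norm (x := 1 - _)) ?subr_ge0//.
    by apply: le_trans b1; rewrite ler_piMr// lerBlDr lerDl.
  rewrite -(real_normK (num_real _)) ler_sqr ?nnegrE ?mulr_ge0//.
  rewrite fD; apply: le_trans (ler_normB _ _) _.
  have -> : 7 * M = M + (3 * M + 3 * M) by ring.
  apply: lerD.
    rewrite normrM (ger0_norm (x := 1 - _)) ?subr_ge0//.
    by apply: le_trans b2; rewrite ler_piMr// lerBlDr lerDl.
  rewrite hDc; apply: le_trans (ler_normB _ _) _; apply: lerD.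
    by apply: prodb => //; rewrite flat0_ge0 flat0_le1.
  by apply: prodb; [rewrite subr_gt0|exact: b4|rewrite flat0_ge0 flat0_le1].
have cvr x : I x -> (fun n => r n x) @ \oo --> (0 : R).
  move=> Ix; have /andP[x0 x1] : 0 < x < 1 by move: Ix; rewrite /I01/= in_itv.
  have kc : (fun n => cutoff 0 1 (c n) x) @ \oo --> (1 : R).
    have := @cutoff_cvg R 0 1 x; rewrite indicE mem_set//.
  have kc0 : (fun n => 1 - cutoff 0 1 (c n) x) @ \oo --> (0 : R).
    by rewrite -[X in _ --> X](subrr 1); apply: cvgB => //; exact: cvg_cst.
  have f0 (z : R) : 0 < z -> (fun n => flat (c n) 0 (z - c n)) @ \oo --> (1 : R).
    exact: flat_cvg1.
  have a1 : (fun n => h x - f n x) @ \oo --> (0 : R).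
    rewrite (_ : (fun n => _) = (fun n => h x * (1 - cutoff 0 1 (c n) x))).
      by rewrite -[X in _ --> X](mulr0 (h x)); apply: cvgM => //; exact: cvg_cst.
    by apply/funext => n; rewrite /f; ring.
  have x1' : 0 < 1 - x by rewrite subr_gt0.
  have a2 : (fun n => 'D_1 h x - 'D_1 (f n) x) @ \oo --> (0 : R).
    rewrite (_ : (fun n => _) = (fun n => 'D_1 h x * (1 - cutoff 0 1 (c n) x) -
      (h x * (c n * flat (c n) 2 (x - c n)) * flat (c n) 0 ((1 - x) - c n) -
       h x * (c n * flat (c n) 2 ((1 - x) - c n)) * flat (c n) 0 (x - c n)))).
      rewrite -[X in _ --> X](_ : 'D_1 h x * 0 - (h x * 0 * 1 - h x * 0 * 1) = 0); last by ring.
      apply: cvgB; first by apply: cvgM => //; exact: cvg_cst.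
      apply: cvgB; apply: cvgM; try exact: f0; apply: cvgM; try exact: cvg_cst;
        exact: flat2_cvg.
    apply/funext => n; rewrite fD hDc; congr (_ - (_ - _)).
    by congr (_ * flat _ _ _); ring.
  rewrite -[X in _ --> X](_ : 0 * 0 + 0 * 0 = 0 :> R); last by ring.
  by rewrite /r; under eq_fun do rewrite !expr2; apply: cvgD; exact: cvgM.
have Ib : mu.-integrable I (EFin \o cst B).
  by apply: (@Ig_bdd _ _ _ mu I mI `|B| (cst B) (lebesgue_itv_lty 0 1)).
have cvr' : {ae mu, forall x, I x -> r ^~ x @ \oo --> cst 0 x}.
  by apply: aeW => x; exact: cvr.
have := @Rintegral_dct _ _ _ mu I mI r (cst 0) (cst B)
  (fun n => smooth_measurable1 (D := I) (sr n)) (smooth_measurable1 (D := I) (smooth_cst (0 : R))) cvr' Ib rB.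
have -> : \int[mu]_(x in I) cst 0 x = 0 :> R by rewrite /Rintegral integral0.
move=> cv; have : \forall n \near \oo, fine (\int[mu]_(x in I) (r n x)%:E)%E < eps.
  exact: (cvgr_lt 0 cv).
move=> [N _ hN]; have := hN N (leqnn N) => /= hlt.
exists (f N); first exact: tf.
have IrN : mu.-integrable I (EFin \o r N).
  exact: (@Ig_bdd _ _ _ mu I mI B (r N) (lebesgue_itv_lty 0 1)
    (smooth_measurable1 (D := I) (sr N)) (rB N)).
by rewrite -[X in (X < _)%E](fineK (@integrable_fin_num _ _ _ mu I mI _ IrN)) lte_fin.
Qed.

End unit_interval.

(** * Slices, smooth elements of A_0 and the heat operator *)

Section special.
Context {R : realType} (T : R) (T0 : 0 < T).
Local Notation mu := (@lebesgue_measure R).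
Local Notation mu2 := (@mu2 R).
Local Notation RR := (measurableTypeR R * measurableTypeR R)%type.
Local Notation Q := (QT T).
Local Notation L2Q := (L2 mu2 Q).
Implicit Types (u v w g h U W : R * R -> R).
Let mQ : measurable (Q : set RR) := @measurable_QT R T.
Let mI : measurable (I01 : set (measurableTypeR R)) := measurable_itv _.

Lemma test_function_slice (f : R * R -> R) t : test_function Q f ->
  test_function I01 (fun x => f (t, x)).
Proof.
move=> [sf [K [cK KQ K0]]]; split; first exact: smooth_slice.
exists (snd @` K); split.
- apply: continuous_compact => //; apply: continuous_subspaceT => p; exact: cvg_snd.
- by move=> x [p /KQ[_ ?] <-].
- by move=> x nx; apply: K0 => Ktx; apply: nx; exists (t, x).
Qed.

(** Links the slicewise derivatives of [L2_H2_H10] to weak derivatives on the cylinder: slices of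
    test functions are test functions, so the inner integral in x vanishes for almost every t. *)
Lemma wderiv1_slices u w : L2Q u -> L2Q w ->
  {ae mu, forall t : R, (`]0, T[%classic)%R t ->
     wderiv1 (fun x => u (t, x)) (fun x => w (t, x))} -> wderiv T (0, 1) u w.
Proof.
move=> Lu Lw hae; split => // f tf.
have sf := tf.1; have sDf := smooth_derive ((0, 1) : R * R) sf.
have i1 := L2_mul mQ Lu (L2_smooth T sDf).
have i2 := L2_mul mQ Lw (L2_smooth T sf).
apply/eqP; rewrite -subr_eq0 opprK -(RintegralD mQ i1 i2); apply/eqP.
apply: (@fubini_zero _ `]0, T[%classic I01
  (fun p => u p * 'D_(0, 1) f p + w p * f p)) => //; first exact: (IgD mQ i1 i2).
right; apply: ae_imp hae => t /[apply] -[Lut Lwt]/(_ _ (test_function_slice t tf)).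
have sft := smooth_slice t sf.
have Df x : 'D_1 (fun y => f (t, y)) x = 'D_(0, 1) f (t, x).
  by have [_ ->] := derive_slice (smooth_differentiable (t, x) sf); rewrite mul1r.
have j1 : mu.-integrable I01 (EFin \o (fun x => u (t, x) * 'D_(0, 1) f (t, x))).
  have := L2_mul mI Lut (L2_smooth1 (smooth_derive (1 : R) sft)).
  by congr (_.-integrable _ (EFin \o _)); apply/funext => x; rewrite Df.
have j2 := L2_mul mI Lwt (L2_smooth1 sft).
under eq_Rintegral do rewrite Df.
move=> /eqP; rewrite -subr_eq0 opprK -(RintegralD mI j1 j2) => /eqP h.
rewrite -[LHS]fineK; first by congr (_%:E); exact: h.
exact: (integrable_fin_num mI (IgD mI j1 j2)).
Qed.

Lemma L2_H2_H10_wderiv u : L2_H2_H10 T u ->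
  exists w1 w2, wderiv T (0, 1) u w1 /\ wderiv T (0, 1) w1 w2.
Proof.
move=> [Lu [w1 [w2 [L1 L2w hae]]]]; exists w1, w2.
by split; apply: wderiv1_slices => //; apply: ae_imp hae => t /[apply] -[[? ?] _].
Qed.

(** Smooth elements of A_0, see [vanishing_A0]; these are the only variations that the proofs of the
    three statements use. *)
Definition vanishing U : Prop :=
  [/\ smooth U, forall t, U (t, 0) = 0 /\ U (t, 1) = 0
    & forall x, U (0, x) = 0 /\ U (T, x) = 0].

Lemma vanishing_lin U W a : vanishing U -> vanishing W ->
  vanishing (fun p => U p + a * W p).
Proof.
move=> [sU U1 U2] [sW W1 W2]; split.
- by apply: smoothD => //; exact: smoothZ.
- by move=> t; have [-> ->] := U1 t; have [-> ->] := W1 t; rewrite mulr0 addr0.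
- by move=> x; have [-> ->] := U2 x; have [-> ->] := W2 x; rewrite mulr0 addr0.
Qed.

Lemma derive_slice_smooth U t : smooth U ->
  'D_(1 : R) (fun x => U (t, x)) = (fun x => 'D_(0, 1) U (t, x)).
Proof.
move=> sU; apply/funext => x.
by have [_ ->] := derive_slice (smooth_differentiable (t, x) sU); rewrite mul1r.
Qed.

Lemma wderiv1_slice U t : smooth U ->
  wderiv1 (fun x => U (t, x)) (fun x => 'D_(0, 1) U (t, x)).
Proof.
move=> sU; have := wderiv1_smooth (smooth_slice t sU).
by rewrite derive_slice_smooth.
Qed.

Lemma vanishing_A0 U : vanishing U -> A0 T U.
Proof.
move=> [sU U1 U2]; have sx := smooth_derive ((0, 1) : R * R) sU.
have sxx := smooth_derive ((0, 1) : R * R) sx.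
have Wt := wderiv_smooth T0 (or_introl erefl) sU.
have Wx := wderiv_smooth T0 (or_intror erefl) sU.
split.
- split; first exact: L2_smooth.
  exists ('D_(0, 1) U), ('D_(0, 1) ('D_(0, 1) U)).
  split; [exact: L2_smooth|exact: L2_smooth|apply: aeW => t _; split].
    by split; apply: wderiv1_slice.
  by apply: H10_unit_smooth; [exact: smooth_slice|exact: (U1 t).1|exact: (U1 t).2].
- exact: (ex_intro _ _ Wt).
have HU : H1 T U by exact: (conj (ex_intro _ _ Wt) (ex_intro _ _ Wx)).
(* A smooth function is its own approximation: its distance to itself is zero because the chosen
   weak derivatives equal the classical ones almost everywhere. *)
split => // eps eps0; exists U; split => //.
  rewrite (H1dist2E eps HU sU) lte_fin.
  have z g h : {ae mu2, forall p, Q p -> g p = h p} -> L2Q g -> L2Q h ->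
      ip mu2 Q (fun p => g p - h p) (fun p => g p - h p) = 0.
    move=> gh Lg Lh; have Lgh := L2B mQ Lg Lh.
    have Lc := L2_smooth T (smooth_cst (0 : R)).
    rewrite (ip_sqr_ae (g := cst 0) mQ Lgh Lc).
      by rewrite ipE /Rintegral; under eq_integral do rewrite mulr0; rewrite integral0.
    by apply: ae_imp gh => p /[apply] ->; rewrite subrr.
  have LU := L2_smooth T sU.
  have [_ Ldt _] := dt_spec (ex_intro _ _ Wt).
  have [_ Ldx _] := dx_spec (ex_intro _ _ Wx).
  have Lt := L2_smooth T (smooth_derive ((1, 0) : R * R) sU).
  have Lx := L2_smooth T sx.
  rewrite (z U U (aeW _ (fun _ _ => erefl)) LU LU).
  rewrite (z _ _ (dt_ae Wt) Ldt Lt) (z _ _ (dx_ae Wx) Ldx Lx) !addr0.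
  exact: eps0.
rewrite /boundary_norm2.
under eq_integral do rewrite (U1 _).1 (U1 _).2 expr0n addr0.
under [X in (_ + X)%E]eq_integral do rewrite (U2 _).1 (U2 _).2 expr0n addr0.
by rewrite !integral0 adde0 lte_fin.
Qed.

Lemma wderiv_ae e u v g : wderiv T e u g -> L2Q v ->
  {ae mu2, forall p, Q p -> u p = v p} -> wderiv T e v g.
Proof.
move=> [Lu Lg h] Lv uv; split => // f tf; rewrite -(h f tf).
have Lf := L2_smooth T (smooth_derive e tf.1).
by have := ip_ael mQ Lu Lv Lf uv; rewrite !ipE => ->.
Qed.

(** [dt] and [dx] are choices, fixed only up to null sets. Linear operations are done on explicit
    derivatives and carried over to [heat] by [heat_ae]. *)
Definition strong u gt gx gxx :=
  [/\ wderiv T (1, 0) u gt, wderiv T (0, 1) u gx & wderiv T (0, 1) gx gxx].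

Definition heat u : R * R -> R := fun p => dt T u p - dx T (dx T u) p.

Lemma strong_exists u : L2_H2_H10 T u -> dt_in_L2 T u -> exists gt gx gxx, strong u gt gx gxx.
Proof.
by move=> /L2_H2_H10_wderiv[w1 [w2 [h1 h2]]] [g hg]; exists g, w1, w2.
Qed.

Lemma strong_lin u v a ut ux uxx vt vx vxx : strong u ut ux uxx -> strong v vt vx vxx ->
  strong (fun p => u p + a * v p) (fun p => ut p + a * vt p)
    (fun p => ux p + a * vx p) (fun p => uxx p + a * vxx p).
Proof. by move=> [? ? ?] [? ? ?]; split; exact: wderiv_lin. Qed.

Lemma strong_smooth U : smooth U ->
  strong U ('D_(1, 0) U) ('D_(0, 1) U) ('D_(0, 1) ('D_(0, 1) U)).
Proof.
move=> sU; have sx := smooth_derive ((0, 1) : R * R) sU.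
split; [apply: wderiv_smooth|apply: wderiv_smooth|apply: wderiv_smooth] => //; by [left|right].
Qed.

Lemma heat_ae u gt gx gxx : strong u gt gx gxx ->
  [/\ L2q T (heat u), L2q T (fun p => gt p - gxx p) &
      {ae mu2, forall p, Q p -> heat u p = gt p - gxx p}].
Proof.
move=> [ht hx hxx].
have [_ Ldt _] := dt_spec (ex_intro _ _ ht).
have [_ Ldx _] := dx_spec (ex_intro _ _ hx).
have hxx' : wderiv T (0, 1) (dx T u) gxx.
  by apply: wderiv_ae hxx Ldx _; apply: ae_imp (dx_ae hx) => p /[apply].
have [_ Ldxx _] := dx_spec (ex_intro _ _ hxx').
split.
- by rewrite L2qE; exact: (L2B mQ Ldt Ldxx).
- by rewrite L2qE; case: ht => _ L1 _; case: hxx => _ L3 _; exact: (L2B mQ L1 L3).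
- apply: ae_imp (ae_and (dt_ae ht) (dx_ae hxx')) => p [h1 h2] Qp.
  by rewrite /heat h1// h2.
Qed.

End special.

(** Below 1/2, Bernoulli's inequality gives the lower bound 1 - (2 y)^n; above 1/2, the value is at
    most exp(-(2 y)^n), hence at most (2 y)^(-n). This is the step function of the elementary proofs
    of the Stone-Weierstrass theorem. *)
Lemma threshold_cvg {R : realType} (y : R) : 0 <= y <= 1 -> y != 2^-1 ->
  (fun n => (1 - y ^+ n) ^+ (2 ^ n)) @ \oo --> ((y < 2^-1)%R%:R : R).
Proof.
move=> /andP[y0 y1] yh.
have b n : 0 <= 1 - y ^+ n <= 1.
  by rewrite subr_ge0 exprn_ile1//= gerBl exprn_ge0.
have E n : (2 * y) ^+ n = (2 ^ n)%:R * y ^+ n by rewrite exprMn natrX.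
have [ylt|yge] := ltP y 2^-1.
  have h : (fun n => 1 - (2 * y) ^+ n) @ \oo --> (1 : R).
    rewrite -[X in _ --> X]subr0; apply: cvgB; first exact: cvg_cst.
    apply: cvg_expr; rewrite ger0_norm ?mulr_ge0//; lra.
  suff : (fun n : nat => (1 - y ^+ n) ^+ (2 ^ n)) @ \oo --> (1 : R) by [].
  apply: (squeeze_cvgr _ h (cvg_cst (1 : R))); near=> n.
  have /andP[b0 b1] := b n; rewrite exprn_ile1// andbT E.
  elim: (2 ^ n)%N => [|m IH]; first by rewrite expr0 mul0r subr0.
  rewrite exprS; apply: (@le_trans _ _ ((1 - y ^+ n) * (1 - m%:R * y ^+ n))).
    rewrite -natr1; set z := y ^+ n.
    have : 0 <= m%:R * (z * z) by rewrite mulr_ge0// -expr2 sqr_ge0.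
    by nra.
  exact: ler_wpM2l.
have ygt : 2^-1 < y by rewrite lt_neqAle eq_sym yh.
have y2 : 1 < 2 * y by lra.
have h : (fun n => ((2 * y)^-1) ^+ n) @ \oo --> (0 : R).
  by apply: cvg_expr; rewrite ger0_norm ?invr_ge0 ?invf_lt1//; lra.
suff : (fun n : nat => (1 - y ^+ n) ^+ (2 ^ n)) @ \oo --> (0 : R) by [].
apply: (squeeze_cvgr _ (cvg_cst (0 : R)) h); near=> n.
have /andP[b0 b1] := b n; rewrite exprn_ge0//=.
have p0 : 0 < (2 * y) ^+ n by rewrite exprn_gt0//; lra.
rewrite exprVn; apply: (@le_trans _ _ (expR (- (2 * y) ^+ n))).
  rewrite E -mulrN expRM_natl; apply: lerXn2r; rewrite ?nnegrE ?expR_ge0//.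
  exact: expR_ge1Dx.
rewrite expRN lef_pV2 ?posrE ?expR_gt0//.
by apply: le_trans (expR_ge1Dx _); rewrite lerDr.
Unshelve. all: by end_near. Qed.

Lemma smoothX {R : realType} {V : normedModType R} (f : V -> R) n :
  smooth f -> smooth (fun x => f x ^+ n).
Proof.
move=> sf; elim: n => [|n IH]; first exact: smooth_cst.
by under eq_fun do rewrite exprS; exact: smoothM.
Qed.

(** * Moments *)

Section lines.
Context {R : realType}.
Local Notation RR := (measurableTypeR R * measurableTypeR R)%type.

Lemma ae_fst_neq (a : R) : {ae @mu2 R, forall p : RR, p.1 != a}.
Proof.
exists ([set a] `*` setT); split.
- exact: measurableX.
- rewrite /mu2 product_measure1E//.
  exact: (eq_trans (congr1 (fun z => z * _)%E (lebesgue_measure_set1 a)) (mul0e _)).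
- by move=> p /= /negP; rewrite negbK => /eqP.
Qed.

Lemma ae_snd_neq (a : R) : {ae @mu2 R, forall p : RR, p.2 != a}.
Proof.
exists (setT `*` [set a]); split.
- exact: measurableX.
- rewrite /mu2 product_measure1E//.
  exact: (eq_trans (congr1 (fun z => _ * z)%E (lebesgue_measure_set1 a)) (mule0 _)).
- by move=> p /= /negP; rewrite negbK => /eqP.
Qed.

End lines.

Section moments.
Context {R : realType} (T : R) (T0 : 0 < T) (G : R * R -> R).
Local Notation mu2 := (@mu2 R).
Local Notation RR := (measurableTypeR R * measurableTypeR R)%type.
Local Notation Q := (QT T).
Let mQ : measurable (Q : set RR) := @measurable_QT R T.
Context (iG : mu2.-integrable (Q : set RR) (EFin \o (G : RR -> R))).
Let e1 : R * R -> R := fun p => expR p.1.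
(** The sign makes [e2] increasing in x on (0, 1), as [e1] is in t, so that a quadrant is the set
    where both functions lie below a threshold. *)
Let e2 : R * R -> R := fun p => - cos (pi * p.2).
Implicit Types (E F : R * R -> R).

Let se1 : smooth e1. Proof. exact: (smooth_fst smooth_expR). Qed.

Let se2 : smooth e2.
Proof.
apply: (smooth_snd (phi := fun x => - cos (pi * x))).
rewrite (_ : (fun x => _) = fun x => -1 * cos (pi * x + 0)).
  by apply: smoothZ; apply: smooth_affine; exact: smooth_sin_cos.2.
by apply/funext => x; rewrite addr0 mulN1r.
Qed.

Let mom F : R := \int[mu2]_(p in Q) (F p * G p).

Let smooth_integrable F : smooth F ->
  mu2.-integrable (Q : set RR) (EFin \o (fun p : RR => F p * G p)).
Proof.
move=> sF; have [M FM] := smooth_QT_bounded T sF.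
exact: (@Ig_bddM _ _ _ mu2 Q mQ M F G (smooth_measurable (D := Q) sF) FM iG).
Qed.

Let momD a b E F : smooth E -> smooth F ->
  mom (fun p => a * E p + b * F p) = a * mom E + b * mom F.
Proof.
move=> sE sF; have iE := smooth_integrable (smoothZ a sE).
have iF := smooth_integrable (smoothZ b sF).
rewrite /mom; under eq_Rintegral do rewrite mulrDl.
rewrite (RintegralD mQ iE iF).
under eq_Rintegral do rewrite -mulrA.
rewrite (RintegralZl _ mQ (smooth_integrable sE)); congr (_ + _).
under eq_Rintegral do rewrite -mulrA.
by rewrite (RintegralZl _ mQ (smooth_integrable sF)).
Qed.

(** Requiring orthogonality for all monomial multiples at once makes this set of functions stable
    under multiplication by [e1] and [e2]. *)
Let orth F : Prop := smooth F /\ forall j l, mom (fun p => F p * (e1 p ^+ j * e2 p ^+ l)) = 0.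

(** Stability passes to affine images and powers, so it reaches [theta] without expanding it as a
    polynomial. *)
Let stable E := forall F, orth F -> orth (fun p => E p * F p).

Let orth_lin a b E F : orth E -> orth F -> orth (fun p => a * E p + b * F p).
Proof.
move=> [sE hE] [sF hF]; split=> [|j l].
  by apply: smoothD; exact: smoothZ.
have sm : smooth (fun p => e1 p ^+ j * e2 p ^+ l) by apply: smoothM; exact: smoothX.
rewrite (_ : (fun p => _) = fun p => a * (E p * (e1 p ^+ j * e2 p ^+ l)) +
    b * (F p * (e1 p ^+ j * e2 p ^+ l))); last by apply/funext => p; ring.
rewrite momD; [|exact: smoothM|exact: smoothM].
by rewrite hE hF !mulr0 addr0.
Qed.

Let stable1 : stable e1.
Proof.
move=> F [sF hF]; split=> [|j l]; first exact: smoothM.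
rewrite -(hF j.+1 l); congr mom; apply/funext => p; rewrite exprS; ring.
Qed.

Let stable2 : stable e2.
Proof.
move=> F [sF hF]; split=> [|j l]; first exact: smoothM.
rewrite -(hF j l.+1); congr mom; apply/funext => p; rewrite exprS; ring.
Qed.

Let stable_affine a b E : stable E -> stable (fun p => a * E p + b).
Proof.
move=> sE F oF; have := orth_lin a b (sE F oF) oF.
by congr orth; apply/funext => p; ring.
Qed.

Let stableX n E : stable E -> stable (fun p => E p ^+ n).
Proof.
move=> sE F oF; elim: n => [|n IH].
  by move: oF; congr orth; apply/funext => p; rewrite expr0 mul1r.
by have := sE _ IH; congr orth; apply/funext => p; rewrite exprS mulrA.
Qed.

(* For y in [0, 1], (1 - y^n)^(2^n) tends to 1 if y < 1/2 and to 0 if y > 1/2. *)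
Let theta n a b E p : R := (1 - (a * E p + b) ^+ n) ^+ (2 ^ n).

Let stable_theta n a b E : stable E -> stable (theta n a b E).
Proof.
move=> sE; apply: stableX => F oF.
have := stable_affine (-1) 1 (stableX n (stable_affine a b sE)) oF.
by congr orth; apply/funext => p; ring.
Qed.

Lemma exp_cos_moments_ae0 :
  (forall j l, \int[mu2]_(p in Q) (expR p.1 ^+ j * (- cos (pi * p.2)) ^+ l * G p) = 0) ->
  {ae mu2, forall p, Q p -> G p = 0}.
Proof.
move=> h0.
have orth1 : orth (cst 1).
  split=> [|j l]; first exact: smooth_cst.
  by rewrite -[RHS](h0 j l) /mom; apply: eq_Rintegral => p _; rewrite mul1r.
(* Quadrants are subsets of the whole plane, so [G] is extended by zero outside the cylinder. *)
pose GQ : RR -> R := fun p => \1_Q p * G p.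
have GQE D : \int[mu2]_(p in D) GQ p = \int[mu2]_(p in Q) (\1_D p * G p).
  rewrite Rintegral_mkcond [RHS]Rintegral_mkcond; apply: eq_Rintegral => p _.
  rewrite /GQ !patchE !indicE; do 2!case: ifPn => _; by rewrite ?mul0r ?mul1r.
suff : {ae mu2, forall p, GQ p = 0}.
  by apply: ae_imp => p + Qp; rewrite /GQ indicE mem_set// mul1r.
apply: quadrant_integral_ae0.
  move/(integrable_mkcond _ mQ): iG; congr (_.-integrable _ _); apply/funext => p.
  by rewrite /GQ patchE /= indicE; case: ifPn; rewrite ?mul1r ?mul0r.
move=> a b; rewrite GQE.
(* cos(pi x) is monotone on [0, 1] only; clamping b to this interval does not affect x < b for x in
   (0, 1). *)
pose b' := Num.min (Num.max b 0) 1.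
(* The affine images are 1/2 + a1 (e^t - e^a) and 1/2 + (cos(pi b') - cos(pi x)) / 4: they stay in
   [0, 1] on the cylinder and pass 1/2 exactly at t = a and at x = b'. *)
pose a1 := (2 * (expR T + expR a))^-1; pose b1 := 2^-1 - expR a * a1.
pose a2 : R := 4^-1; pose b2 := 2^-1 + cos (pi * b') / 4.
pose k n (p : R * R) := theta n a1 b1 e1 p * (theta n a2 b2 e2 p * cst 1 p).
have ok n : orth (k n) := stable_theta n a1 b1 stable1 (stable_theta n a2 b2 stable2 orth1).
pose f n (p : RR) := k n p * G p.
have f0 n : \int[mu2]_(p in Q) f n p = 0.
  have [_ /(_ 0%N 0%N) H] := ok n.
  rewrite -[RHS]H /mom; apply: eq_Rintegral => p _.
  by rewrite /f !expr0 !mulr1.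
have y1P p : Q p -> [/\ 0 <= a1 * e1 p + b1 <= 1, (a1 * e1 p + b1 < 2^-1) = (p.1 < a)
    & p.1 != a -> a1 * e1 p + b1 != 2^-1].
  move=> [/= tQ _]; have tT : p.1 < T by move: tQ; rewrite in_itv/= => /andP[].
  have eT : expR p.1 < expR T by rewrite ltr_expR.
  have := expR_gt0 T; have := expR_gt0 a; have := expR_gt0 p.1 => ht ha hT.
  have a1D : a1 * (expR T + expR a) = 2^-1.
    by rewrite /a1 invfM mulrAC -mulrA mulfV ?mulr1// gt_eqF// addr_gt0.
  have a10 : 0 < a1 by rewrite invr_gt0 mulr_gt0// addr_gt0.
  have -> : a1 * e1 p + b1 = 2^-1 + a1 * (expR p.1 - expR a) by rewrite /b1 /e1; ring.
  rewrite gtrDl pmulr_rlt0// subr_lt0 ltr_expR; split => //.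
    have h1 : 0 <= a1 * (expR p.1 + expR T) by rewrite mulr_ge0// ?(ltW a10)// ltW// addr_gt0.
    have h2 : 0 <= a1 * (expR T - expR p.1) by rewrite mulr_ge0// ?(ltW a10)// subr_ge0 ltW.
    have h3 : 0 <= a1 * expR a by rewrite mulr_ge0// ltW.
    by apply/andP; split; lra.
  move=> na; rewrite -subr_eq0 addrC addrA addNr add0r mulf_eq0 gt_eqF//= subr_eq0.
  by apply: contra na => /eqP/expR_inj ->.
have b01 : 0 <= b' <= 1.
  by rewrite le_min ler01 le_max lexx orbT ge_min lexx orbT.
have y2P p : Q p -> [/\ 0 <= a2 * e2 p + b2 <= 1, (a2 * e2 p + b2 < 2^-1) = (p.2 < b)
    & p.2 != b' -> a2 * e2 p + b2 != 2^-1].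
  move=> [_]; rewrite /I01/= in_itv/= => /andP[x0 x1].
  have -> : a2 * e2 p + b2 = 2^-1 + (cos (pi * b') - cos (pi * p.2)) / 4.
    by rewrite /b2 /e2 /a2; ring.
  have cosE x y : 0 <= x <= 1 -> 0 <= y <= 1 -> (cos (pi * y) < cos (pi * x)) = (x < y).
    move=> /andP[? ?] /andP[? ?]; rewrite ltr_cos ?ltr_pM2l ?pi_gt0// in_itv/=.
      by rewrite mulr_ge0 ?pi_ge0//= ler_piMr ?pi_ge0.
    by rewrite mulr_ge0 ?pi_ge0//= ler_piMr ?pi_ge0.
  have x01 : 0 <= p.2 <= 1 by rewrite !ltW.
  split.
  - have := cos_geN1 (pi * b'); have := cos_geN1 (pi * p.2).
    have := cos_le1 (pi * b'); have := cos_le1 (pi * p.2).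
    move: (cos _) (cos _) => u w ? ? ? ?; apply/andP; split; lra.
  - rewrite gtrDl pmulr_llt0 ?invr_gt0// subr_lt0 cosE//.
    by rewrite lt_min x1 andbT lt_max (lt_gtF x0) orbF.
  - move=> nb; have : cos (pi * b') != cos (pi * p.2).
      by move: nb; rewrite !neq_lt !cosE// orbC.
    by move: (cos _) (cos _) => u w; apply: contra => /eqP ?; apply/eqP; lra.
have cv : (fun n => \int[mu2]_(p in Q) f n p) @ \oo -->
    \int[mu2]_(p in Q) (\1_(`]-oo, a[%classic `*` `]-oo, b[%classic) p * G p).
  apply: (@Rintegral_dct _ _ _ mu2 Q mQ f _ (fun p => `|G p|)).
  - by move=> n; exact: Ig_measurable (smooth_integrable (ok n).1).
  - have mG := Ig_measurable iG.
    apply: measurable_funM => //; apply: measurable_funTS.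
    by apply: measurable_indic; apply: measurableX; exact: measurable_itv.
  (* The lines t = a and x = b', where [threshold_cvg] says nothing, are null sets. *)
  - apply: ae_imp (ae_and (ae_fst_neq a) (ae_snd_neq b')) => p [pa pb] Qp.
    have [z1 l1 n1] := y1P p Qp; have [z2 l2 n2] := y2P p Qp.
    have t1 := threshold_cvg z1 (n1 pa); have t2 := threshold_cvg z2 (n2 pb).
    rewrite (_ : \1_ _ p = (a1 * e1 p + b1 < 2^-1)%R%:R * ((a2 * e2 p + b2 < 2^-1)%R%:R * 1)).
      by apply: cvgM; [|exact: cvg_cst]; apply: cvgM; [exact: t1|apply: cvgM; [exact: t2|exact: cvg_cst]].
    rewrite l1 l2 mulr1 -natrM mulnb indicE; congr (_%:R); congr nat_of_bool.
    by apply/idP/idP; rewrite ?inE /= !in_itv/= => /andP.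
  - by have := integrable_abse iG.
  - move=> n p Qp; rewrite /f normrM ler_piMl// /k /cst mulr1.
    have [z1 _ _] := y1P p Qp; have [z2 _ _] := y2P p Qp.
    have th (z : R) : 0 <= z <= 1 -> 0 <= (1 - z ^+ n) ^+ (2 ^ n) <= 1.
      move=> /andP[? ?]; have zn : 0 <= 1 - z ^+ n <= 1.
        by rewrite subr_ge0 exprn_ile1//= gerBl exprn_ge0.
      by case/andP: zn => ? ?; rewrite exprn_ge0//= exprn_ile1.
    have /andP[? ?] := th _ z1; have /andP[? ?] := th _ z2.
    by rewrite ger0_norm ?mulr_ge0// mulr_ile1.
have := cvg_lim (@norm_hausdorff _ _) cv; rewrite (_ : (fun n => _) = cst 0).
  by rewrite lim_cst// => <-.
by apply/funext => n; exact: f0.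
Qed.

End moments.

(** * Separated modes *)

Section modes.
Context {R : realType}.
Implicit Types (k j : nat) (x t : R).

(** The summand 0 gives the argument the shape required by [smooth_affine] and [derive_affine]. *)
Definition mode k x : R := sin (k%:R * pi * x + 0).

Lemma smooth_mode k : smooth (mode k).
Proof. by apply: smooth_affine; exact: smooth_sin_cos.1. Qed.

Lemma mode0 x : mode 0 x = 0.
Proof. by rewrite /mode !mul0r addr0 sin0. Qed.

Lemma mode_at0 k : mode k 0 = 0.
Proof. by rewrite /mode mulr0 addr0 sin0. Qed.

Lemma mode_at1 k : mode k 1 = 0.
Proof.
rewrite /mode mulr1 addr0; elim: k => [|k IH]; first by rewrite mul0r sin0.
by rewrite -addn1 natrD mulrDl mul1r sinDpi IH oppr0.
Qed.

Lemma derive2_mode k x : 'D_1 ('D_1 (mode k)) x = - (k%:R * pi) ^+ 2 * mode k x.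
Proof.
have Ds (z : R) : 'D_1 (@sin R) z = cos z by exact: derive_val.
have Dc (z : R) : 'D_1 (@cos R) z = - sin z by exact: derive_val.
have -> : 'D_1 (mode k) = fun x : R => (k%:R * pi) * cos (k%:R * pi * x + 0).
  apply/funext => y; rewrite derive_affine ?Ds//; exact: smooth_sin_cos.1.
rewrite (smooth_deriveZ _ _ _ (smooth_affine _ _ smooth_sin_cos.2)).
rewrite (derive_affine _ _ _ smooth_sin_cos.2) Dc /mode; ring.
Qed.

(** The product formula for sin and cos. Starting at k + 1 keeps the lower neighbour a natural
    number; for k = 0 that neighbour is the zero mode. *)
Lemma mode_mul_cos k x : mode k.+1 x * (- cos (pi * x)) =
  - 2^-1 * mode k.+2 x + - 2^-1 * mode k x.
Proof.
rewrite /mode !addr0.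
have -> : k.+2%:R * pi * x = k.+1%:R * pi * x + pi * x by rewrite -(natr1 k.+1); ring.
have -> : k%:R * pi * x = k.+1%:R * pi * x - pi * x by rewrite -natr1; ring.
rewrite sinD sinB; lra.
Qed.

Definition expmode j t : R := expR (j%:R * t + 0).

Lemma smooth_expmode j : smooth (expmode j).
Proof. by apply: smooth_affine; exact: smooth_expR. Qed.

Lemma derive_expmode j t : 'D_1 (expmode j) t = j%:R * expmode j t.
Proof. rewrite (derive_affine _ _ _ smooth_expR); congr (_ * _); exact: derive_val. Qed.

Lemma expmodeE j t : expmode j t = expR t ^+ j.
Proof. by rewrite /expmode addr0 expRM_natl. Qed.

End modes.

(** * Functions orthogonal to the weighted heat operator *)

Section master.
Context {R : realType} (T : R) (T0 : 0 < T).
Local Notation mu2 := (@mu2 R).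
Local Notation RR := (measurableTypeR R * measurableTypeR R)%type.
Local Notation Q := (QT T).
Local Notation ipQ := (ipq T).
Let mQ : measurable (Q : set RR) := @measurable_QT R T.
Context (g : R -> R) (M : R) (mg : measurable_fun I01 g).
Context (gM : forall x, I01 x -> `|g x| <= M).
Context (v : R * R -> R) (Hv : H10 T v).
Implicit Types (E F U W h : R * R -> R).

Let pair W h : R := ipQ (fun p => g p.2 * W p) h.

Let L2g W : smooth W -> L2q T (fun p => g p.2 * W p).
Proof. by move=> sW; rewrite L2qE; exact: L2_snd_smooth gM sW. Qed.

Let pair_lin a b E F h : smooth E -> smooth F -> L2q T h ->
  pair (fun p => a * E p + b * F p) h = a * pair E h + b * pair F h.
Proof.
move=> sE sF Lh; have LE := L2g sE; have LF := L2g sF.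
rewrite /pair (_ : (fun p => g p.2 * _) = (fun p => (a * (g p.2 * E p)) + b * (g p.2 * F p))).
  rewrite (ipq_linl b (L2qZ a LE) LF Lh); congr (_ + _).
  by move: LE Lh; rewrite ipqE L2qE => LE Lh; rewrite (ipZl mQ a LE Lh).
by apply/funext => p; ring.
Qed.

Let pair_dt W : smooth W -> pair ('D_(1, 0) W) v = - pair W (Dt T v).
Proof.
by move=> sW; rewrite /pair DtE ipqE; exact: (H10_int_dt T0 Hv mg gM sW).
Qed.

(** The cutoff occurs undifferentiated, so it is dominated by 1 and no estimate of its derivative is
    involved. *)
Let cutoff_pair_cvg W h : smooth W -> L2q T h ->
  (fun N => pair (fun p => cutoff 0 T N.+1%:R^-1 p.1 * W p) h) @ \oo --> pair W h.
Proof.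
move=> sW Lh; rewrite /pair ipqE.
have LW := L2g sW; rewrite L2qE in Lh LW.
have iWh := L2_mul mQ LW Lh.
have c0 N : 0 < N.+1%:R^-1 :> R by rewrite invr_gt0.
pose f N (p : RR) := cutoff 0 T N.+1%:R^-1 p.1 * (g p.2 * W p * h p).
have mf N : measurable_fun Q (f N).
  apply: measurable_funM; last exact: (Ig_measurable iWh).
  exact: (smooth_measurable (D := Q) (smooth_fst (smooth_cutoff 0 T (c0 N)))).
have -> : (fun N => ip mu2 Q (fun p => g p.2 * (cutoff 0 T N.+1%:R^-1 p.1 * W p)) h) =
    (fun N => \int[mu2]_(p in Q) f N p).
  apply/funext => N; rewrite ipE; apply: eq_Rintegral => p _; rewrite /f; ring.
rewrite ipE; apply: (@Rintegral_dct _ _ _ mu2 Q mQ f (fun p => g p.2 * W p * h p)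
  (fun p => `|g p.2 * W p * h p|) mf (Ig_measurable iWh)).
- apply: aeW => p [tQ _]; rewrite -[X in _ --> X]mul1r; apply: cvgM; last exact: cvg_cst.
  by have := @cutoff_cvg R 0 T p.1; rewrite indicE mem_set.
- exact: integrable_norm iWh.
- move=> N p _; rewrite /f normrM; apply: ler_piMl => //; exact: cutoff_norm_le1.
Qed.

Context (pair0 : forall U, vanishing T U ->
  pair (fun p => 'D_(1, 0) U p - 'D_(0, 1) ('D_(0, 1) U) p) v = 0).

Let Lv : L2q T v. Proof. by have [] := H10_L2q Hv. Qed.
Let Ldtv : L2q T (Dt T v). Proof. by have [] := H10_L2q Hv. Qed.

(** The hypothesis [pair0] for U = phi(t) sin(k pi x), with the t-derivative already moved onto v so
    that phi can then be replaced by a limit of cutoffs. *)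
Let mode_weak phi k : smooth phi -> phi 0 = 0 -> phi T = 0 ->
  - pair (tensor phi (mode k)) (Dt T v) +
  (k%:R * pi) ^+ 2 * pair (tensor phi (mode k)) v = 0.
Proof.
move=> sphi p0 pT; have sk := smooth_mode (R := R) k; have sW := smooth_tensor sphi sk.
have vW : vanishing T (tensor phi (mode k)).
  split => // z; rewrite /tensor /=; first by rewrite mode_at0 mode_at1 mulr0.
  by rewrite p0 pT !mul0r.
rewrite -pair_dt//; have := pair0 vW.
have Dx1 psi : smooth psi -> 'D_((0, 1) : R * R) (tensor phi psi) = tensor phi ('D_1 psi).
  by move=> spsi; apply/funext => p; rewrite derive_tensor//= mul0r add0r mul1r.
have sD := smooth_derive (1 : R) sk.
have E2 := eq_trans (congr1 (fun F => 'D_((0, 1) : R * R) F) (Dx1 _ sk)) (Dx1 _ sD).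
have sDW := smooth_derive ((1, 0) : R * R) sW.
have := pair_lin 1 ((k%:R * pi) ^+ 2) sDW sW Lv; rewrite mul1r => <- H.
rewrite -[RHS]H; congr (pair _ _); apply/funext => p.
have := congr1 (fun f => f p) E2; rewrite /= => ->.
rewrite mul1r; congr (_ + _); rewrite /tensor derive2_mode; ring.
Qed.

(** e^(jt) does not vanish at 0 and T, so its mode is reached through cutoffs. Moving the
    t-derivative back is legitimate because v vanishes on the boundary, and k > 0 keeps the factor j
    + (k pi)^2 positive even for j = 0. *)
Let expmode_weak j k : (0 < k)%N -> pair (tensor (expmode j) (mode k)) v = 0.
Proof.
move=> k0; set W := tensor _ _.
have sj := smooth_expmode (R := R) j; have sk := smooth_mode (R := R) k.
have sW : smooth W by exact: smooth_tensor.
have l0 : 0 < (k%:R * pi) ^+ 2 :> R by rewrite exprn_gt0// mulr_gt0 ?ltr0n ?pi_gt0.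
have H : - pair W (Dt T v) + (k%:R * pi) ^+ 2 * pair W v = 0.
  have c1 := cutoff_pair_cvg sW Ldtv; have c2 := cutoff_pair_cvg sW Lv.
  have cv : (fun N => - pair (fun p => cutoff 0 T N.+1%:R^-1 p.1 * W p) (Dt T v) +
      (k%:R * pi) ^+ 2 * pair (fun p => cutoff 0 T N.+1%:R^-1 p.1 * W p) v) @ \oo -->
      - pair W (Dt T v) + (k%:R * pi) ^+ 2 * pair W v.
    by apply: cvgD; [exact: cvgN|apply: cvgM => //; exact: cvg_cst].
  have := cvg_lim (@norm_hausdorff _ _) cv => <-.
  rewrite (_ : (fun n => _) = cst 0) ?lim_cst//; apply/funext => N /=.
  have c0 : 0 < N.+1%:R^-1 :> R by rewrite invr_gt0.
  have sc := smooth_cutoff 0 T c0.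
  have := @mode_weak (fun t => cutoff 0 T N.+1%:R^-1 t * expmode j t) k (smoothM sc sj).
  rewrite (_ : tensor _ _ = fun p => cutoff 0 T N.+1%:R^-1 p.1 * W p).
    apply; rewrite cutoff_support ?mul0r//= in_itv/= ?add0r ?sub0r.
      by rewrite leNgt c0.
    by rewrite andbC lerDl leNgt oppr_lt0 c0.
  by apply/funext => p; rewrite /W /tensor; ring.
rewrite -pair_dt// in H.
have E : 'D_((1, 0) : R * R) W = fun p => j%:R * W p + 0 * W p.
  apply/funext => p; rewrite /W derive_tensor//= derive_expmode /tensor; ring.
rewrite E pair_lin// mul0r addr0 -mulrDl in H.
move/eqP: H; rewrite mulf_eq0 gt_eqF/=; first by move/eqP.
by rewrite ltr_wpDl.
Qed.

(** Induction on [l] for all [k] together, since [mode_mul_cos] trades one power of the cosine for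
    the two neighbouring modes; the case k = 0 is trivial. *)
Let power_weak j l k :
  pair (fun p => tensor (expmode j) (mode k) p * (- cos (pi * p.2)) ^+ l) v = 0.
Proof.
have sc : smooth (fun p : R * R => - cos (pi * p.2)).
  apply: (smooth_snd (phi := fun x => - cos (pi * x))).
  rewrite (_ : (fun x => _) = fun x => -1 * cos (pi * x + 0)).
    by apply: smoothZ; apply: smooth_affine; exact: smooth_sin_cos.2.
  by apply/funext => x; rewrite addr0 mulN1r.
have st k' := smooth_tensor (smooth_expmode (R := R) j) (smooth_mode k').
have z0 (F : R * R -> R) : (forall p, F p = 0) -> pair F v = 0.
  move=> F0; have sF : smooth F by rewrite (_ : F = cst 0); [exact: smooth_cst|apply/funext].
  have := pair_lin 0 0 sF sF Lv; rewrite !mul0r addr0 => H; rewrite -[RHS]H.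
  by congr (pair _ _); apply/funext => p; rewrite F0 !mulr0 addr0.
elim: l k => [|l IH] [|k].
- by apply: z0 => p; rewrite /tensor mode0 mulr0 mul0r.
- rewrite -[RHS](@expmode_weak j k.+1)//; congr (pair _ _).
  by apply/funext => p; rewrite expr0 mulr1.
- by apply: z0 => p; rewrite /tensor mode0 mulr0 mul0r.
have s k' : smooth (fun p : R * R => tensor (expmode j) (mode k') p * (- cos (pi * p.2)) ^+ l).
  by apply: smoothM => //; exact: smoothX.
have := pair_lin (- 2^-1) (- 2^-1) (s k.+2) (s k) Lv.
rewrite !IH !mulr0 addr0 => H; rewrite -[RHS]H; congr (pair _ _); apply/funext => p.
rewrite exprS /tensor; have := mode_mul_cos k p.2.
set c := - cos _; move=> E.
have -> : expmode j p.1 * mode k.+1 p.2 * (c * c ^+ l) =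
  expmode j p.1 * (mode k.+1 p.2 * c) * c ^+ l by ring.
rewrite E; ring.
Qed.

(** The modes with k = 1 are the moments of sin(pi x) g v, and sin(pi x) has no zero in (0, 1). *)
Lemma heat_orthogonal_ae0 : {ae mu2, forall p, Q p -> g p.2 * v p = 0}.
Proof.
have s1 : smooth (fun p : R * R => mode 1 p.2) by exact: smooth_snd (smooth_mode 1).
have iG : mu2.-integrable (Q : set RR) (EFin \o (fun p : RR => mode 1 p.2 * (g p.2 * v p))).
  have LW := L2g s1; have L := Lv; rewrite L2qE in LW L.
  have := L2_mul mQ LW L; congr (_.-integrable _ (EFin \o _)).
  by apply/funext => p; ring.
have h0 j l : \int[mu2]_(p in Q) (expR p.1 ^+ j * (- cos (pi * p.2)) ^+ l *
    (mode 1 p.2 * (g p.2 * v p))) = 0.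
  have := power_weak j l 1; rewrite /pair ipqE ipE => H.
  rewrite -[RHS]H; apply: eq_Rintegral => p _; rewrite /tensor expmodeE; ring.
apply: ae_imp (exp_cos_moments_ae0 iG h0) => p + Qp.
move=> /(_ Qp) /eqP; rewrite mulf_eq0 => /orP[|/eqP//].
case: Qp => _; rewrite /I01/= in_itv/= => /andP[x0 x1].
rewrite gt_eqF// /mode mul1r addr0 sin_gt0_pi// mulr_gt0 ?pi_gt0//=.
by rewrite gtr_pMr ?pi_gt0.
Qed.

End master.

Lemma test_function_derive {R : realType} {V : normedModType R} (D : set V)
  (f : V -> R) (e : V) : test_function D f -> test_function D ('D_e f).
Proof.
move=> [sf [K [cK KD f0]]]; split; first exact: smooth_derive.
exists K; split => // x nKx.
rewrite (@near_eq_derive _ _ _ f (cst 0)) ?derive_cst//.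
have oK : open (~` K) by apply: closed_openC; apply: compact_closed.
by near=> y; apply: f0; near: y; exact: open_nbhs_nbhs.
Unshelve. all: by end_near. Qed.

(** The hypothesis gives N (z - N + 2 y) >= y^2 >= 0. For y = e c this bounds the energy from below
    by a line in e. *)
Lemma square_line_arith {R : realFieldType} (N z y : R) : 0 < N ->
  (N - y) ^+ 2 <= z * N -> 2^-1 * N + - y <= 2^-1 * z.
Proof.
move=> N0 h; have : 0 <= N * (z - N + 2 * y).
  have : 0 <= y ^+ 2 by exact: sqr_ge0.
  move: h; rewrite expr2 [y ^+ 2]expr2; nra.
rewrite pmulr_rge0//; lra.
Qed.

(** In this lemma and the similar ones that follow, the identities between integrals enter as
    hypotheses, so that the algebra is done on scalars only. *)
Lemma affine_arith {R : comRingType} (X Y Z S u x y z d t a : R) :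
  X = u + 1 * x -> Y = u + 1 * y -> Z = u + 1 * z -> S = u + 1 * t ->
  t = x + a * d -> d = y + -1 * z -> - X + a * (- Y + -1 * - Z) = - S.
Proof. by move=> -> -> -> -> -> ->; ring. Qed.

Lemma difference_arith {R : realFieldType} (X Y u x z : R) :
  X = u + 1 * x -> Y = u + 1 * z -> z = 0 -> - X + -1 * - Y = 0 -> x = 0.
Proof. by move=> -> -> ->; lra. Qed.

Lemma half_lt {R : realFieldType} (z e : R) : 0 < e -> z <= e -> 2^-1 * z < e.
Proof. lra. Qed.

Lemma duality_arith {R : realFieldType} (X a b c d e e' : R) :
  X = a + -1 * b -> a = - c -> b = d -> d = - e -> e' = e -> - c + e' = 0 -> X = 0.
Proof. lra. Qed.

(** * Correctors *)

Section correctors.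
Context {R : realType} (T : R) (T0 : 0 < T) (omega : set R).
Context (iom : is_interval omega).
Context (om01 : omega `<=` I01).
Local Notation mu2 := (@mu2 R).
Local Notation RR := (measurableTypeR R * measurableTypeR R)%type.
Local Notation Q := (QT T).
Local Notation q := (qT T omega).
Local Notation ipQ := (ipq T).
Local Notation L2Q := (L2q T).
Local Notation lin v a w := (fun p => v p + a * w p).
Let mQ : measurable (Q : set RR) := @measurable_QT R T.
Implicit Types (u v w k h U : R * R -> R).

(** chi as a function of x alone, see [gQ]: the form in which [int_dt_test] accepts it as a
    weight. *)
Let g : R -> R := \1_(~` omega).

Let mom : measurable (omega : set (measurableTypeR R)).
Proof. exact: is_interval_measurable. Qed.

Let mg : measurable_fun I01 (g : measurableTypeR R -> R).
Proof. by apply: measurable_funTS; apply: measurable_indic; exact: measurableC. Qed.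

Let gM x : I01 x -> `|g x| <= 1.
Proof. by move=> _; rewrite /g indicE; case: (_ \in _); rewrite ?normr1 ?normr0. Qed.

Let mg2 : measurable_fun Q (fun p : RR => g p.2).
Proof. exact: measurable_snd_QT. Qed.

Let gMQ (p : RR) : Q p -> `|g p.2| <= 1.
Proof. by case=> _; exact: gM. Qed.

Let gQ p : Q p -> \1_(Q `\` q) p = g p.2.
Proof.
move=> Qp; rewrite /g !indicE; congr (_%:R); congr nat_of_bool.
apply/idP/idP; rewrite !inE.
  by move=> [_ nq] o; apply: nq; split => //; case: Qp.
by move=> no; split => // -[].
Qed.

Let src u : R * R -> R := fun p => g p.2 * heat T u p.

Let L2g h : L2Q h -> L2Q (fun p => g p.2 * h p).
Proof. by rewrite L2qE => Lh; exact: (L2_bddM mQ mg2 gMQ Lh). Qed.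

Let strong1 u := exists ut ux uxx, strong T u ut ux uxx.

Let L2src u : strong1 u -> L2Q (src u).
Proof. by move=> [ut [ux [uxx /(heat_ae)[Lh _ _]]]]; exact: L2g. Qed.

Let strong1_lin u U a : strong1 u -> strong1 U -> strong1 (lin u a U).
Proof.
move=> [ut [ux [uxx su]]] [Ut [Ux [Uxx sU]]].
exact: (ex_intro _ _ (ex_intro _ _ (ex_intro _ _ (strong_lin a su sU)))).
Qed.

Let src_lin u U a w : strong1 u -> strong1 U -> L2Q w ->
  ipQ (src (lin u a U)) w = ipQ (src u) w + a * ipQ (src U) w.
Proof.
move=> su sU Lw; have Lu := L2src su; have LU := L2src sU.
rewrite -(ipq_linl a Lu LU Lw); have Llin := L2src (strong1_lin a su sU).
case: su => ut [ux [uxx su]]; case: sU => Ut [Ux [Uxx sU]].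
have [Lh _ h] := heat_ae (strong_lin a su sU).
have [_ _ hu] := heat_ae su; have [_ _ hU] := heat_ae sU.
apply: (ipq_ael Llin (L2q_lin a Lu LU) Lw).
apply: ae_imp (ae_and h (ae_and hu hU)) => p [h1 [h2 h3]] Qp.
rewrite /src h1// h2// h3//; ring.
Qed.

Let strong1_vanishing U : vanishing T U -> strong1 U.
Proof.
move=> [sU _ _]; exact: (ex_intro _ _ (ex_intro _ _ (ex_intro _ _ (strong_smooth T0 sU)))).
Qed.

Lemma energyE v w : H10 T v -> H10 T w ->
  energy T v w = \int[mu2]_(p in Q) (dt T v p * dt T w p + dx T v p * dx T w p).
Proof.
move=> /H10_L2[_ a b] /H10_L2[_ c d].
have i1 := L2_mul mQ a c; have i2 := L2_mul mQ b d.
rewrite /energy DtE DxE ipqE.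
exact: (eq_trans (f_equal2 +%R (ipE mu2 Q (dt T v) (dt T w)) (ipE mu2 Q (dx T v) (dx T w)))
  (esym (RintegralD mQ i1 i2))).
Qed.

Lemma is_correctorP u v : is_corrector T omega u v <->
  H10 T v /\ forall w, H10 T w -> energy T v w = - ipQ (src u) w.
Proof.
have S w : \int[mu2]_(p in Q) (\1_(Q `\` q) p * (dt T u p - dx T (dx T u) p) * w p) =
    ipQ (src u) w.
  by rewrite ipqE ipE; apply: eq_Rintegral => p; rewrite inE => Qp; rewrite gQ.
split=> -[Hv h]; split => // w Hw; have := h w Hw.
  by rewrite S (energyE Hv Hw).
by rewrite S -(energyE Hv Hw).
Qed.

Let no_corrector u : ~ (exists v, is_corrector T omega u v) -> corrector T omega u = cst 0.
Proof. by move=> nv; apply: xgetPN => v cv; apply: nv; exists v. Qed.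

Let ET_energy u : H10 T (corrector T omega u) ->
  ET T omega u = 2^-1 * energy T (corrector T omega u) (corrector T omega u).
Proof.
move=> Hc; by rewrite (energyE Hc Hc) /ET; congr (_ * _).
Qed.

Let H10_0 : H10 T (cst 0 : R * R -> R).
Proof.
have s0 : smooth (cst 0 : R * R -> R) := smooth_cst 0.
have Wt := wderiv_smooth T0 (or_introl erefl) s0.
have Wx := wderiv_smooth T0 (or_intror erefl) s0.
apply: (H10_of_approx Wt Wx) => eps eps0; exists (cst 0).
have z h : ip mu2 Q (fun p => h p - h p) (fun p => h p - h p) <= eps.
  rewrite ipE (@eq_Rintegral _ _ _ mu2 Q (cst 0)).
    by rewrite /Rintegral integral0 ltW.
  by move=> p _; rewrite subrr mulr0.
split; [|exact: z|exact: z|exact: z].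
by split => //; exists set0; split => //; exact: compact0.
Qed.

Let energy_0 : energy T (cst 0) (cst 0) = 0.
Proof.
have := energy_dist H10_0 H10_0.
rewrite (_ : lin _ _ _ = cst 0); first by lra.
by apply/funext => p /=; rewrite mulr0 addr0.
Qed.

(* Without corrector [corrector] is the default value [cst 0]; Lax-Milgram would
   exclude this case, but it is harmless since then E_T(u) = 0. *)
Lemma ET_no_corrector u : ~ (exists v, is_corrector T omega u v) -> ET T omega u = 0.
Proof.
by move=> /no_corrector E; rewrite ET_energy E ?energy_0 ?mulr0.
Qed.

(** Uniqueness of the corrector is used at the level of energies only: testing the equations of v
    and of the chosen corrector c against each other gives |c|^2 = <v, c> = |v|^2. *)
Lemma ET_corrector u v : is_corrector T omega u v -> ET T omega u = 2^-1 * energy T v v.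
Proof.
move=> cv; have cc : is_corrector T omega u (corrector T omega u).
  exact: (xgetPex (cst 0) (ex_intro _ _ cv)).
move: cv cc => /is_correctorP[Hv hv] /is_correctorP[Hc hc].
rewrite ET_energy//; congr (_ * _).
by rewrite hc// -hv// energyC hc// -hv.
Qed.

Lemma orthogonal_source_ae0 v : H10 T v ->
  (forall U, vanishing T U -> ipQ (src U) v = 0) -> {ae mu2, forall p, Q p -> g p.2 * v p = 0}.
Proof.
move=> Hv h; apply: (heat_orthogonal_ae0 T0 mg gM Hv) => U vU.
have [_ L ae] := heat_ae (strong_smooth T0 (let: And3 sU _ _ := vU in sU)).
have [Lv _ _] := H10_L2q Hv.
rewrite -[RHS](h U vU); apply: ipq_ael; [exact: L2g|exact: L2src (strong1_vanishing vU)|by []|].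
by apply: ae_imp ae => p h1 Qp; rewrite /src h1.
Qed.

Lemma source_ae0 u v : strong1 u -> H10 T v ->
  {ae mu2, forall p, Q p -> g p.2 * v p = 0} -> ipQ (src u) v = 0.
Proof.
move=> su Hv ae; have [Lv _ _] := H10_L2q Hv.
case: su => ut [ux [uxx su]]; have [Lh _ _] := heat_ae su.
have Lgv := L2g Lv; rewrite L2qE in Lgv Lh; have Lc := L2_smooth T (smooth_cst (0 : R)).
have := ip_ael mQ Lgv Lc Lh ae; rewrite ipqE !ipE => H.
transitivity (\int[mu2]_(p in Q) (g p.2 * v p * heat T u p)).
  by apply: eq_Rintegral => p _; rewrite /src; ring.
by rewrite H /Rintegral; under eq_integral do rewrite mul0r; rewrite integral0.
Qed.

Lemma strong_A ubar u : L2_H2_H10 T ubar -> dt_in_L2 T ubar -> A T ubar u -> strong1 u.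
Proof.
move=> h1 h2 [U [k1 k2 _] <-].
have s1 : strong1 ubar by exact: strong_exists.
have s2 : strong1 U by exact: strong_exists.
have := strong1_lin 1 s1 s2; congr strong1.
by apply/funext => p /=; rewrite mul1r.
Qed.

(* By Cauchy-Schwarz against v, E_T(u + eps U) lies above a line in eps, with
   equality at eps = 0, and the slope of this line must vanish. *)
Lemma critical_ET0 u : strong1 u -> ET_critical T omega u -> ET T omega u = 0.
Proof.
move=> su crit; have [[v cv]|] := pselect (exists v, is_corrector T omega u v); last first.
  exact: ET_no_corrector.
have [Hv hv] := (is_correctorP u v).1 cv; have [Lv _ _] := H10_L2q Hv.
rewrite (ET_corrector cv); set N := energy T v v.
have [N0|N0] := eqVneq N 0; first by rewrite N0 mulr0.
have Np : 0 < N by rewrite lt_neqAle eq_sym N0 energy_ge0.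
suff : N = 0 by move=> E; rewrite E eqxx in N0.
rewrite /N hv// source_ae0 ?oppr0//; apply: orthogonal_source_ae0 => // U vU.
have sU := strong1_vanishing vU.
set c := ipQ (src U) v.
pose F e := ET T omega (lin u e U).
have dF : is_derive (0 : R) (1 : R) F 0 by exact: crit (vanishing_A0 T0 vU).
have F0 : F 0 = 2^-1 * N.
  rewrite -(ET_corrector cv) /F; congr (ET _ _ _).
  by apply/funext => p; rewrite mul0r addr0.
suff : 0 = - c by move=> /eqP; rewrite eq_sym oppr_eq0 => /eqP.
apply: (is_derive_lower_line dF).
(* Continuity keeps [F] positive near 0, which rules out perturbations without corrector: there [F]
   would be 0 and could lie below the line. *)
have cF : F @ (0 : R) --> F 0.
  have d0 : derivable F 0 1 by exact: ex_derive.
  by have /derivable1_diffP/differentiable_continuous := d0.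
have : \forall e \near 0, 0 < F e by apply: (cvgr_gt (F 0) cF); rewrite F0 mulr_gt0.
apply: filterS => e Fe.
have [[k ck]|nk] := pselect (exists k, is_corrector T omega (lin u e U) k); last first.
  by move: Fe; rewrite /F ET_no_corrector// ltxx.
have [Hk hk] := (is_correctorP _ _).1 ck.
rewrite F0 /F (ET_corrector ck).
(* The energy of the perturbed corrector against v is affine in e, whether or not the correctors
   themselves depend nicely on e. *)
have E1 : energy T k v = N - e * c.
  by rewrite (hk v Hv) (src_lin e su sU Lv) opprD /N (hv v Hv).
have := energy_CS Hk Hv; rewrite E1 -/N.
by rewrite mulrN; exact: square_line_arith.
Qed.

Let affine_set ubar k := exists2 U, vanishing T U & is_corrector T omega (lin ubar 1 U) k.

(** Already smooth variations of [ubar] make E_T arbitrarily small. *)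
Lemma small_ET ubar : strong1 ubar ->
  forall eps, 0 < eps -> exists2 U, vanishing T U & ET T omega (lin ubar 1 U) < eps.
Proof.
move=> su eps eps0.
(* If some variation has no corrector, then E_T is 0 there and nothing remains to be shown;
   otherwise the correctors of all smooth variations form an affine space. *)
have [|h] := pselect (forall U, vanishing T U ->
    exists k, is_corrector T omega (lin ubar 1 U) k); last first.
  have [U [vU nU]] : exists U, vanishing T U /\
      ~ exists k, is_corrector T omega (lin ubar 1 U) k.
    by apply/not_existsP => n; apply: h => U vU; apply: contrapT => nk; exact: (n U).
  by exists U => //; rewrite ET_no_corrector.
move=> ex; pose K := affine_set ubar.
have v0 : vanishing T (cst 0) by split => //; exact: smooth_cst.
have KH k : K k -> H10 T k by move=> [U _ /is_correctorP[]].
have K0 : exists k, K k by have [k ck] := ex _ v0; exists k, (cst 0).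
have sK U : vanishing T U -> strong1 (lin ubar 1 U).
  by move=> vU; apply: strong1_lin => //; exact: strong1_vanishing.
have Klin v k k' a : K v -> K k -> K k' -> K (lin v a (lin k (-1) k')).
  move=> [U vU /is_correctorP[Hv hv]] [V vV /is_correctorP[Hk hk]] [W vW /is_correctorP[Hk' hk']].
  exists (lin U a (lin V (-1) W)); first by do 2!apply: vanishing_lin => //.
  have Hd := H10_lin (-1) Hk Hk'.
  apply/is_correctorP; split; first exact: (H10_lin a Hv Hd).
  move=> w Hw; have [Lw _ _] := H10_L2q Hw.
  rewrite (energy_linl a Hv Hd Hw) (energy_linl (-1) Hk Hk' Hw) (hv w Hw) (hk w Hw) (hk' w Hw).
  have sU := strong1_vanishing vU; have sV := strong1_vanishing vV.
  have sW := strong1_vanishing vW; have sd := strong1_lin (-1) sV sW.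
  exact: (affine_arith (src_lin 1 su sU Lw) (src_lin 1 su sV Lw) (src_lin 1 su sW Lw)
    (src_lin 1 su (strong1_lin a sU sd) Lw) (src_lin a sU sd Lw) (src_lin (-1) sV sW Lw)).
have [m [Hm ort apx]] := affine_projection T0 K0 KH Klin.
have Lm : L2Q m by have [] := H10_L2q Hm.
(* The difference of the correctors of [ubar] + U and of [ubar] has the source of U alone, so
   orthogonality to differences is orthogonality to all these sources. *)
have m0 : {ae mu2, forall p, Q p -> g p.2 * m p = 0}.
  apply: orthogonal_source_ae0 => // U vU.
  have [k ck] := ex _ vU; have [k' ck'] := ex _ v0.
  have := ort k k' (ex_intro2 _ _ U vU ck) (ex_intro2 _ _ _ v0 ck').
  move: ck ck' => /is_correctorP[Hk hk] /is_correctorP[Hk' hk'].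
  have sU := strong1_vanishing vU; have s0 := strong1_vanishing v0.
  rewrite energyC (energy_linl (-1) Hk Hk' Hm) (hk m Hm) (hk' m Hm).
  have z0 : ipQ (src (cst 0)) m = 0.
    have := src_lin (-1) s0 s0 Lm.
    rewrite (_ : lin _ _ _ = cst 0); last by apply/funext => p /=; rewrite mulr0 addr0.
    by move=> ->; rewrite mulN1r subrr.
  exact: (difference_arith (src_lin 1 su sU Lm) (src_lin 1 su s0 Lm) z0).
have mK k : K k -> energy T m k = 0.
  move=> [U vU /is_correctorP[Hk hk]]; rewrite energyC hk// source_ae0 ?oppr0//.
  exact: sK.
have [k [U vU ck] ke] := affine_projection_small Hm KH mK apx eps0.
exists U => //; by rewrite (ET_corrector ck); exact: half_lt.
Qed.

(* The end points of omega, at which omega may be closed, are negligible. *)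
Lemma dx_ae0_control v : H1 T v -> {ae mu2, forall p, q p -> v p = 0} ->
  {ae mu2, forall p, q p -> dx T v p = 0}.
Proof.
move=> Hv v0; have [om0|om0] := pselect (omega !=set0); last first.
  by apply: aeW => p [_ op]; exfalso; apply: om0; exists p.2.
have [Lv Ldx hdx] := (H1_wderiv Hv).2.
set a := inf omega; set b := sup omega.
have ab x : a < x -> x < b -> omega x.
  move=> /(inf_lt om0)[y oy yx] /(sup_gt om0)[z oz xz].
  by apply: (iom oy oz); rewrite !ltW.
have rq : rect 0 T a b `<=` q.
  by move=> p [tp]; rewrite /= in_itv/= => /andP[ax xb]; split => //; exact: ab.
have qQ : q `<=` Q by move=> p [tp /om01 xp]; split.
have rQ := subset_trans rq qQ; have mr := measurable_rect 0 T a b.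
(* Test functions of the open rectangle live where v vanishes, so the weak derivative is orthogonal
   to all of them. *)
have r0 : {ae mu2, forall p, rect 0 T a b p -> dx T v p = 0}.
  apply: test_function_ae0.
    apply: (integrableS mQ mr rQ).
    have := L2_mul mQ Ldx (L2_smooth T (smooth_cst (1 : R))).
    by congr (_.-integrable _ (EFin \o _)); apply/funext => p; rewrite mulr1.
  move=> f tf; have tDf := test_function_derive ((0, 1) : R * R) tf.
  have := hdx f (test_function_sub rQ tf).
  have -> : \int[mu2]_(p in Q) (v p * 'D_(0, 1) f p) = 0.
    have Lc := L2_smooth T (smooth_cst (0 : R)).
    have LDf := L2_smooth T tDf.1.
    have LvD : L2 mu2 Q (fun p => v p * 'D_(0, 1) f p).
      have [M DM] := smooth_QT_bounded T tDf.1.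
      have := L2_bddM mQ (smooth_measurable (D := Q) tDf.1) DM Lv.
      by congr (L2 _ _ _); apply/funext => p; rewrite mulrC.
    have L1 := L2_smooth T (smooth_cst (1 : R)).
    have ae : {ae mu2, forall p, Q p -> v p * 'D_(0, 1) f p = cst 0 p}.
      apply: ae_imp v0 => p h Qp; have [rp|nr] := pselect (rect 0 T a b p).
        by rewrite h ?mul0r//; exact: rq.
      by rewrite (test_function_out tDf nr) mulr0.
    have := ip_ael mQ LvD Lc L1 ae; rewrite !ipE => H.
    transitivity (\int[mu2]_(p in Q) (v p * 'D_(0, 1) f p * cst 1 p)).
      by apply: eq_Rintegral => p _; rewrite mulr1.
    by rewrite H /Rintegral; under eq_integral do rewrite mul0r; rewrite integral0.
  move=> /esym/eqP; rewrite oppr_eq0 => /eqP H; rewrite -[RHS]H.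
  rewrite Rintegral_mkcond [RHS]Rintegral_mkcond; apply: eq_Rintegral => p _.
  rewrite !patchE; case: ifPn => [|np]; first by rewrite inE => /rQ Qp; rewrite mem_set.
  case: ifPn => // _; rewrite (test_function_out tf) ?mulr0//.
  by move=> rp; move: np; rewrite mem_set.
apply: ae_imp (ae_and r0 (ae_and (ae_snd_neq a) (ae_snd_neq b))) => p [h [pa pb]] [tp op].
apply: h; split => //=; rewrite in_itv/= !lt_neqAle eq_sym pa pb/=.
apply/andP; split.
  by apply: ge_inf => //; exists 0 => x /om01; rewrite /I01/= in_itv/= => /andP[/ltW].
by apply: ub_le_sup => //; exists 1 => x /om01; rewrite /I01/= in_itv/= => /andP[_ /ltW].
Qed.

Let ipg_ae h w : L2Q h -> L2Q w -> {ae mu2, forall p, q p -> w p = 0} ->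
  ipQ (fun p => g p.2 * h p) w = ipQ h w.
Proof.
move=> Lh Lw w0; have Lgw := L2g Lw.
have E : ipQ (fun p => g p.2 * h p) w = ipQ (fun p => g p.2 * w p) h.
  by rewrite ipqE !ipE; apply: eq_Rintegral => p _; ring.
rewrite E (ipqC T h); apply: (ipq_ael Lgw Lw Lh); apply: ae_imp w0 => p h0 Qp.
have [qp|nq] := pselect (q p); first by rewrite h0 ?mulr0.
by rewrite -gQ// indicE mem_set ?mul1r.
Qed.

Lemma unique_continuation v : H10 T v -> {ae mu2, forall p, q p -> v p = 0} ->
  (forall U, A0 T U ->
     \int[mu2]_(p in Q `\` q) (- U p * dt T v p + dx T U p * dx T v p) = 0) ->
  {ae mu2, forall p, Q p -> v p = 0}.
Proof.
move=> Hv v0 cond; have [Lv Ldt Ldx] := H10_L2q Hv.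
suff h : {ae mu2, forall p, Q p -> g p.2 * v p = 0}.
  apply: ae_imp (ae_and h v0) => p [h1 h2] Qp.
  have [qp|nq] := pselect (q p); first exact: h2.
  by have := h1 Qp; rewrite -gQ// indicE mem_set ?mul1r.
apply: orthogonal_source_ae0 => // U vU; have [sU _ _] := vU.
have st := smooth_derive ((1, 0) : R * R) sU.
have sx := smooth_derive ((0, 1) : R * R) sU.
have sxx := smooth_derive ((0, 1) : R * R) sx.
have Ls F : smooth F -> L2Q F by move=> sF; rewrite L2qE; exact: L2_smooth.
have dx0 : {ae mu2, forall p, q p -> Dx T v p = 0}.
  by rewrite DxE; exact: dx_ae0_control (H10_H1 Hv) v0.
have e1 : ipQ (src U) v = ipQ (fun p => g p.2 * 'D_(1, 0) U p) v
    + -1 * ipQ (fun p => g p.2 * 'D_(0, 1) ('D_(0, 1) U) p) v.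
  have [_ _ ae] := heat_ae (strong_smooth T0 sU).
  have L1 := L2g (Ls _ st); have L2 := L2g (Ls _ sxx).
  rewrite -(ipq_linl (-1) L1 L2 Lv).
  apply: (ipq_ael (L2src (strong1_vanishing vU)) (L2q_lin (-1) L1 L2) Lv).
  by apply: ae_imp ae => p h1 Qp; rewrite /src h1//; ring.
have e2 : ipQ (fun p => g p.2 * 'D_(1, 0) U p) v = - ipQ (fun p => g p.2 * U p) (Dt T v).
  by rewrite DtE ipqE; exact: (H10_int_dt T0 Hv mg gM sU).
(* chi cannot be carried through an integration by parts in x. As v vanishes in [q], the weight is
   dropped here; it is restored in [e5], where v_x vanishes in [q]. *)
have e3 := ipg_ae (Ls _ sxx) Lv v0.
have e4 : ipQ ('D_(0, 1) ('D_(0, 1) U)) v = - ipQ ('D_(0, 1) U) (Dx T v).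
  by rewrite DxE ipqE; exact: (H10_int_dx T0 Hv sx).
have Wx := wderiv_smooth T0 (or_intror erefl) sU.
have [_ LdxU _] := dx_spec (ex_intro _ _ Wx).
have LdxU' : L2Q (dx T U) by rewrite L2qE.
have e5 : ipQ (fun p => g p.2 * dx T U p) (Dx T v) = ipQ ('D_(0, 1) U) (Dx T v).
  rewrite (ipg_ae LdxU' Ldx dx0); exact: (ipq_ael LdxU' (Ls _ sx) Ldx (dx_ae Wx)).
apply: (duality_arith e1 e2 e3 e4 e5).
have LgU := L2g (Ls _ sU); have LgdxU := L2g LdxU'.
have := cond U (vanishing_A0 T0 vU).
rewrite DtE in Ldt *; rewrite DxE in Ldx *; rewrite L2qE in LgU LgdxU Ldt Ldx.
have i1 := L2_mul mQ (L2N mQ LgU) Ldt; have i2 := L2_mul mQ LgdxU Ldx.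
move=> H; rewrite -[RHS]H ipqE.
have n1 := esym (ipNl mQ LgU Ldt); have E1 := eq_trans n1 (ipE mu2 Q _ _).
have E2 := ipE mu2 Q (fun p => g p.2 * dx T U p) (dx T v).
apply: (eq_trans (f_equal2 +%R E1 E2)); apply: (eq_trans (esym (RintegralD mQ i1 i2))).
rewrite Rintegral_mkcond [RHS]Rintegral_mkcond; apply: eq_Rintegral => p _.
rewrite !patchE; have [Qp|nQ] := pselect (Q p); last first.
  by rewrite !memNset//; move=> [].
rewrite (mem_set Qp); case: ifPn => [|nq].
  rewrite inE => qp; have -> : g p.2 = 1 by rewrite -gQ// indicE mem_set.
  ring.
have -> : g p.2 = 0 by rewrite -gQ// indicE (negbTE nq).
by rewrite !mul0r oppr0 mul0r addr0.
Qed.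

End correctors.

Theorem theorem5p1 (R : realType) (T : R) (omega : set R) (ubar : R * R -> R)
    (hT : 0 < T)
    (homega : is_interval omega) (homega01 : omega `<=` I01)
    (hubar : L2_H2_H10 T ubar) (hubart : dt_in_L2 T ubar) :
  let Q := QT T in
  let q := qT T omega in
  let approximately_controllable :=
    forall eps : R, 0 < eps -> exists2 u, A T ubar u & ET T omega u < eps in
  let unique_continuation :=
    forall v, (corrector T omega @` A T ubar) v ->
      {ae mu2, forall p, q p -> v p = 0} ->
      (forall U, A0 T U ->
        \int[mu2]_(p in Q `\` q) (- U p * dt T v p + dx T U p * dx T v p) = 0) ->
      {ae mu2, forall p, Q p -> v p = 0} in
  let error_functional :=
    forall u, A T ubar u -> ET_critical T omega u -> ET T omega u = 0 in
  (approximately_controllable <-> unique_continuation) /\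
  (unique_continuation <-> error_functional).
Proof.
move=> Q q controllable continuation error_functional.
have h1 : controllable.
  move=> eps eps0.
  have [U vU EU] := small_ET hT homega (strong_exists hubar hubart) eps0.
  exists (fun p => ubar p + 1 * U p); last exact: EU.
  exists U; first exact: vanishing_A0.
  by apply/funext => p /=; rewrite mul1r.
have h2 : continuation.
  move=> v [u Au <-]; have [ex|nex] := pselect (exists v, is_corrector T omega u v).
    have [Hv _] := xgetPex (cst 0) ex.
    exact: (unique_continuation hT homega homega01 Hv).
  (* Without corrector, the element of the image is the default value 0, which is the trivial
     solution. *)
  have -> : corrector T omega u = cst 0.
    by apply: xgetPN => w cw; apply: nex; exists w.
  by move=> _ _; exact: aeW.
have h3 : error_functional.
  move=> u Au; exact: (critical_ET0 hT homega (strong_A hubar hubart Au)).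
by split; split.
Qed.
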